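(* Let $n\geq 3$ be a natural number and $(R,\Delta)$ a Hermitian form ring where $R$ is commutative. Let $\sigma\in U_{2n+1}(R,\Delta)$ and let $i,j,k,l\in\Theta_{hb}$ be such that $k\neq\pm l$ and $i\neq\pm j$. Further let $a\in J(\Delta)$. Then (i) $T_{kl}(\sigma_{ij})$ is a product of $160$ elementary unitary $\sigma$-conjugates, (ii) $T_{kl}(\sigma_{i,-i})$ is a product of $320$ elementary unitary $\sigma$-conjugates, (iii) $T_{kl}(\sigma_{i0}a)$ is a product of $480$ elementary unitary $\sigma$-conjugates, (iv) $T_{kl}(\bar a\mu\sigma_{0j})$ is a product of $480$ elementary unitary $\sigma$-conjugates, (v) $T_{kl}(\sigma_{ii}-\sigma_{jj})$ is a product of $480$ elementary unitary $\sigma$-conjugates, (vi) $T_{kl}(\sigma_{ii}-\sigma_{-i,-i})$ is a product of $960$ elementary unitary $\sigma$-conjugates, (vii) $T_{k}(q_1(\sigma_{*j}),\lambda^{-(\epsilon(k)+1)/2}q_2(\sigma_{*j}))$ is a product of $1600n+5764$ elementary unitary $\sigma$-conjugates, and (viii) $T_{k}((\sigma_{00}-\sigma_{jj})a,x)$ is a product of $4800n+16812$ elementary unitary $\sigma$-conjugates for some $x\in R$.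
   Context: Rings are associative with $1\neq0$. For group elements, ${}^{h}g:=hgh^{-1}$. Hermitian rings: a Hermitian ring is a quadruple $(R,\bar{\ },\lambda,\mu)$ where $R$ is a ring, $\bar{\ }:R\to R$ is an anti-isomorphism (bijective, additive, $\overline{xy}=\bar y\bar x$, $\bar 1=1$), $\lambda\in R$ satisfies $\bar{\bar x}=\lambda x\bar\lambda$ for all $x\in R$ (then $\bar\lambda=\lambda^{-1}$), and $\mu\in R$ satisfies $\mu=\bar\mu\lambda$. Heisenberg group: $\mathfrak{H}$ is the set $R\times R$ with group operation $(x_1,y_1)\overset{.}{+}(x_2,y_2):=(x_1+x_2,\,y_1+y_2-\bar x_1\mu x_2)$, equipped with the right action of the multiplicative monoid of $R$ given by $(x,y)\circ a:=(xa,\bar a y a)$. Inverses are denoted using $\overset{.}{-}$. An $R^{\bullet}$-submodule of $\mathfrak{H}$ is a subgroup stable under all $\circ a$, $a\in R$. The trace map is $tr:\mathfrak{H}\to R$, $tr(x,y)=\bar x\mu x+y+\bar y\lambda$. Set $\Delta_{min}:=\{(0,x-\bar x\lambda)\mid x\in R\}$ and $\Delta_{max}:=\ker(tr)$. An odd form parameter is an $R^{\bullet}$-submodule $\Delta$ of $\mathfrak{H}$ with $\Delta_{min}\subseteq\Delta\subseteq\Delta_{max}$. A Hermitian form ring is a pair $((R,\bar{\ },\lambda,\mu),\Delta)$ with $\Delta$ an odd form parameter; it is abbreviated $(R,\Delta)$. Set $J(\Delta):=\{y\in R\mid\exists z\in R:(y,z)\in\Delta\}$, $\Delta^{1}:=\Delta$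 and $\Delta^{-1}:=\{(x,y)\in R\times R\mid(x,\bar y)\in\Delta\}$. Index set: $\Theta:=\{1,\dots,n,0,-n,\dots,-1\}$, $\Theta_{hb}:=\Theta\setminus\{0\}$; for $i\in\Theta_{hb}$, $\epsilon(i)=1$ if $i>0$ and $\epsilon(i)=-1$ if $i<0$. The rows and columns of $(2n+1)\times(2n+1)$ matrices and the coordinates of column vectors $u\in M:=R^{2n+1}$ are indexed by $\Theta$ in the order $1,\dots,n,0,-n,\dots,-1$; $\sigma_{ij}$ is the entry of $\sigma$ at position $(i,j)$ and $\sigma_{*j}$ is the $j$-th column of $\sigma$. Unitary group: define $b:M\times M\to R$ by $b(u,v)=\sum_{i=1}^n\bar u_iv_{-i}+\bar u_0\mu v_0+\sum_{i=-n}^{-1}\bar u_i\lambda v_{-i}$ and $q:M\to\mathfrak{H}$ by $q(u)=(q_1(u),q_2(u)):=(u_0,\sum_{i=1}^n\bar u_iu_{-i})$. Then $$U_{2n+1}(R,\Delta):=\{\sigma\in GL_{2n+1}(R)\mid b(\sigma u,\sigma v)=b(u,v)\ \forall u,v\in M\text{ and }q(\sigma u)\equiv q(u)\bmod\Delta\ \forall u\in M\},$$ where $\alpha\equiv\beta\bmod\Delta$ means $\alpha\overset{.}{-}\beta\in\Delta$. Elementary matrices: let $e$ be the identity matrix and $e^{ij}$ the matrix with $1$ at position $(i,j)$ and $0$ elsewhere. For $i,j\in\Theta_{hb}$, $i\neq\pm j$, $x\in R$ set $$T_{ij}(x):=e+xe^{ij}-\lambda^{(\epsilon(j)-1)/2}\bar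 x\lambda^{(1-\epsilon(i))/2}e^{-j,-i}.$$ For $i\in\Theta_{hb}$ and $(x,y)\in\Delta^{-\epsilon(i)}$ set $$T_i(x,y):=e+xe^{0,-i}-\lambda^{-(1+\epsilon(i))/2}\bar x\mu e^{i0}+ye^{i,-i}.$$ These matrices lie in $U_{2n+1}(R,\Delta)$, and $EU_{2n+1}(R,\Delta)$ is the subgroup of $U_{2n+1}(R,\Delta)$ generated by all of them. Writing $T_k(x,y)$ includes the requirement $(x,y)\in\Delta^{-\epsilon(k)}$. For $\sigma\in U_{2n+1}(R,\Delta)$, an elementary (unitary) $\sigma$-conjugate is a matrix of the form ${}^{\epsilon}\sigma^{\pm1}=\epsilon\sigma^{\pm1}\epsilon^{-1}$ where $\epsilon\in EU_{2n+1}(R,\Delta)$. *)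

(* Defs.v *)
From HB Require Import structures.
From mathcomp Require Import all_boot all_order all_algebra.
From mathcomp Require Import zify.
Set Implicit Arguments.
Unset Strict Implicit.
Unset Printing Implicit Defensive.
Import GRing.Theory.
Local Open Scope ring_scope.

Record hermitianRing (R : nzRingType) := HermitianRing {
  bar : R -> R;
  lam : R;
  mu : R;
  bar_bij : bijective bar;
  barD : forall x y, bar (x + y) = bar x + bar y;
  barM : forall x y, bar (x * y) = bar y * bar x;
  bar1 : bar 1 = 1;
  barK : forall x, bar (bar x) = lam * x * bar lam;
  muE : mu = bar mu * lam
}.

Section HermitianRing.
Variables (R : nzRingType) (H : hermitianRing R).
Local Notation bar := (bar H).
Local Notation lam := (lam H).
Local Notation mu := (mu H).

Lemma lam_barlam : lam * bar lam = 1.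
Proof. by have := barK H 1; rewrite !bar1 mulr1. Qed.

Lemma bar0 : bar 0 = 0.
Proof. by apply: (addrI (bar 0)); rewrite -barD !addr0. Qed.

Lemma barN x : bar (- x) = - bar x.
Proof. by apply: (addrI (bar x)); rewrite -barD !subrr bar0. Qed.

Lemma barlam_lam : bar lam * lam = 1.
Proof.
have hom x y : lam * (x * y) * bar lam = lam * x * (bar lam * lam) * y * bar lam.
  by rewrite -barK !barM !barK !mulrA.
have inj : injective (fun x => bar (bar x)).
  by apply: inj_comp; apply: bij_inj (bar_bij H).
apply: (inj) => /=; rewrite !barK; have := hom 1 1.
by rewrite !mulr1 => ->.
Qed.

(* lam ^ z for an integer z; no partial inverse on R is needed because
   bar lam is the inverse of lam (lam_barlam and barlam_lam). *)
Definition lamz (z : int) : R :=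
  match z with
  | Posz m => lam ^+ m
  | Negz m => bar lam ^+ m.+1
  end.

Definition hadd (p q : R * R) : R * R :=
  (p.1 + q.1, p.2 + q.2 - bar p.1 * mu * q.1).

Definition hopp (p : R * R) : R * R :=
  (- p.1, - p.2 - bar p.1 * mu * p.1).

Definition hact (p : R * R) (a : R) : R * R :=
  (p.1 * a, bar a * p.2 * a).

Lemma haddA : associative hadd.
Proof.
move=> [x1 y1] [x2 y2] [x3 y3]; rewrite /hadd /= addrA barD; congr (_, _).
rewrite !mulrDl mulrDr !opprD !addrA.
by rewrite [LHS](ACl (1*2*5*3*6*4)).
Qed.

Lemma hadd0p p : hadd (0, 0) p = p.
Proof. by case: p => x y; rewrite /hadd /= bar0 !mul0r subr0 !add0r. Qed.

Lemma haddp0 p : hadd p (0, 0) = p.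
Proof. by case: p => x y; rewrite /hadd /= mulr0 subr0 !addr0. Qed.

Lemma haddpN p : hadd p (hopp p) = (0, 0).
Proof.
by case: p => x y; rewrite /hadd /= subrr mulrN opprK addrA subrr sub0r addNr.
Qed.

Lemma haddNp p : hadd (hopp p) p = (0, 0).
Proof.
case: p => x y; rewrite /hadd /= addNr barN !mulNr opprK.
by rewrite addrAC subrK addNr.
Qed.

Definition hsub (p q : R * R) : R * R := hadd p (hopp q).

Definition htr (p : R * R) : R :=
  bar p.1 * mu * p.1 + p.2 + bar p.2 * lam.

Definition Delta_min (p : R * R) : Prop :=
  exists x : R, p = (0, x - bar x * lam).

Definition Delta_max (p : R * R) : Prop := htr p = 0.

Record hsubmodule (D : R * R -> Prop) : Prop := HSubmodule {
  hsubmodule0 : D (0, 0);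
  hsubmoduleD : forall p q, D p -> D q -> D (hadd p q);
  hsubmoduleN : forall p, D p -> D (hopp p);
  hsubmoduleA : forall p a, D p -> D (hact p a)
}.

Record oddFormParameter := OddFormParameter {
  Delta :> R * R -> Prop;
  Delta_hsubmodule : hsubmodule Delta;
  Delta_ge_min : forall p, Delta_min p -> Delta p;
  Delta_le_max : forall p, Delta p -> Delta_max p
}.

(* For d = 1 or d = -1 this is Delta ^ d; no other d occurs. *)
Definition Delta_pow (D : oddFormParameter) (d : int) (p : R * R) : Prop :=
  if d == 1 then D p else D (p.1, bar p.2).

Definition J (D : oddFormParameter) (y : R) : Prop :=
  exists z : R, D (y, z).

End HermitianRing.

(* The index set {1, ..., n, 0, -n, ..., -1}, in this order, is identified with
   the 2n+1 positions 0, ..., 2n; theta_label recovers the label of a position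
   and rev_ord is negation of labels (theta_label_rev). *)
Notation Theta n := 'I_(n.*2.+1).

Section Theta.
Variable n : nat.

Definition theta_label (i : Theta n) : int :=
  if (i < n)%N then i.+1%:Z
  else if (i == n :> nat) then 0
  else i%:Z - (n.*2.+1)%:Z.

Lemma theta0_subproof : (n < n.*2.+1)%N.
Proof. by rewrite ltnS -addnn leq_addr. Qed.

Definition theta0 : Theta n := Ordinal theta0_subproof.

Definition hb (i : Theta n) : bool := i != theta0.

Definition eps (i : Theta n) : int := if (i < n)%N then 1 else -1.

Lemma theta_label_rev (i : Theta n) :
  theta_label (rev_ord i) = - theta_label i.
Proof.
rewrite /theta_label /=; have := ltn_ord i.
by do 4?case: ifP; lia.
Qed.

End Theta.

Section Unitary.
Variables (R : nzRingType) (H : hermitianRing R) (n : nat).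
Local Notation bar := (bar H).
Local Notation lam := (lam H).
Local Notation mu := (mu H).
Local Notation lamz := (lamz H).
Local Notation z0 := (theta0 n).
Local Notation m := (n.*2.+1).

Definition bform (u v : 'cV[R]_m) : R :=
  \sum_(i < m | (i < n)%N) bar (u i 0) * v (rev_ord i) 0
  + bar (u z0 0) * mu * v z0 0
  + \sum_(i < m | (n < i)%N) bar (u i 0) * lam * v (rev_ord i) 0.

Definition q1 (u : 'cV[R]_m) : R := u z0 0.

Definition q2 (u : 'cV[R]_m) : R :=
  \sum_(i < m | (i < n)%N) bar (u i 0) * u (rev_ord i) 0.

Definition qform (u : 'cV[R]_m) : R * R := (q1 u, q2 u).

Definition mx_inverse (A B : 'M[R]_m) : Prop :=
  A *m B = 1%:M /\ B *m A = 1%:M.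

Variable D : oddFormParameter H.

Definition unitary (s : 'M[R]_m) : Prop :=
  [/\ exists t : 'M[R]_m, mx_inverse s t,
      forall u v : 'cV[R]_m, bform (s *m u) (s *m v) = bform u v
    & forall u : 'cV[R]_m, D (hsub H (qform (s *m u)) (qform u))].

Definition Tij (i j : Theta n) (x : R) : 'M[R]_m :=
  1%:M + x *: delta_mx i j
  - (lamz ((eps j - 1) %/ 2)%Z * bar x * lamz ((1 - eps i) %/ 2)%Z)
      *: delta_mx (rev_ord j) (rev_ord i).

Definition Ti (i : Theta n) (x y : R) : 'M[R]_m :=
  1%:M + x *: delta_mx z0 (rev_ord i)
  - (lamz (- ((1 + eps i) %/ 2)%Z) * bar x * mu) *: delta_mx i z0
  + y *: delta_mx i (rev_ord i).

Inductive EU : 'M[R]_m -> Prop :=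
| EU_Tij (i j : Theta n) (x : R) :
    hb i -> hb j -> i != j -> i != rev_ord j -> EU (Tij i j x)
| EU_Ti (i : Theta n) (x y : R) :
    hb i -> Delta_pow D (- eps i) (x, y) -> EU (Ti i x y)
| EU_1 : EU 1%:M
| EU_M (A B : 'M[R]_m) : EU A -> EU B -> EU (A *m B)
| EU_V (A B : 'M[R]_m) : EU A -> mx_inverse A B -> EU B.

Definition elementary_conjugate (s C : 'M[R]_m) : Prop :=
  exists e e' t : 'M[R]_m,
    [/\ EU e, mx_inverse e e', t = s \/ mx_inverse s t
      & C = e *m t *m e'].

Definition product_of_conjugates (N : nat) (s A : 'M[R]_m) : Prop :=
  exists C : 'I_N -> 'M[R]_m,
    (forall p, elementary_conjugate s (C p)) /\ A = \prod_(p < N) C p.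

End Unitary.

(* Main.v *)
Require Import Defs.
From HB Require Import structures.
From mathcomp Require Import all_boot all_order all_algebra.
From mathcomp Require Import zify ring.
Set Implicit Arguments.
Unset Strict Implicit.
Unset Printing Implicit Defensive.
Import GRing.Theory.
Local Open Scope ring_scope.

(* Both kinds of elementary matrices are Siegel transformations
   [siegel e x z], attached to an isotropic vector [e], a vector [x] orthogonal
   to [e] and a scalar [z].  For fixed [e] they multiply as in a Heisenberg
   group, and an isometry [s] conjugates [siegel e x z] to
   [siegel (s e) (s x) z].  Weyl elements move a long root element to any other
   position, so the number of [s]-conjugates it takes depends on its entry only,
   and these numbers add up when entries are added.

   If an elementary [t] fixes [s^-1 e_p], then [s t s^-1] fixes [e_p] and
   [t^-1 (s t s^-1)] is a product of two conjugates; iterated commutators of it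
   with elementary matrices are root elements whose entries are quadratic in the
   entries of [s], at a cost of 16 or 32 conjugates.  Applied to the commutator
   of [s^-1] with a root element of entry [x], where [x] is an entry of [s],
   this produces [x] itself up to a unit and up to entries that are quadratic in
   [s]: 128 conjugates.  The other entries in (ii)-(vi) follow by conjugating
   [s] with an elementary matrix and comparing entries.

   For (vii), [siegel e_p (xi w) 0] times the inverse of [siegel e_p w 0], with
   [xi = s t s^-1], is a product of boundedly many conjugates.  Here [xi w - w]
   is a combination of three columns of [s], its hyperbolic coordinates lie in
   the ideal of the entries treated before, and once they are removed by long
   root elements a product of three short root elements is left, one for each of
   the three columns.  Two of their coefficients are cheap, and the third is
   congruent to any prescribed scalar modulo cheap elements.  Finally (viii)
   compares column [j] of [s] with that of a conjugate of [s] by a short root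
   element. *)

(* Naming a matrix by a variable without a body keeps unification and [done]
   from unfolding it. *)
Lemma named (T : Type) (x : T) : exists y, y = x.
Proof. by exists x. Qed.

Section HermitianFormRing.
Variables (n : nat) (R : comNzRingType) (H : hermitianRing R).
Variable D : oddFormParameter H.
Local Notation m := (n.*2.+1).
Local Notation bar := (bar H).
Local Notation lam := (lam H).
Local Notation mu := (mu H).
Local Notation EU := (@EU R H n D).
Local Notation "0'" := (theta0 n).
Local Notation rv := (@rev_ord m).

(** * Siegel transformations *)

Section SiegelTransformations.
Implicit Types (u v w x y : 'cV[R]_m) (i j k l : Theta n) (s t : 'M[R]_m).

Fact lock_key : unit. Proof. exact: tt. Qed.

(* [bform], the basis vectors and the transvections below are locked: otherwise
   unification keeps unfolding them to sums of matrix entries. *)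
Definition bf u v : R := locked_with lock_key (bform H u v).
Local Notation b := bf.

Lemma bfE u v : bf u v = bform H u v.
Proof. by rewrite /bf unlock. Qed.

Lemma barlamK : lam * bar lam = 1. Proof. exact: lam_barlam. Qed.

Lemma barK' (a : R) : bar (bar a) = a.
Proof. by rewrite barK mulrAC barlamK mul1r. Qed.

Lemma barmu : bar mu = bar lam * mu.
Proof. by rewrite [in RHS]muE; ring: barlamK. Qed.

Lemma bar_sum (I : Type) (r : seq I) (P : pred I) (F : I -> R) :
  bar (\sum_(i <- r | P i) F i) = \sum_(i <- r | P i) bar (F i).
Proof. exact: (big_morph bar (barD H) (bar0 H)). Qed.

Definition barE := (barD, barM, barN, barK', bar0, bar1, barmu).

(** The value of the form on [be i] and [be (rv i)] ([b_opp]). It is a unit with inverse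
    [bar (om i)], and through it both signs of an index are treated uniformly. *)
Definition om (i : Theta n) : R := if (i < n)%N then 1 else lam.

Definition be i : 'cV[R]_m := locked_with lock_key (delta_mx i 0).

Lemma be_delta i : be i = delta_mx i 0. Proof. by rewrite /be unlock. Qed.

Lemma om_bar i : om i * bar (om i) = 1.
Proof. by rewrite /om; case: ifP; rewrite ?bar1 ?mulr1 ?barlamK. Qed.

Lemma hb_lt i : hb i -> (n < i)%N = ~~ (i < n)%N.
Proof. by rewrite /hb -val_eqE /= => h; rewrite -leqNgt ltn_neqAle eq_sym h. Qed.

Lemma rev_lt i : (rev_ord i < n)%N = (n < i)%N.
Proof. by have := ltn_ord i; rewrite /=; lia. Qed.

Lemma hb_rev i : hb (rev_ord i) = hb i.
Proof. by rewrite /hb -!val_eqE /=; have := ltn_ord i; lia. Qed.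

Lemma om_rev i : hb i -> om i * om (rev_ord i) = lam.
Proof.
move=> hi; rewrite /om rev_lt hb_lt //.
by case: ifP; rewrite ?mul1r ?mulr1.
Qed.

Lemma rev0 : rev_ord 0' = 0'.
Proof. by apply/val_inj => /=; lia. Qed.

Lemma bformE u v : b u v =
  \sum_(i | hb i) bar (u i 0) * om i * v (rev_ord i) 0
  + bar (u 0' 0) * mu * v 0' 0.
Proof.
rewrite bfE /bform -addrA [X in _ + X]addrC addrA; congr (_ + _).
rewrite [RHS](bigID (fun i : Theta n => (i < n)%N)) /=; congr (_ + _).
  apply: eq_big => [i|i hi]; last by rewrite /om hi mulr1.
  by rewrite /hb -val_eqE /=; case: ltngtP.
apply: eq_big => [i|i hi]; last by rewrite /om ltnNge ltnW.
by rewrite /hb -val_eqE /=; case: ltngtP.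
Qed.

Lemma bDl u v w : b (u + v) w = b u w + b v w.
Proof.
rewrite !bformE addrACA -big_split /= !mxE barD !mulrDl; congr (_ + _).
by apply: eq_bigr => i _; rewrite !mxE barD !mulrDl.
Qed.

Lemma bDr u v w : b u (v + w) = b u v + b u w.
Proof.
rewrite !bformE addrACA -big_split /= !mxE !mulrDr; congr (_ + _).
by apply: eq_bigr => i _; rewrite !mxE !mulrDr.
Qed.

Lemma bZl a u v : b (a *: u) v = bar a * b u v.
Proof.
rewrite !bformE mulrDr mulr_sumr !mxE barM; congr (_ + _); last by ring.
by apply: eq_bigr => i _; rewrite !mxE barM; ring.
Qed.

Lemma bZr a u v : b u (a *: v) = a * b u v.
Proof.
rewrite !bformE mulrDr mulr_sumr !mxE; congr (_ + _); last by ring.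
by apply: eq_bigr => i _; rewrite !mxE; ring.
Qed.

Lemma bNl u v : b (- u) v = - b u v.
Proof. by rewrite -scaleN1r bZl !barE mulN1r. Qed.

Lemma bNr u v : b u (- v) = - b u v.
Proof. by rewrite -scaleN1r bZr mulN1r. Qed.

Lemma b0l v : b 0 v = 0.
Proof. by rewrite -(scale0r v) bZl !barE mul0r. Qed.

Lemma b0r v : b v 0 = 0.
Proof. by rewrite -(scale0r v) bZr mul0r. Qed.

Definition bE := (bDl, bDr, bZl, bZr, bNl, bNr, b0l, b0r).

(** Reindexing by negation exchanges [om i] and [om (rv i)], whose product is [lam]; the middle
    coordinate is covered by [barmu]. *)
Lemma b_herm u v : b v u = lam * bar (b u v).
Proof.
rewrite !bformE !barE bar_sum mulrDr mulr_sumr; congr (_ + _); last first.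
  by ring: barlamK.
rewrite [LHS](reindex_inj rev_ord_inj) /=; apply: eq_big => i.
  by rewrite hb_rev.
rewrite hb_rev => hi; rewrite rev_ordK !barE -(om_rev hi).
by ring: (om_bar i).
Qed.

Lemma mulmx_be s i : s *m be i = col i s.
Proof. by rewrite be_delta colE. Qed.

Lemma beE i j : be i j 0 = (j == i)%:R.
Proof. by rewrite be_delta mxE andbT. Qed.

Lemma b_bel i v : hb i -> b (be i) v = om i * v (rev_ord i) 0.
Proof.
move=> hi; rewrite bformE (bigD1 i) //= big1 => [|j /andP[_ ji]]; rewrite beE.
  by rewrite eqxx barE [in X in _ + X]beE eq_sym (negPf hi) barE; ring.
by rewrite (negPf ji) barE !mul0r.
Qed.

Lemma b_be0l v : b (be 0') v = mu * v 0' 0.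
Proof.
rewrite bformE big1 => [|j hj]; first by rewrite beE eqxx barE; ring.
by rewrite beE (negPf hj) barE !mul0r.
Qed.

Lemma b_ber i v : hb i -> b v (be i) = om (rev_ord i) * bar (v (rev_ord i) 0).
Proof.
move=> hi; rewrite b_herm b_bel // barM -(om_rev hi).
by ring: (om_bar i).
Qed.

Lemma b_bb i j : hb i -> b (be i) (be j) = (j == rev_ord i)%:R * om i.
Proof. by move=> hi; rewrite b_bel // beE eq_sym mulrC. Qed.

Definition brow u : 'rV[R]_m := \row_j b u (be j).

Lemma vecE v : v = \sum_j v j 0 *: be j.
Proof.
apply/colP=> k; rewrite summxE (bigD1 k) //= big1 => [|j jk].
  by rewrite !mxE beE !eqxx mulr1 addr0.
by rewrite !mxE beE eq_sym (negPf jk) mulr0.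
Qed.

Lemma browE u v : brow u *m v = (b u v)%:M.
Proof.
apply/matrixP=> i j; rewrite !ord1 !mxE /= mulr1n {2}(vecE v).
have h : {morph b u : x y / x + y >-> x + y} by move=> x y; rewrite bDr.
rewrite (big_morph _ h (b0r u)).
by apply: eq_bigr => k _; rewrite mxE bZr mulrC.
Qed.

Lemma mx_ext s t : (forall x, s *m x = t *m x) -> s = t.
Proof.
move=> h; apply/matrixP=> i j; have := h (be j); rewrite !mulmx_be.
by move/colP/(_ i); rewrite !mxE.
Qed.

(* Instances of [mulmxA] with fixed types, much faster to rewrite with. *)
Lemma mulmx_vec (A B : 'M[R]_m) v : A *m B *m v = A *m (B *m v).
Proof. by rewrite mulmxA. Qed.

Lemma mulmx_vecZ (A : 'M[R]_m) (a : R) v : A *m (a *: v) = a *: (A *m v).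
Proof. by rewrite scalemxAr. Qed.

Lemma mulmx_vecD (A : 'M[R]_m) u v : A *m (u + v) = A *m u + A *m v.
Proof. exact: mulmxDr. Qed.

Lemma mulmx_vecN (A : 'M[R]_m) v : A *m (- v) = - (A *m v).
Proof. exact: mulmxN. Qed.

Definition mulmx_vecE := (mulmx_vec, mulmx_vecZ, mulmx_vecD, mulmx_vecN).

Lemma mulmx3 (A B C : 'M[R]_m) : A *m (B *m C) = A *m B *m C.
Proof. exact: mulmxA. Qed.

(* The Siegel transformation attached to a vector [x] orthogonal to the
   isotropic vector [e].  For fixed [e] these multiply like the elements
   [(x, z)] of a Heisenberg group over the whole module (see [siegelM]), and
   both families of elementary matrices are special cases. *)
Definition siegel e x (z : R) : 'M[R]_m :=
  locked_with lock_key
    (1%:M + x *m brow e + bar lam *: (z *: (e *m brow e) - e *m brow x)).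

Lemma siegelE e x z y : siegel e x z *m y =
  y + b e y *: x + (bar lam * (z * b e y - b x y)) *: e.
Proof.
rewrite /siegel unlock !mulmxDl mul1mx -scalemxAl mulmxBl -scalemxAl -!mulmxA !browE.
by rewrite !mul_mx_scalar scalerA -scalerBl scalerA.
Qed.

Definition bisometry s := forall u v, b (s *m u) (s *m v) = b u v.

Ltac vec := apply/colP=> ?; rewrite !mxE; try ring: barlamK.

Lemma siegel_conj s s' e x z : bisometry s -> mx_inverse s s' ->
  s *m siegel e x z *m s' = siegel (s *m e) (s *m x) z.
Proof.
move=> si [ss' s's]; apply: mx_ext => y; rewrite -!mulmxA !siegelE.
have bs u : b u (s' *m y) = b (s *m u) y by rewrite -si mulmxA ss' mul1mx.
by rewrite !bs !mulmxDr -!scalemxAr mulmxA ss' mul1mx.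
Qed.

Lemma siegelM e x z x' z' : b e e = 0 -> b e x = 0 -> b e x' = 0 ->
  siegel e x z *m siegel e x' z' = siegel e (x + x') (z + z' - b x x').
Proof.
move=> ee ex ex'; have xe : b x e = 0 by rewrite b_herm ex !barE mulr0.
apply: mx_ext => y; rewrite -mulmxA !siegelE !bE ?(ee, ex, ex', xe); vec.
Qed.

Lemma siegel00 e : siegel e 0 0 = 1%:M.
Proof. by apply: mx_ext => y; rewrite siegelE mul1mx !bE; vec. Qed.

(** With central parameter 0 the transformation depends only on the wedge of the two vectors, which
    is symmetric up to a unit. *)
Lemma siegel_swap e x : siegel e x 0 = siegel x (- bar lam *: e) 0.
Proof. by apply: mx_ext => y; rewrite !siegelE !bE !barE; vec. Qed.

Lemma siegelZ a e x z :
  siegel (a *: e) x z = siegel e (bar a *: x) (a * bar a * z).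
Proof. by apply: mx_ext => y; rewrite !siegelE !bE !barE; vec. Qed.

Lemma siegel_center e a z : siegel e (a *: e) z = siegel e 0 (z + lam * a - bar a).
Proof. by apply: mx_ext => y; rewrite !siegelE !bE; vec. Qed.

Lemma siegelV e x z : b e e = 0 -> b e x = 0 ->
  mx_inverse (siegel e x z) (siegel e (- x) (- z - b x x)).
Proof.
move=> ee ex; have ex' : b e (- x) = 0 by rewrite bE ex oppr0.
by split; rewrite siegelM // ?subrr ?addNr !bE -[1%:M](siegel00 e);
  congr (siegel _ _ _); ring.
Qed.

(** For [x = a *: be 0'] the last hypothesis is the vanishing of the trace of [(a, z)], see
    [Delta_trace]. *)
Lemma siegel_bisometry e x z : b e e = 0 -> b e x = 0 ->
  b x x + z + lam * bar z = 0 -> bisometry (siegel e x z).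
Proof.
move=> ee ex xz u v; have xe : b x e = 0 by rewrite b_herm ex !barE mulr0.
rewrite !siegelE !bE ?(ee, ex, xe) (b_herm e u) (b_herm x u) !barE.
have -> : bar z = - bar lam * (b x x + z).
  by apply/eqP; rewrite -subr_eq0; apply/eqP; rewrite -[RHS](mulr0 (bar lam)) -xz;
    ring: barlamK.
by ring: barlamK.
Qed.

(** The terms of the central part that mix [e] and [e'] are absorbed by the last factor, a long root
    element when [e] and [e'] are basis vectors at separated indices. *)
Lemma siegelDl e e' x z :
  b e e = 0 -> b e' e' = 0 -> b e e' = 0 -> b x e = 0 -> b x e' = 0 ->
  b x x + z + lam * bar z = 0 ->
  siegel (e + e') x z =
    siegel e x z *m siegel e' x z *m siegel e' (- bar z *: e) 0.
Proof.
move=> ee e'e' ee' xe xe' xz.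
have e'e : b e' e = 0 by rewrite b_herm ee' !barE mulr0.
have ex : b e x = 0 by rewrite b_herm xe !barE mulr0.
have e'x : b e' x = 0 by rewrite b_herm xe' !barE mulr0.
have xx : b x x = - z - lam * bar z.
  by apply/eqP; rewrite -subr_eq0 -[0]xz; apply/eqP; ring.
rewrite -mulmxA; apply: mx_ext => y.
rewrite -!mulmxA !siegelE !bE !barE ?(ee, ee', e'e', xe, xe', e'e, ex, e'x, xx); vec.
Qed.

End SiegelTransformations.
Local Notation b := bf.

(** * Indices of long roots, and elementary matrices as Siegel transformations *)

Section RootIndices.
Implicit Types (u v w x y : 'cV[R]_m) (i j k l : Theta n) (s t A B e : 'M[R]_m).

(** The pairs that index long roots; the relation is symmetric and invariant under a change of sign
    of either index. *)
Definition sep i j := [&& hb i, hb j, i != j & i != rv j].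

Lemma rv_eq i j : (rv i == j) = (i == rv j).
Proof. by rewrite -(inj_eq rev_ord_inj) rev_ordK. Qed.

Lemma rv_neq i : hb i -> rv i != i.
Proof. by rewrite /hb -!val_eqE /=; have := ltn_ord i; lia. Qed.

(** Packed as a tuple of rewrite rules that decide every comparison between one of [i], [rv i] and
    one of [j], [rv j]. *)
Lemma sepP i j : sep i j ->
  (hb i * hb j * hb (rv i) * hb (rv j)) *
  (((i == j) = false) * ((j == i) = false) * ((i == rv j) = false) *
   ((j == rv i) = false) * ((rv i == j) = false) * ((rv j == i) = false) *
   ((rv i == rv j) = false) * ((rv j == rv i) = false)).
Proof.
case/and4P => hi hj ij ij'; rewrite !hb_rev hi hj.
have ji' : (j == rv i) = (i == rv j) by rewrite -rv_eq eq_sym.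
by rewrite !(inj_eq rev_ord_inj) !rv_eq ji' (eq_sym j i) (negPf ij) (negPf ij').
Qed.

Lemma sepC i j : sep i j = sep j i.
Proof. by apply/idP/idP=> /sepP h; rewrite /sep !h. Qed.

Lemma sepNl i j : sep (rv i) j = sep i j.
Proof.
by apply/idP/idP=> /sepP h; move: h; rewrite ?rev_ordK => h; rewrite /sep !h.
Qed.

Lemma sepNr i j : sep i (rv j) = sep i j.
Proof. by rewrite sepC sepNl sepC. Qed.

Lemma delta_mx_mul i j (y : 'cV[R]_m) : delta_mx i j *m y = y j 0 *: be i.
Proof.
rewrite be_delta -(mul_delta_mx (0 : 'I_1)) -mulmxA -rowE; apply/colP=> p.
by rewrite !mxE big_ord_recl big_ord0 !mxE addr0 mulrC.
Qed.

Lemma lamz_eps k l : hb l ->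
  lamz H ((eps (rv l) - 1) %/ 2)%Z * bar (om l) * lamz H ((1 - eps k) %/ 2)%Z
  = bar lam * om k.
Proof.
move=> hl; rewrite /eps /om rev_lt (hb_lt hl).
case: (l < n)%N; case: (k < n)%N; rewrite /= ?barE /= ?expr0 ?expr1.

all: ring.
Qed.

(** The second index is negated because pairing with [be l] reads off the coordinate at [rv l]. *)
Lemma Tij_root k l (x : R) : hb k -> hb l ->
  Tij H k (rv l) x = siegel (be l) ((x * bar (om l)) *: be k) 0.
Proof.
move=> hk hl; rewrite /Tij rev_ordK; apply: mx_ext => y.
rewrite siegelE !bZl !b_bel // mulmxBl mulmxDl mul1mx -!scalemxAl.
rewrite !delta_mx_mul !scalerA; set c := _ * bar x * _.
have -> : c = bar lam * om k * bar (x * bar (om l)).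
  by rewrite -(lamz_eps k hl) /c !barE; ring: (om_bar l).
by apply/colP=> p; rewrite !mxE barE barK'; ring: (om_bar l).
Qed.

(** Scaling [be k] by [om k] keeps the first parameter equal to [x]; the form of the second one
    absorbs the distinction between the two powers of the form parameter ([Delta_pow_short]). *)
Lemma Ti_short k (x c : R) : hb k ->
  Ti H k x (om k * bar lam * c) = siegel (om k *: be k) (x *: be 0') c.
Proof.
move=> hk; rewrite /Ti; apply: mx_ext => y.
rewrite siegelE !bZl b_be0l b_bel //.
rewrite mulmxDl mulmxBl mulmxDl mul1mx -!scalemxAl !delta_mx_mul !scalerA.
have -> : lamz H (- ((1 + eps k) %/ 2)%Z) = bar lam * om k.
  by rewrite /eps /om; case: ifP => _ /=; rewrite ?expr0 ?expr1; ring: (barlamK).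
by apply/colP=> p; rewrite !mxE; ring: (om_bar k).
Qed.

Lemma EU_root k l (x : R) : sep k l -> EU (siegel (be l) (x *: be k) 0).
Proof.
move=> kl; have h := sepP kl.
have -> : x = (x * om l) * bar (om l) by ring: (om_bar l).
rewrite -Tij_root ?h //; apply: EU_Tij; rewrite ?h ?rev_ordK ?h //.
Qed.

(** The two elements differ by a member of [Delta_min]. *)
Lemma Delta_bar (a c : R) : D (a, c) -> D (a, lam * bar c).
Proof.
move=> Dac; have Dm : D (0, - c - bar (- c) * lam).
  by apply: Delta_ge_min; exists (- c).
have := hsubmoduleD (Delta_hsubmodule D) Dac Dm.
by rewrite /hadd /= !barE; congr (D (_, _)); ring.
Qed.

Lemma Delta_pow_short k (a c : R) :
  Delta_pow D (- eps k) (a, om k * bar lam * c) <-> D (a, c).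
Proof.
rewrite /Delta_pow /eps /om; case: (k < n)%N => /=.
  rewrite mul1r !barE; split=> /Delta_bar; rewrite ?barE ?mulrA ?barlamK ?mul1r.
    by [].
  by rewrite mulrC.
by rewrite barlamK mul1r.
Qed.

Lemma EU_short k (a c : R) : hb k -> D (a, c) -> EU (siegel (be k) (a *: be 0') c).
Proof.
move=> hk Dac.
have -> : siegel (be k) (a *: be 0') c
    = siegel (om k *: be k) ((a * om k) *: be 0') c.
  rewrite siegelZ scalerA; congr siegel; first congr (_ *: _);
  by ring: (om_bar k).
rewrite -Ti_short //; apply: EU_Ti => //; apply/Delta_pow_short.
have := hsubmoduleA (Delta_hsubmodule D) (om k) Dac.
by rewrite /hact /=; congr (D (_, _)); ring: (om_bar k).
Qed.

End RootIndices.

(** * Counting conjugates *)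

Section Products.
Implicit Types (s t A B C e : 'M[R]_m).

Lemma mx_inverse_sym A B : mx_inverse A B -> mx_inverse B A.
Proof. by case. Qed.

Lemma mx_inverse_uniq A B C : mx_inverse A B -> mx_inverse A C -> B = C.
Proof. by case=> _ hB [hC _]; rewrite -[B]mulmx1 -hC mulmxA hB mul1mx. Qed.

Lemma mx_inverse_mul A A' B B' :
  mx_inverse A A' -> mx_inverse B B' -> mx_inverse (A *m B) (B' *m A').
Proof.
move=> [AA' A'A] [BB' B'B]; split.
  by rewrite mulmxA -(mulmxA A) BB' mulmx1.
by rewrite mulmxA -(mulmxA B') A'A mulmx1.
Qed.

Lemma mx_inverse_conj A A' B B' :
  mx_inverse A A' -> mx_inverse B B' ->
  mx_inverse (A *m B *m A') (A *m B' *m A').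
Proof.
move=> hA hB; rewrite -(mulmxA A B').
by do 2?apply: mx_inverse_mul => //; apply: mx_inverse_sym.
Qed.

(** An inductive form of [product_of_conjugates], suited to induction on the number of factors. *)
Inductive conj_prod s : nat -> 'M[R]_m -> Prop :=
| conj_prod0 : conj_prod s 0 1%:M
| conj_prodS N C A : elementary_conjugate D s C -> conj_prod s N A ->
    conj_prod s N.+1 (C *m A).

Lemma conj_prodP s N A : conj_prod s N A -> product_of_conjugates D N s A.
Proof.
elim=> [|{}N C {}A hC _ [F [hF ->]]].
  by exists (fun=> 0); split=> [[]//|]; rewrite big_ord0.
exists (fun p => if unlift ord0 p is Some q then F q else C); split.
  by move=> p; case: unliftP => [q|] _.
rewrite big_ord_recl unlift_none; congr (_ * _).
by apply: eq_bigr => p _; rewrite liftK.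
Qed.

Variables (s s' : 'M[R]_m).
Hypothesis ss' : mx_inverse s s'.
Local Notation G := (conj_prod s).

Lemma conj_prod1 C : elementary_conjugate D s C -> G 1 C.
Proof. by move=> hC; rewrite -[C]mulmx1; apply: conj_prodS hC (conj_prod0 s). Qed.

Lemma conj_prodM N M A B : G N A -> G M B -> G (N + M) (A *m B).
Proof.
move=> hA hB; elim: hA => [|{}N C {}A hC _ IH]; first by rewrite mul1mx.
by rewrite -mulmxA; constructor.
Qed.

Lemma elementary_conjugateJ e e' C : EU e -> mx_inverse e e' ->
  elementary_conjugate D s C -> elementary_conjugate D s (e *m C *m e').
Proof.
move=> Ee ee' [f [f' [t [Ef ff' ht ->]]]].
exists (e *m f), (f' *m e'), t; split=> //; first exact: EU_M.
  exact: mx_inverse_mul.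
by rewrite !mulmxA.
Qed.

Lemma conj_prodJ e e' N A : EU e -> mx_inverse e e' ->
  G N A -> G N (e *m A *m e').
Proof.
move=> Ee ee'; elim=> [|{}N C {}A hC _ IH].
  by case: ee' => e1 _; rewrite mulmx1 e1; constructor.
rewrite (_ : e *m _ *m e' = e *m C *m e' *m (e *m A *m e')).
  by constructor=> //; apply: elementary_conjugateJ.
by case: ee' => _ e1; rewrite !mulmxA -[_ *m e' *m e]mulmxA e1 mulmx1.
Qed.

Lemma elementary_conjugateV C : elementary_conjugate D s C ->
  exists2 C', elementary_conjugate D s C' & mx_inverse C C'.
Proof.
case=> [e [e' [t [Ee ee' ht ->]]]].
have [t' [ht' tt']] : exists t', (t' = s \/ mx_inverse s t') /\ mx_inverse t t'.
  case: ht => [->|st]; first by exists s'; split=> //; right.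
  by exists s; split; [left | apply: mx_inverse_sym].
by exists (e *m t' *m e'); [exists e, e', t' | apply: mx_inverse_conj].
Qed.

Lemma conj_prodV N A A' : G N A -> mx_inverse A A' -> G N A'.
Proof.
move=> hA hA'; have [B hB /mx_inverse_uniq/(_ hA') <- //] :
  exists2 B, G N B & mx_inverse A B.
elim: {hA'} hA => [|{}N C {}A /elementary_conjugateV[C' hC' CC'] _ [B hB AB]].
  by exists 1%:M; [constructor | split; rewrite mulmx1].
exists (B *m C'); last exact: mx_inverse_mul.
by rewrite -addn1; apply: conj_prodM => //; apply: conj_prod1.
Qed.

(** The commutator is [A] times an elementary conjugate of its inverse, so a commutator with an
    elementary matrix doubles the count. *)
Lemma conj_prod_comm N A A' e e' : G N A -> mx_inverse A A' -> EU e ->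
  mx_inverse e e' -> G (N * 2) (A *m e *m A' *m e').
Proof.
move=> hA hA' Ee ee'; rewrite muln2 -addnn -mulmxA -(mulmxA A) (mulmxA e).
apply: conj_prodM => //.
by apply: conj_prodJ => //; apply: conj_prodV hA'.
Qed.

Lemma conj_prod_self : G 2 1%:M.
Proof.
have e1 : EU 1%:M := EU_1 _ _; have i1 : mx_inverse 1%:M (1%:M : 'M[R]_m).
  by split; rewrite mulmx1.
rewrite -(proj1 ss'); apply: (@conj_prodM 1 1); apply: conj_prod1.
  by exists 1%:M, 1%:M, s; split; rewrite ?mul1mx ?mulmx1 //; left.
by exists 1%:M, 1%:M, s'; split; rewrite ?mul1mx ?mulmx1 //; right.
Qed.

(** Products of [s] and its inverse fill up the count. Hence a smaller bound of the same parity
    suffices for an exact number of conjugates. *)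
Lemma conj_prod_pad N M A : G N A -> (N <= M)%N -> ~~ odd (M - N) -> G M A.
Proof.
move=> hA /subnKC <-; set k := (M - N)%N; rewrite addKn => k2.
rewrite -(even_halfK k2); elim: (k./2) => [|q IH]; first by rewrite addn0.
by rewrite doubleS -addn2 addnA -[A]mulmx1; apply: conj_prodM IH conj_prod_self.
Qed.

End Products.

Section ProductTransfer.
Variables (s s' : 'M[R]_m).
Hypothesis ss' : mx_inverse s s'.

Lemma conj_prod_trans t t' A k N : mx_inverse t t' ->
  conj_prod s k t -> conj_prod t N A -> conj_prod s (N * k) A.
Proof.
move=> tt' kt; elim=> [|{}N C {}A [e [e' [r [Ee ee' hr ->]]]] _ IH].
  by constructor.
rewrite mulSn; apply: conj_prodM => //; apply: conj_prodJ => //.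
case: hr => [->//|tr]; exact: (conj_prodV ss' kt tr).
Qed.

Lemma conj_prod_commutator (e e' : 'M[R]_m) :
  EU e -> mx_inverse e e' -> conj_prod s 2 (e *m s *m e' *m s').
Proof.
move=> Ee ee'; have e1 : EU 1%:M := EU_1 _ _.
have i1 : mx_inverse 1%:M (1%:M : 'M[R]_m) by split; rewrite mulmx1.
apply: (@conj_prodM _ 1 1); apply: conj_prod1.
  by exists e, e', s; split=> //; left.
by exists 1%:M, 1%:M, s'; split; rewrite ?mul1mx ?mulmx1 //; right.
Qed.

Lemma conj_prod_inv_commutator (e e' : 'M[R]_m) :
  EU e -> mx_inverse e e' -> conj_prod s 2 (s' *m e *m s *m e').
Proof.
move=> Ee ee'; have e1 : EU 1%:M := EU_1 _ _.
have i1 : mx_inverse 1%:M (1%:M : 'M[R]_m) by split; rewrite mulmx1.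
rewrite -(mulmxA s') -mulmxA; apply: (@conj_prodM _ 1 1); apply: conj_prod1.
  by exists 1%:M, 1%:M, s'; split; rewrite ?mul1mx ?mulmx1 //; right.
by exists e, e', s; split=> //; left.
Qed.

End ProductTransfer.

Hypothesis n3 : (3 <= n)%N.

(** * Products of conjugates and root elements *)

Section Roots.
Implicit Types (u v : 'cV[R]_m) (i j k l : Theta n) (c d x y : R).

Lemma b_self k : hb k -> b (be k) (be k) = 0.
Proof. by move=> hk; rewrite b_bb // eq_sym (negPf (rv_neq hk)) mul0r. Qed.

Lemma b_sep k l : sep k l -> b (be k) (be l) = 0.
Proof. by move/sepP=> h; rewrite b_bb ?h // mul0r. Qed.

Lemma b_opp k : hb k -> b (be k) (be (rv k)) = om k.
Proof. by move=> hk; rewrite b_bb // eqxx mul1r. Qed.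

Lemma b_zero k : hb k -> b (be k) (be 0') = 0.
Proof.
move=> hk; rewrite b_bb // eq_sym rv_eq rev0.
by move: hk; rewrite /hb => /negPf ->; rewrite mul0r.
Qed.

Lemma b_zerol k : hb k -> b (be 0') (be k) = 0.
Proof. by move=> hk; rewrite b_herm b_zero // !barE mulr0. Qed.

Lemma bisometryM (s t : 'M[R]_m) :
  bisometry s -> bisometry t -> bisometry (s *m t).
Proof. by move=> hs ht u v; rewrite -!mulmxA hs ht. Qed.

Lemma bisometryV (s t : 'M[R]_m) :
  bisometry s -> mx_inverse s t -> bisometry t.
Proof. by move=> hs [st _] u v; rewrite -hs !mulmxA st !mul1mx. Qed.

Definition rootmx k l (x : R) :=
  locked_with lock_key (siegel (be l) (x *: be k) 0).

Lemma rootmx_siegel k l x : rootmx k l x = siegel (be l) (x *: be k) 0.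
Proof. by rewrite /rootmx unlock. Qed.

Lemma EU_rootmx k l x : sep k l -> EU (rootmx k l x).
Proof. by rewrite rootmx_siegel; apply: EU_root. Qed.

Lemma rootmxE k l x v : hb k -> hb l -> rootmx k l x *m v =
  v + (om l * v (rv l) 0 * x) *: be k
    - (bar lam * bar x * om k * v (rv k) 0) *: be l.
Proof.
move=> hk hl; rewrite rootmx_siegel siegelE bZl !b_bel //.
by apply/colP=> p; rewrite !mxE; ring.
Qed.

Lemma rootmx_fix k l x i : hb k -> hb l -> i != rv k -> i != rv l ->
  rootmx k l x *m be i = be i.
Proof.
move=> hk hl ik il; rewrite rootmxE // !beE ![_ == i]eq_sym (negPf ik) (negPf il).
by rewrite !(mulr0, mul0r, scale0r) addr0 subr0.
Qed.

Lemma rootmx_move k l x : sep k l ->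
  rootmx k l x *m be (rv l) = be (rv l) + (om l * x) *: be k.
Proof.
move=> /sepP h; rewrite rootmxE ?h // !beE eqxx !h.
by rewrite !(mulr0, mul0r, scale0r) mulr1 subr0.
Qed.

Lemma rootmx_bisometry k l x : sep k l -> bisometry (rootmx k l x).
Proof.
move=> kl; have h := sepP kl; have lk : sep l k by rewrite sepC.
rewrite rootmx_siegel.
apply: siegel_bisometry; rewrite ?bE ?b_self ?b_sep ?h //; rewrite ?bar0; ring.
Qed.

Lemma rootmxV k l x : sep k l -> mx_inverse (rootmx k l x) (rootmx k l (- x)).
Proof.
move=> kl; have h := sepP kl; have lk : sep l k by rewrite sepC.
have := @siegelV (be l) (x *: be k) 0.
rewrite !bE b_self ?h // b_sep // b_self ?h // !mulr0 subr0 oppr0 -scaleNr.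
rewrite -!rootmx_siegel; exact.
Qed.

Lemma rootmx_swap k l x : rootmx k l x = rootmx l k (- bar lam * bar x).
Proof. by rewrite !rootmx_siegel siegel_swap siegelZ scalerA mulr0 mulrC. Qed.

Lemma rootmxD k l x y : sep k l -> rootmx k l (x + y) = rootmx k l x *m rootmx k l y.
Proof.
move=> kl; have h := sepP kl; have lk : sep l k by rewrite sepC.
rewrite !rootmx_siegel siegelM ?bE ?b_self ?b_sep ?h ?mulr0 // scalerDl; congr siegel.
by ring.
Qed.

(** The usual product [A *m B *m A] of root elements, where [A] adds [c *: be i] to [be j] and [B]
    subtracts [d *: be j] from [be i]. *)
Lemma weyl i j (c d : R) : sep i j -> c * d = 1 ->
  exists w w', [/\ EU w, mx_inverse w w', bisometry w, w *m be j = c *: be i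
    & (forall k, sep k i -> sep k j -> w *m be k = be k) /\ w *m be 0' = be 0'].
Proof.
move=> ij cd; have h := sepP ij.
have s1 : sep i (rv j) by rewrite sepNr.
have s2 : sep j (rv i) by rewrite sepNr sepC.
pose x := c * bar (om (rv j)); pose y := - d * bar (om (rv i)).
have [A eA] := named (rootmx i (rv j) x).
have [B eB] := named (rootmx j (rv i) y).
have iA := rootmxV x s1; have iB := rootmxV y s2; rewrite -eA -eB in iA iB.
have Aj : A *m be j = be j + c *: be i.
  have := rootmx_move x s1; rewrite rev_ordK -eA => ->; congr (_ + _ *: _).
  by rewrite /x; ring: (om_bar (rv j)).
have Bi : B *m be i = be i - d *: be j.
  have := rootmx_move y s2; rewrite rev_ordK -eB -scaleNr => ->; congr (_ + _ *: _).
  by rewrite /y; ring: (om_bar (rv i)).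
have Ai : A *m be i = be i by rewrite eA rootmx_fix ?rev_ordK ?h // eq_sym rv_neq ?h.
have Bj : B *m be j = be j by rewrite eB rootmx_fix ?rev_ordK ?h // eq_sym rv_neq ?h.
exists (A *m B *m A); eexists; split.
- by rewrite eA eB; apply: EU_M; [apply: EU_M|]; apply: EU_rootmx.
- exact: (mx_inverse_mul (mx_inverse_mul iA iB) iA).
- by do 2?apply: bisometryM; rewrite ?eA ?eB; apply: rootmx_bisometry.
- rewrite !mulmx_vecE Aj !mulmx_vecE Bi Bj !mulmx_vecE Aj Ai.
  by apply/colP=> ?; rewrite !mxE; ring: cd.
split=> [k /sepP ki /sepP kj|].
  by rewrite eA eB !mulmx_vec !rootmx_fix ?rev_ordK ?h ?ki ?kj.
have z k : hb k -> (0' == k) = false by rewrite eq_sym => /negPf.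
by rewrite eA eB !mulmx_vec !rootmx_fix ?rev_ordK ?z ?h.
Qed.

Lemma sep_hbl k l : sep k l -> hb k. Proof. by case/and4P. Qed.

Lemma sep_hbr k l : sep k l -> hb l. Proof. by case/and4P. Qed.

(** Up to sign, [k] and [l] exclude at most two of the labels 1, 2, 3, all of which occur since [n]
    is at least 3. *)
Lemma exists_sep k l : hb k -> hb l -> exists2 i, sep i k & sep i l.
Proof.
move=> hk hl.
pose P (p : nat) := [&& p != k, p != rv k, p != l & p != rv l].
have [p p3 Pp] : exists2 p, (p < 3)%N & P p.
  have : P 0%N || P 1%N || P 2%N.
    rewrite /P /=; move: hk hl (ltn_ord k) (ltn_ord l); rewrite /hb -!val_eqE /=.
    lia.
  by case/orP=> [/orP[]|] hP; [exists 0%N | exists 1%N | exists 2%N].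
have pm : (p < m)%N by lia.
by case/and4P: Pp => *; exists (Ordinal pm); rewrite /sep ?hk ?hl -!val_eqE /=;
  apply/and3P; split=> //; rewrite /hb -val_eqE /=; lia.
Qed.

Section Cost.
Variables (s s' : 'M[R]_m).
Hypothesis ss' : mx_inverse s s'.
Local Notation G := (conj_prod s).

(** All positions are included at once; by [root_costP] a single one determines the cost. *)
Definition root_cost N (x : R) := forall k l, sep k l -> G N (rootmx k l x).

(** The bound holds on the whole principal ideal of [x], so linear combinations can be estimated
    term by term. *)
Definition ideal_cost N (x : R) := forall c, root_cost N (c * x).

Lemma rootmx_moveL N i k l c d x : sep i k -> sep i l -> sep k l -> c * d = 1 ->
  G N (rootmx k l x) -> G N (rootmx i l (c * x)).
Proof.
move=> ik il kl cd; have [w [w' [Ew ww' iw wk [wl _]]]] := weyl ik cd.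
move/(conj_prodJ Ew ww'); rewrite !rootmx_siegel siegel_conj // wl 1?sepC //.
by rewrite mulmx_vecZ wk scalerA mulrC.
Qed.

(** The root element is moved to a third index and back, and the second Weyl element carries the
    unit [c]. *)
Lemma rootmx_scale N k l c d x : sep k l -> c * d = 1 ->
  G N (rootmx k l x) -> G N (rootmx k l (c * x)).
Proof.
move=> kl cd; have h := sepP kl.
have [i ik il] := exists_sep (sep_hbl kl) (sep_hbr kl).
move/(rootmx_moveL ik il kl (mulr1 1)).
move/(rootmx_moveL _ kl il cd); rewrite mul1r; apply.
by rewrite sepC.
Qed.

(** If [i] is the negative of [k], no single Weyl element of the above kind applies, and the move
    goes through a third index [j]. *)
Lemma rootmx_moveL' N i k l x : sep i l -> sep k l ->
  G N (rootmx k l x) -> G N (rootmx i l x).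
Proof.
move=> il kl hG; have h := sepP kl; have h' := sepP il.
have [j jk jl] := exists_sep (sep_hbl kl) (sep_hbr kl).
have := boolP (sep i k); case=> [ik|].
  by have := rootmx_moveL ik il kl (mulr1 1) hG; rewrite mul1r.
rewrite /sep !(h, h') /= negb_and !negbK => /orP[] /eqP e; first by rewrite e.
have := rootmx_moveL jk jl kl (mulr1 1) hG; rewrite mul1r => {}hG.
have ij : sep i j by rewrite e sepNl sepC.
by have := rootmx_moveL ij il jl (mulr1 1) hG; rewrite mul1r.
Qed.

Lemma rootmx_moveR N i k l x : sep k i -> sep k l ->
  G N (rootmx k l x) -> G N (rootmx k i x).
Proof.
move=> ki kl; rewrite rootmx_swap [rootmx k i x]rootmx_swap.
by apply: rootmx_moveL'; rewrite sepC.
Qed.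

Lemma root_costP N k l c d x : sep k l -> c * d = 1 ->
  G N (rootmx k l x) -> root_cost N (c * x).
Proof.
move=> kl cd /(rootmx_scale kl cd) {cd d}; move: (c * x) => {c}x hG i j ij.
have h := sepP kl; have h' := sepP ij.
have [q qk ql] := exists_sep (sep_hbl kl) (sep_hbr kl).
have := boolP (sep i l); case=> [il|].
  by apply: (rootmx_moveR ij il); apply: (rootmx_moveL' il kl).
have kq : sep k q by rewrite sepC.
have lq : sep l q by rewrite sepC.
have hG2 := rootmx_moveR kq kl hG.
rewrite /sep !(h, h') /= negb_and !negbK => /orP[] /eqP e; subst i.
  by apply: (rootmx_moveR ij lq); apply: (rootmx_moveL' lq kq).
have lq' : sep (rv l) q by rewrite sepNl.
by apply: (rootmx_moveR ij lq'); apply: (rootmx_moveL' lq' kq).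
Qed.

Lemma root_cost_unit N c d x : c * d = 1 -> root_cost N x -> root_cost N (c * x).
Proof. by move=> cd hx k l kl; apply: (rootmx_scale kl cd); apply: hx. Qed.

Lemma root_cost_bar N x : root_cost N x -> root_cost N (bar x).
Proof.
move=> hx k l kl; have lk : sep l k by rewrite sepC.
have cd : - lam * - bar lam = 1 by ring: (barlamK).
have := hx _ _ lk; rewrite rootmx_swap => /(rootmx_scale kl cd).
by congr (G N (rootmx k l _)); ring: (barlamK).
Qed.

Lemma root_costD N M x y : root_cost N x -> root_cost M y -> root_cost (N + M) (x + y).
Proof.
by move=> hx hy k l kl; rewrite rootmxD //; apply: conj_prodM; [apply: hx | apply: hy].
Qed.

Lemma ideal_cost_bar N x : ideal_cost N x -> ideal_cost N (bar x).
Proof. by move=> hx c; rewrite mulrC -[c](barK') -barM; apply/root_cost_bar/hx. Qed.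

Lemma ideal_costM N a x : ideal_cost N x -> ideal_cost N (a * x).
Proof. by move=> hx c; rewrite mulrA. Qed.

Lemma ideal_costD N M x y :
  ideal_cost N x -> ideal_cost M y -> ideal_cost (N + M) (x + y).
Proof. by move=> hx hy c; rewrite mulrDr; apply: root_costD. Qed.

Lemma ideal_cost_root N x : ideal_cost N x -> root_cost N x.
Proof. by move=> hx; rewrite -[x]mul1r; apply: hx. Qed.

End Cost.
End Roots.

(** * Root elements from iterated commutators *)

Section QuadraticCosts.
Implicit Types (u v x y : 'cV[R]_m) (i j k l : Theta n).

Variables (s s' : 'M[R]_m).
Hypotheses (ss' : mx_inverse s s') (si : bisometry s).
Local Notation G := (conj_prod s).

Section Indices.
Variables (p q r : Theta n).
Hypotheses (pq : sep p q) (pr : sep p r) (qr : sep q r).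

(* By the fourth condition [s t s'] fixes [be p]; the entries [al] and [ga] of
   [t] are those that survive in the commutators below. *)
Definition adapted (t t' : 'M[R]_m) (al ga : R) :=
  [/\ EU t, mx_inverse t t', bisometry t, t *m (s' *m be p) = s' *m be p
    & [/\ t *m be (rv p) = be (rv p), t *m be (rv q) = be (rv q),
          t *m be (rv r) = be (rv r)
        & exists de, t *m be p =
            be p + al *: be (rv p) + de *: be (rv q) + ga *: be (rv r)]].

Lemma adaptedM t1 t1' t2 t2' al1 ga1 al2 ga2 :
  adapted t1 t1' al1 ga1 -> adapted t2 t2' al2 ga2 ->
  adapted (t1 *m t2) (t2' *m t1') (al1 + al2) (ga1 + ga2).
Proof.
case=> E1 i1 b1 f1 [p1 q1 r1 [d1 v1]] [E2 i2 b2 f2 [p2 q2 r2 [d2 v2]]].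
split; [exact: EU_M | exact: mx_inverse_mul | exact: bisometryM | |].
  by rewrite -mulmxA f2.
split; rewrite -mulmxA ?(p2, q2, r2) // v2.
exists (d1 + d2); rewrite !mulmxDr -!scalemxAr v1 p1 q1 r1.
by apply/colP=> ?; rewrite !mxE; ring.
Qed.

(* Two commutators: [t' (s t s')] with the root element [rootmx p (rv q) 1],
   and the result, a product of four conjugates, with [rootmx r p c]. *)
Lemma conj_prod8 t t' al ga c : adapted t t' al ga ->
  exists z w, G 8 (siegel (be p) 0 z *m
     siegel (be (rv q)) ((bar lam * bar c * om r * ga) *: be p
                         - (om p * al * c) *: be r) w)
  /\ (al = 0 -> w = 0).
Proof.
case=> Et tt' bt ft [tp tq tr [de tv]]; set v := t *m be p in tv.
have [hp hq] := (sep_hbl pq, sep_hbr pq).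
have rp : sep r p by rewrite sepC.
have hr := sep_hbl rp.
have pq' : sep p (rv q) by rewrite sepNr.
have [xi exi] := named (s *m t *m s').
have [xi' exi'] := named (s *m t' *m s').
have ixi : mx_inverse xi xi' by rewrite exi exi'; apply: mx_inverse_conj.
have bxi : bisometry xi.
  by rewrite exi; do 2?apply: bisometryM => //; apply: bisometryV si ss'.
have xip : xi *m be p = be p.
  by rewrite exi !mulmx_vec ft -mulmx_vec (proj1 ss') mul1mx.
have [g eg] := named (rootmx p (rv q) 1).
have [g' eg'] := named (rootmx p (rv q) (- 1)).
have ig : mx_inverse g g' by rewrite eg eg'; apply: rootmxV.
have [A eA] := named (siegel (be (rv q)) v 0).
have [A' eA'] := named (siegel (be (rv q)) (- v) 0).
have tA : t *m g *m t' = A.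
  by rewrite eg rootmx_siegel (siegel_conj _ _ _ bt tt') tq scale1r -/v eA; exact: erefl.
have tA' : t *m g' *m t' = A'.
  rewrite eg' rootmx_siegel (siegel_conj _ _ _ bt tt') tq mulmx_vecZ scaleN1r eA'.
  exact: erefl.
have iA : mx_inverse A A' by rewrite -tA -tA'; apply: mx_inverse_conj.
have [w0 ew0] := named (- bar lam *: (xi *m be (rv q))).
have [W eW] := named (siegel (be p) w0 0).
have xW : xi *m g *m xi' = W.
  rewrite eg rootmx_siegel (siegel_conj _ _ _ bxi ixi) siegel_swap scale1r xip eW ew0.
  exact: erefl.
have [W' EW] := named (xi *m g' *m xi').
have iW : mx_inverse W W' by rewrite EW -xW; apply: mx_inverse_conj.
have pp : b (be p) (be p) = 0 := b_self hp.
have pw0 : b (be p) w0 = 0.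
  by rewrite ew0 bZr -{1}xip bxi b_sep // mulr0.
have [tt1 tt2] := tt'.
(* This is the [t]-conjugate of the commutator of [t' *m xi], a product of two conjugates, with
   [g]. *)
have G4 : G 4 (W *m A').
  have k2 : G 2 (t' *m s *m t *m s').
    exact: (conj_prod_commutator ss' (EU_V Et tt') (mx_inverse_sym tt')).
  have ik : mx_inverse (t' *m s *m t *m s') (s *m t' *m s' *m t).
    have := mx_inverse_mul (mx_inverse_sym tt') ixi.
    by rewrite exi exi' !mulmx3.
  have Eg : EU g by rewrite eg; apply: EU_rootmx.
  have := conj_prodJ Et tt' (conj_prod_comm ss' k2 ik Eg ig).
  by rewrite -xW -tA' exi exi' !mulmx3 tt1 mul1mx.
have [h eh] := named (rootmx r p c).
have [h' eh'] := named (rootmx r p (- c)).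
have ih : mx_inverse h h' by rewrite eh eh'; apply: rootmxV.
have Eh : EU h by rewrite eh; apply: EU_rootmx.
have EA' : EU A'.
  rewrite -tA' eg'; apply: EU_M; last exact: EU_V tt'.
  by apply: EU_M => //; apply: EU_rootmx.
have G4' := conj_prodV ss' G4 (mx_inverse_mul iW (mx_inverse_sym iA)).
have iAW := mx_inverse_mul iA (mx_inverse_sym iW).
have := conj_prodJ EA' (mx_inverse_sym iA) (conj_prod_comm ss' G4' iAW Eh ih).
rewrite !mulmx3 (proj2 iA) mul1mx.
have pr0 : b (be p) (c *: be r) = 0 by rewrite bZr b_sep ?mulr0.
have EW' : W' = siegel (be p) (- w0) (- 0 - b w0 w0).
  by apply: mx_inverse_uniq iW _; rewrite eW; apply: siegelV.
(* Both [W] and [h] are based at [be p], so they commute up to a central factor. *)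
have [z Wz] : exists z, W' *m h *m W = siegel (be p) 0 z *m h.
  rewrite EW' eh !rootmx_siegel eW.
  rewrite !siegelM ?(bDr, bNr, pw0, pr0, pp, oppr0, addr0) //.
  rewrite addrAC addNr add0r; set z := (X in siegel _ _ X); exists z.
  rewrite (siegelM _ _ pp (b0r _) pr0) b0l subr0 addr0 add0r; exact: erefl.
have hq' : hb (rv q) by rewrite hb_rev.
have hhq : h *m be (rv q) = be (rv q).
  by rewrite eh rootmx_fix ?(sepP pq) ?(sepP qr) ?(sepP pr).
have bh : bisometry h by rewrite eh; apply: rootmx_bisometry.
have Wh : h *m A' *m h' = siegel (be (rv q)) (- (h *m v)) 0.
  rewrite eA' (siegel_conj _ _ _ bh ih) hhq mulmx_vecN; exact: erefl.
(* Of the coordinates of [v], only those at [rv p] and [rv r] matter for [h]; they are [al] and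
   [ga]. *)
have hv : h *m v = v + (om p * al * c) *: be r - (bar lam * bar c * om r * ga) *: be p.
  rewrite eh (rootmxE c v hr hp).
  have -> : v (rv p) 0 = al.
    by rewrite tv !mxE !beE !eqxx (negPf (rv_neq hp)) ?(sepP pq) ?(sepP pr) /=; ring.
  have -> // : v (rv r) 0 = ga.
  by rewrite tv !mxE !beE !eqxx ?(sepP qr) ?(sepP pr) /=; ring.
have vv : b v v = 0 by rewrite /v bt.
have qv : b (be (rv q)) v = 0 by rewrite /v -{1}tq bt b_sep // sepNl sepC.
have qhv : b (be (rv q)) (h *m v) = 0 by rewrite -{1}hhq bh.
move=> G8; exists z, (b (h *m v) v); split=> [|al0].
  have -> : (bar lam * bar c * om r * ga) *: be p - (om p * al * c) *: be r
      = - (h *m v) + v by rewrite hv; apply/colP=> ?; rewrite !mxE; ring.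
  have -> : b (h *m v) v = 0 + 0 - b (- (h *m v)) v by rewrite bNl opprK !add0r.
  rewrite -siegelM ?bNr ?qhv ?oppr0 //; last by rewrite b_self.
  by rewrite -Wh -eA !mulmx3 -Wz; exact: G8.
rewrite hv al0 !(mulr0, mul0r, scale0r, addr0) !bE vv tv al0 scale0r addr0.
by rewrite !bE pp !b_sep ?sepNr // !mulr0 !addr0 mulr0 subr0.
Qed.

(** With [al = 0] the product found in [conj_prod8] is a single Siegel transformation at [be p]. Its
    commutator with [rootmx r q 1] removes the central parameter and leaves a root element at [r]
    and [p]. *)
Lemma root_cost16 t t' ga c : adapted t t' 0 ga -> root_cost s 16 (c * ga).
Proof.
move=> ad; have [z [w [hG w0]]] := conj_prod8 (bar c) ad.
have {w0}w0 := w0 erefl; move: hG; rewrite {w}w0 mulr0 mul0r scale0r subr0 barK'.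
set x := bar lam * c * om r * ga => hG.
have rq : sep r q by rewrite sepC.
have qp : sep (rv q) p by rewrite sepNl sepC.
have rp : sep r p by rewrite sepC.
have hp := sep_hbl pq; have pp := b_self hp.
have [ka eka] := named (- bar lam * bar x).
have [h eh] := named (rootmx r q 1).
have ih : mx_inverse h (rootmx r q (- 1)) by rewrite eh; apply: rootmxV.
have pk : b (be p) (ka *: be (rv q)) = 0 by rewrite bZr b_sep ?mulr0 // sepC.
have X : siegel (be p) 0 z *m siegel (be (rv q)) (x *: be p) 0
    = siegel (be p) (ka *: be (rv q)) z.
  rewrite -(rootmx_siegel) rootmx_swap -eka rootmx_siegel siegelM ?b0r //.
  by rewrite b0l subr0 addr0 add0r.
rewrite {}X in hG.
have Eh : EU h by rewrite eh; apply: EU_rootmx.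
have := conj_prod_comm ss' hG (siegelV z pp pk) Eh ih.
have hp' : h *m be p = be p by rewrite eh rootmx_fix ?(sepP pq, sepP pr).
have hq' : h *m be (rv q) = be (rv q) + om q *: be r.
  by rewrite eh rootmx_move ?mulr1.
have bh : bisometry h by rewrite eh; apply: rootmx_bisometry.
rewrite -2!mulmx3 (mulmx3 h) siegel_conj //.
rewrite hp' mulmx_vecN mulmx_vecZ hq' siegelM //; last 1 first.
  by rewrite !bE !b_sep ?sepNr // !mulr0 addr0 mulr0 oppr0.
have -> : ka *: be (rv q) - ka *: (be (rv q) + om q *: be r)
    = (om q * bar (om r) * bar (c * ga)) *: be r.
  rewrite eka /x; apply/colP=> ?; rewrite !mxE !barE.
  by ring: (barlamK).
rewrite [X in siegel _ _ X](_ : _ = 0); last first.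
  by rewrite !bE (b_self (sep_hbl qp)) b_sep ?sepNl //; ring.
rewrite -(rootmx_siegel).
set y := bar (c * ga); rewrite -[c * ga](barK') -/y => {}hG.
have u1 : bar (om q) * om r * (om q * bar (om r)) = 1.
  by rewrite mulrACA [bar _ * _]mulrC !om_bar mulr1.
apply: (root_cost_bar).
have := root_costP rp u1 hG.
by rewrite mulrA u1 mul1r.
Qed.

(* The vectors below span a totally isotropic subspace, so that the
   corresponding transvections multiply additively. *)
Lemma isotropic_cancel (e e' x w : 'cV[R]_m) (z u : R) :
  b e e = 0 -> b e e' = 0 -> b e' e' = 0 -> b e x = 0 -> b e' x = 0 ->
  b x x = 0 -> b w w = 0 -> b w e = 0 -> b w e' = 0 -> b w x = 0 ->
  siegel w 0 z *m siegel e x u *m siegel e' (- x) (- u) *m siegel w 0 (- z)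
  = siegel e x u *m siegel e' (- x) (- u).
Proof.
move=> ee ee' e'e' ex e'x xx ww we we' wx.
have sy x1 x2 : b x1 x2 = 0 -> b x2 x1 = 0.
  by move=> e0; rewrite b_herm e0 !barE mulr0.
pose F := (ee, ee', e'e', ex, e'x, xx, ww, we, we', wx, sy _ _ ee', sy _ _ ex,
  sy _ _ e'x, sy _ _ we, sy _ _ we', sy _ _ wx).
have orth v e1 x1 z1 y : b v e1 = 0 -> b v x1 = 0 ->
  b v (siegel e1 x1 z1 *m y) = b v y.
  by move=> v1 v2; rewrite siegelE !bE v1 v2 !mulr0 !addr0.
have N v : b v x = 0 -> b v (- x) = 0 by move=> h; rewrite bE h oppr0.
apply: mx_ext => y; rewrite !mulmx_vec.
do ?[rewrite siegelE ?(bDl, bNl, bZl) ?(orth, N, F, b0r, b0l) //].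
by apply/colP=> ?; rewrite !mxE; ring: (barlamK).
Qed.

(** The second commutator in [root_cost32]: only the interaction of the shift [d *: e] of [x] with
    the shift [f] of [e] survives. *)
Lemma isotropic_commutator (e f x : 'cV[R]_m) (u d : R) :
  b e e = 0 -> b f f = 0 -> b e f = 0 -> b e x = 0 -> b f x = 0 -> b x x = 0 ->
  siegel e x u *m siegel (e + f) (- x) (- u) *m
    siegel (e + f) (x + d *: e) u *m siegel e (- x - d *: e) (- u)
  = siegel f (d *: e) 0.
Proof.
move=> ee ff ef ex fx xx.
have sy x1 x2 : b x1 x2 = 0 -> b x2 x1 = 0.
  by move=> e0; rewrite b_herm e0 !barE mulr0.
pose F := (ee, ff, ef, ex, fx, xx, sy _ _ ef, sy _ _ ex, sy _ _ fx).
have orth v e1 x1 z1 y : b v e1 = 0 -> b v x1 = 0 ->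
  b v (siegel e1 x1 z1 *m y) = b v y.
  by move=> v1 v2; rewrite siegelE !bE v1 v2 !mulr0 !addr0.
have E v : b v e = 0 -> b v f = 0 -> b v (e + f) = 0.
  by move=> h1 h2; rewrite bE h1 h2 addr0.
have N v : b v x = 0 -> b v (- x) = 0 by move=> h; rewrite bE h oppr0.
have P v : b v e = 0 -> b v x = 0 -> b v (x + d *: e) = 0.
  by move=> h1 h2; rewrite !bE h1 h2 mulr0 addr0.
have Q v : b v e = 0 -> b v x = 0 -> b v (- x - d *: e) = 0.
  by move=> h1 h2; rewrite !bE h1 h2 mulr0 oppr0 addr0.
apply: mx_ext => y; rewrite !mulmx_vec.
do 4?[rewrite siegelE ?(bDl, bNl, bZl) ?(orth, E, N, P, Q, F, b0r, b0l) //].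
rewrite siegelE ?(bZl).
by apply/colP=> ?; rewrite !mxE; ring: (barlamK).
Qed.

(** For general [al] two more commutators are needed. The first, with [h], shifts [be (rv q)] and
    cancels the central factor at [be p]. The second, with [g], shifts [y] through its [be p]
    component only, so that [ga] remains and [al] drops out. *)
Lemma root_cost32 t t' al ga c : adapted t t' al ga -> root_cost s 32 (c * ga).
Proof.
move=> ad; have [z [w [hG _]]] := conj_prod8 (bar c) ad.
move: hG; rewrite barK'; set y := _ - _ => hG.
have rq : sep r q by rewrite sepC.
have rp : sep r p by rewrite sepC.
have [hp hq hr] : [/\ hb p, hb q & hb r].
  by rewrite (sep_hbl pq) (sep_hbr pq) (sep_hbr pr).
have hq' : hb (rv q) by rewrite hb_rev.
have pp := b_self hp; have rr := b_self hr; have qq := b_self hq'.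
have qp : b (be (rv q)) (be p) = 0 by rewrite b_sep // sepNl sepC.
have qr0 : b (be (rv q)) (be r) = 0 by rewrite b_sep // sepNl.
have rp0 := b_sep rp; have pr0 := b_sep pr.
have pq0 : b (be p) (be (rv q)) = 0 by rewrite b_sep // sepNr.
have yy : b y y = 0 by rewrite /y !bE ?(pp, rr, pr0, rp0); ring.
have qy : b (be (rv q)) y = 0 by rewrite /y !bE qp qr0; ring.
have py : b (be p) y = 0 by rewrite /y !bE pp pr0; ring.
have ry : b (be r) y = 0 by rewrite /y !bE rp0 rr; ring.
have [h eh] := named (rootmx r q 1); have [h' eh'] := named (rootmx r q (- 1)).
have ih : mx_inverse h h' by rewrite eh eh'; apply: rootmxV.
have Eh : EU h by rewrite eh; apply: EU_rootmx.
have bh : bisometry h by rewrite eh; apply: rootmx_bisometry.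
have hhp : h *m be p = be p by rewrite eh rootmx_fix ?(sepP pq, sepP pr).
have hhr : h *m be r = be r by rewrite eh rootmx_fix ?(sepP qr) // eq_sym rv_neq.
have hy : h *m y = y by rewrite /y !mulmx_vecE hhp hhr; exact: erefl.
have [f eF] := named (om q *: be r); have [E eE] := named (be (rv q)).
rewrite -eE in hG qq qp qr0 pq0 qy.
have hE : h *m E = E + f by rewrite eF eE eh rootmx_move // mulr1; exact: erefl.
have [A eA] := named (siegel (be p) 0 z); have [B eB] := named (siegel E y w).
have [A' eA'] := named (siegel (be p) 0 (- z)).
have [B' eB'] := named (siegel E (- y) (- w)).
have iA : mx_inverse A A'.
  by have := siegelV z pp (b0r (be p)); rewrite oppr0 b0l subr0 eA eA'; exact.
have iB : mx_inverse B B'.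
  by have := siegelV w qq qy; rewrite yy subr0 eB eB'; exact.
have hB : h *m B' *m h' = siegel (E + f) (- y) (- w).
  by rewrite eB' (siegel_conj _ _ _ bh ih) hE mulmx_vecN hy; exact: erefl.
have hA : h *m A' *m h' = A'.
  by rewrite eA' (siegel_conj _ _ _ bh ih) hhp mulmx0; exact: erefl.
rewrite -eA -eB in hG.
have := conj_prod_comm ss' hG (mx_inverse_mul iA iB) Eh ih.
have -> : A *m B *m h *m (B' *m A') *m h' = A *m B *m (h *m B' *m h') *m (h *m A' *m h').
  by case: ih => _ h'h; rewrite !mulmx3 -(mulmx3 _ h' h) h'h mulmx1; exact: erefl.
have Er0 : b E f = 0 by rewrite eF bZr qr0 mulr0.
have ff : b f f = 0 by rewrite eF !bE rr !mulr0.
have fy : b f y = 0 by rewrite eF bZl ry mulr0.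
have fE : b f E = 0 by rewrite b_herm Er0 !barE mulr0.
have ef1 : b (E + f) (E + f) = 0 by rewrite !bE qq Er0 ff fE !addr0.
have ef2 : b E (E + f) = 0 by rewrite bDr qq Er0 addr0.
have ef3 : b (E + f) y = 0 by rewrite bDl qy fy addr0.
have ef4 : b (be p) (E + f) = 0 by rewrite bDr pq0 eF bZr pr0 mulr0 addr0.
rewrite hA hB eA eB eA' (isotropic_cancel z w qq ef2 ef1 qy ef3 yy pp pq0 ef4 py).
rewrite -eB.
have [S eS] := named (siegel (E + f) (- y) (- w)); rewrite -eS.
have [S' eS'] := named (siegel (E + f) y w).
have iS : mx_inverse S S'.
  have := siegelV w ef1 ef3; rewrite yy subr0 -eS -eS'; exact: mx_inverse_sym.
have [g eg] := named (rootmx (rv p) (rv q) 1).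
have [g' eg'] := named (rootmx (rv p) (rv q) (- 1)).
have pq' : sep (rv p) (rv q) by rewrite sepNr sepNl.
have ig : mx_inverse g g' by rewrite eg eg'; apply: rootmxV.
have Eg : EU g by rewrite eg; apply: EU_rootmx.
have bg : bisometry g by rewrite eg; apply: rootmx_bisometry.
have gE : g *m E = E by rewrite eE eg rootmx_fix ?rev_ordK ?(sepP pq) ?rv_neq.
have gr : g *m be r = be r.
  by rewrite eg rootmx_fix ?rev_ordK ?(sepP pq, sepP rp, sepP rq).
have gp : g *m be p = be p - (bar lam * om (rv p)) *: E.
  rewrite eE eg rootmx_swap bar1 mulr1 -{2 3}[p]rev_ordK rootmx_move.
    by rewrite -scaleNr mulrN [om _ * _]mulrC; exact: erefl.
  by rewrite sepC.
have [d ed] := named (- (c * ga) * (bar lam * bar lam * om r * om (rv p))).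
have gy : g *m y = y + d *: E.
  rewrite /y !mulmx_vecE gp gr ed; apply/colP=> ?; rewrite !mxE; ring.
move=> hM; have := conj_prod_comm ss' hM (mx_inverse_mul iB iS) Eg ig.
have -> : B *m S *m g *m (S' *m B') *m g' = B *m S *m (g *m S' *m g') *m (g *m B' *m g').
  by case: ig => _ h'h; rewrite !mulmx3 -(mulmx3 _ g' g) h'h mulmx1; exact: erefl.
have gf : g *m f = f by rewrite eF mulmx_vecZ gr.
rewrite eS' eB' !(siegel_conj _ _ _ bg ig) mulmx_vecD mulmx_vecN gE gf gy opprD.
rewrite eB eS (isotropic_commutator _ _ qq ff Er0 qy fy yy) eF siegelZ scalerA.
rewrite mulr0 eE -rootmx_siegel => hF.
have u1 : - (lam * lam * bar (om r) * bar (om (rv p)) * om q)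
   * - (bar lam * bar lam * om r * om (rv p) * bar (om q)) = 1.
  have o1 := om_bar r; have o2 := om_bar q; have o3 := om_bar (rv p).
  by have o4 := barlamK; ring: o1 o2 o3 o4.
have sqr : sep (rv q) r by rewrite sepNl.
have := root_costP sqr u1 hF; congr (root_cost s _ _); rewrite ed.
have o1 := om_bar r; have o2 := om_bar q; have o3 := om_bar (rv p).
by have o4 := barlamK; ring: o1 o2 o3 o4.
Qed.

End Indices.
End QuadraticCosts.

(** * Adapted elements, and products of two entries *)

Section Adapted.
Implicit Types (u v : 'cV[R]_m) (i j k l : Theta n) (c d x y z : R).

Lemma EU_center k a : hb k -> EU (siegel (be k) 0 (lam * a - bar a)).
Proof.
move=> hk; have <- : 0 *: be 0' = 0 by rewrite scale0r.
apply: EU_short hk _; apply: Delta_ge_min; exists (- bar a).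
by rewrite !barE; congr (_, _); ring.
Qed.

Lemma EU_wedge i j x : hb j -> (i == j) || sep i j -> EU (siegel (be j) (x *: be i) 0).
Proof.
move=> hj /orP[/eqP->|ij]; last exact: EU_root.
by rewrite siegel_center add0r; apply: EU_center.
Qed.

Lemma siegel_addr e u v : b e e = 0 -> b e u = 0 -> b e v = 0 -> b u v = 0 ->
  siegel e (u + v) 0 = siegel e u 0 *m siegel e v 0.
Proof.
by move=> ee eu ev uv; rewrite siegelM // uv subr0 addr0.
Qed.

Definition lcomb3 i j k x y z : 'cV[R]_m := x *: be i + y *: be j + z *: be k.

Lemma lcomb3_iso i j k x y z x' y' z' : sep i j -> sep i k -> sep j k ->
  b (lcomb3 i j k x y z) (lcomb3 i j k x' y' z') = 0.
Proof.
move=> ij ik jk; have ji : sep j i by rewrite sepC.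
have ki : sep k i by rewrite sepC.
have kj : sep k j by rewrite sepC.
have [hi hj hk] : [/\ hb i, hb j & hb k].
  by rewrite (sep_hbl ij) (sep_hbr ij) (sep_hbr jk).
by rewrite /lcomb3 !bE !(b_self, b_sep) // !(mulr0, addr0).
Qed.

Lemma lcomb3_1 i j k x : lcomb3 i j k x 0 0 = x *: be i.
Proof. by rewrite /lcomb3 !scale0r !addr0. Qed.
Lemma lcomb3_2 i j k x : lcomb3 i j k 0 x 0 = x *: be j.
Proof. by rewrite /lcomb3 !scale0r !addr0 add0r. Qed.
Lemma lcomb3_3 i j k x : lcomb3 i j k 0 0 x = x *: be k.
Proof. by rewrite /lcomb3 !scale0r !add0r. Qed.

Lemma lcomb3Z i j k c x y z :
  c *: lcomb3 i j k x y z = lcomb3 i j k (c * x) (c * y) (c * z).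
Proof. by rewrite /lcomb3; apply/colP=> ?; rewrite !mxE; ring. Qed.

(** Both vectors lie in one totally isotropic span. Expanding one, exchanging the roles by
    [siegel_swap] and expanding the other leaves wedges of basis vectors. *)
Lemma EU_lcomb3 i j k x y z x' y' z' : sep i j -> sep i k -> sep j k ->
  EU (siegel (lcomb3 i j k x' y' z') (lcomb3 i j k x y z) 0).
Proof.
move=> ij ik jk; have ji : sep j i by rewrite sepC.
have ki : sep k i by rewrite sepC.
have kj : sep k j by rewrite sepC.
have [hi hj hk] : [/\ hb i, hb j & hb k].
  by rewrite (sep_hbl ij) (sep_hbr ij) (sep_hbr jk).
have iso x1 y1 z1 x2 y2 z2 := lcomb3_iso x1 y1 z1 x2 y2 z2 ij ik jk.
have split1 x1 y1 z1 u : b u u = 0 ->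
  (forall x2 y2 z2, b u (lcomb3 i j k x2 y2 z2) = 0) ->
  siegel u (lcomb3 i j k x1 y1 z1) 0 = siegel u (x1 *: be i) 0 *m
    siegel u (y1 *: be j) 0 *m siegel u (z1 *: be k) 0.
  move=> uu uc.
  have ux : b u (x1 *: be i) = 0 by rewrite -(lcomb3_1 i j k).
  have uy : b u (y1 *: be j) = 0 by rewrite -(lcomb3_2 i j k).
  have uz : b u (z1 *: be k) = 0 by rewrite -(lcomb3_3 i j k).
  have xy : b (x1 *: be i) (y1 *: be j) = 0 by rewrite !bE (b_sep ij) !mulr0.
  have xz : b (x1 *: be i + y1 *: be j) (z1 *: be k) = 0.
    by rewrite !bE (b_sep ik) (b_sep jk) !mulr0 addr0 mulr0.
  have uxy : b u (x1 *: be i + y1 *: be j) = 0 by rewrite bDr ux uy addr0.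
  by rewrite /lcomb3 (siegel_addr uu uxy uz xz) (siegel_addr uu ux uy xy).
have base l x1 y1 z1 : l \in [:: i; j; k] -> EU (siegel (be l) (lcomb3 i j k x1 y1 z1) 0).
  move=> hl; have hlb : hb l by move: hl; rewrite !inE => /or3P[]/eqP->.
  have [lx [ly [lz el]]] : exists lx ly lz, be l = lcomb3 i j k lx ly lz.
    move: hl; rewrite !inE => /or3P[]/eqP->.
    - by exists 1, 0, 0; rewrite lcomb3_1 scale1r.
    - by exists 0, 1, 0; rewrite lcomb3_2 scale1r.
    - by exists 0, 0, 1; rewrite lcomb3_3 scale1r.
  rewrite split1; [|by rewrite el iso|by move=> *; rewrite el iso].
  by do 2?apply: EU_M; apply: EU_wedge => //; move: hl; rewrite !inE;
    case/or3P=> /eqP->; rewrite ?eqxx ?ij ?ik ?jk ?ji ?ki ?kj ?orbT.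
rewrite siegel_swap lcomb3Z (split1 _ _ _ _ (iso _ _ _ _ _ _) (iso x y z)).
have sw l x1 : siegel (lcomb3 i j k x y z) ((- bar lam * x1) *: be l) 0
    = siegel (be l) (bar x1 *: lcomb3 i j k x y z) 0.
  by rewrite -scalerA -siegel_swap siegelZ mulr0.
by rewrite !sw !lcomb3Z; do 2?apply: EU_M; apply: base; rewrite !inE eqxx ?orbT.
Qed.

Variables (s s' : 'M[R]_m).
Hypotheses (ss' : mx_inverse s s') (si : bisometry s).
Local Notation G := (conj_prod s).

Section Indices.
Variables (p q r : Theta n).
Hypotheses (pq : sep p q) (pr : sep p r) (qr : sep q r).
Local Notation lc := (lcomb3 (rv p) (rv q) (rv r)).
Local Notation phi c := (b (s *m be (rv c)) (be p)).

(** The two hypotheses say that [s] maps both vectors into the orthogonal complement of [be p];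
    hence the transformation fixes [s' *m be p]. *)
Lemma adapted_siegel x y z x' y' z' :
  bar x * phi p + bar y * phi q + bar z * phi r = 0 ->
  bar x' * phi p + bar y' * phi q + bar z' * phi r = 0 ->
  adapted s' p q r (siegel (lc x' y' z') (lc x y z) 0)
     (siegel (lc x' y' z') (- lc x y z) 0)
     (om (rv p) * (bar x' * x - bar lam * bar x * x'))
     (om (rv p) * (bar x' * z - bar lam * bar x * z')).
Proof.
move=> e1 e2; have hp := sep_hbl pq.
have pq' : sep (rv p) (rv q) by rewrite sepNr sepNl.
have pr' : sep (rv p) (rv r) by rewrite sepNr sepNl.
have qr' : sep (rv q) (rv r) by rewrite sepNr sepNl.
have iso x1 y1 z1 x2 y2 z2 := lcomb3_iso x1 y1 z1 x2 y2 z2 pq' pr' qr'.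
have perp x1 y1 z1 : bar x1 * phi p + bar y1 * phi q + bar z1 * phi r = 0 ->
    b (lc x1 y1 z1) (s' *m be p) = 0.
  move=> e0; rewrite -si -mulmx_vec (proj1 ss') mul1mx.
  by rewrite /lcomb3 !mulmx_vecE !bE.
have bp x1 y1 z1 : b (lc x1 y1 z1) (be p) = bar x1 * om (rv p).
  have h1 : b (be (rv q)) (be p) = 0 by rewrite b_sep // sepNl sepC.
  have h2 : b (be (rv r)) (be p) = 0 by rewrite b_sep // sepNl sepC.
  have h3 : b (be (rv p)) (be p) = om (rv p).
    by rewrite -{2}[p]rev_ordK b_opp // hb_rev.
  by rewrite /lcomb3 !bE h1 h2 h3 !mulr0 !addr0.
have [P eP] := named (lc x y z); have [Q eQ] := named (lc x' y' z').
have PP : b P P = 0 by rewrite eP iso.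
have QQ : b Q Q = 0 by rewrite eQ iso.
have QP : b Q P = 0 by rewrite eP eQ iso.
have fx x1 y1 z1 : siegel Q P 0 *m lc x1 y1 z1 = lc x1 y1 z1.
  by rewrite siegelE eP eQ !iso; apply/colP=> ?; rewrite !mxE; ring.
split.
- exact: EU_lcomb3.
- by have := siegelV 0 QQ QP; rewrite PP oppr0 addr0 eP eQ.
- by rewrite -eP -eQ; apply: siegel_bisometry; rewrite ?PP ?bar0 //; ring.
- rewrite siegelE !perp //; apply/colP=> ?; rewrite !mxE; ring.
split.
- by have := fx 1 0 0; rewrite lcomb3_1 scale1r eP eQ.
- by have := fx 0 1 0; rewrite lcomb3_2 scale1r eP eQ.
- by have := fx 0 0 1; rewrite lcomb3_3 scale1r eP eQ.
exists (om (rv p) * (bar x' * y - bar lam * bar x * y')).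
rewrite siegelE !bp /lcomb3; apply/colP=> ?; rewrite !mxE; ring.
Qed.

(* The relations used below come from the vectors [bar (phi j) e_i - bar
   (phi i) e_j], which [s] maps into the orthogonal complement of [be p]. *)
Lemma ideal_cost16 : ideal_cost s 16 (bar (phi q) * phi r).
Proof.
have c1 : bar 0 * phi p + bar (bar (phi r)) * phi q + bar (- bar (phi q)) * phi r = 0.
  by rewrite !barE; ring.
have c2 : bar (bar (phi r)) * phi p + bar 0 * phi q + bar (- bar (phi p)) * phi r = 0.
  by rewrite !barE; ring.
have := adapted_siegel c1 c2; rewrite !barE !(mulr0, mul0r, subr0).
move=> ad c; have := root_cost16 ss' si pq pr qr (- c * bar (om (rv p))) ad.
congr (root_cost s _ _); have o := om_bar (rv p); ring: o.
Qed.

(** A product of two adapted elements: the first contributes the term in [x], the second those in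
    [y] and [z]. The first has a nonzero [al] in general, whence [root_cost32]. *)
Lemma ideal_cost32 x y z : ideal_cost s 32
  (x * (bar (phi p) * phi q) + y * (bar (phi q) * phi r) + z * (bar (phi q) * phi q)).
Proof.
have c1 : bar (bar x * bar lam * bar (phi q)) * phi p
  + bar (- (bar x * bar lam * bar (phi p))) * phi q + bar 0 * phi r = 0.
  by rewrite !barE; ring.
have c2 : bar (bar (phi r)) * phi p + bar 0 * phi q + bar (- bar (phi p)) * phi r = 0.
  by rewrite !barE; ring.
have c3 : bar 0 * phi p + bar (bar (phi r)) * phi q + bar (- bar (phi q)) * phi r = 0.
  by rewrite !barE; ring.
have c4 : bar (- (bar y * bar (phi r)) - bar z * bar (phi q)) * phi p
  + bar (bar z * bar (phi p)) * phi q + bar (bar y * bar (phi p)) * phi r = 0.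
  by rewrite !barE; ring.
have := adaptedM (adapted_siegel c1 c2) (adapted_siegel c3 c4).
move=> ad c; have := root_cost32 ss' si pq pr qr (c * bar (om (rv p))) ad.
congr (root_cost s _ _); have o := om_bar (rv p); have l := barlamK.
rewrite !barE; ring: o l.
Qed.

End Indices.
End Adapted.

(** * From products of entries to a single entry *)

Section Entries.
Implicit Types (u v : 'cV[R]_m) (i j k l : Theta n) (c d x y z : R).

Variables (s s' : 'M[R]_m).
Hypotheses (ss' : mx_inverse s s') (si : bisometry s).

Lemma form_inv u v : b (s' *m u) v = b u (s *m v).
Proof. by rewrite -si -mulmx_vec (proj1 ss') mul1mx. Qed.

Section Indices.
Variables (p q r : Theta n).
Hypotheses (pq : sep p q) (pr : sep p r) (qr : sep q r).
Local Notation phi c := (b (s *m be (rv c)) (be p)).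

(* With [x = phi q], [ideal_cost32] is applied to the commutator [rh] of [s']
   and [rootmx p r (bar x)]: the product [bar P1 * P2] of two of its entries is
   a unit times [bar x] plus terms that are quadratic in entries of [s]. *)
Lemma ideal_cost128 : ideal_cost s 128 (phi q).
Proof.
have [hp hr] := (sep_hbl pq, sep_hbr pr).
have [x ex] := named (phi q); rewrite -ex.
have [g eg] := named (rootmx p r (bar x)); have [g' eg'] := named (rootmx p r (- bar x)).
have ig : mx_inverse g g' by rewrite eg eg'; apply: rootmxV.
have Eg : EU g by rewrite eg; apply: EU_rootmx.
have bg' : bisometry g' by rewrite eg'; apply: rootmx_bisometry.
have [rh erh] := named (s' *m g *m s *m g').
have G2 : conj_prod s 2 rh by rewrite erh; apply: conj_prod_inv_commutator.
have [rh' irh] : exists rh', mx_inverse rh rh'.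
  have i1 := mx_inverse_conj (mx_inverse_sym ss') ig.
  by have i2 := mx_inverse_mul i1 (mx_inverse_sym ig); eexists; rewrite erh; exact: i2.
have si' : bisometry s' := bisometryV si ss'.
have [f ef] := named (s' *m be p); have [h eh] := named (s' *m be r).
have rhE (y : 'cV[R]_m) : rh *m y = siegel h (bar x *: f) 0 *m (g' *m y).
  rewrite erh mulmx_vec eg rootmx_siegel.
  by rewrite (siegel_conj _ _ _ si' (mx_inverse_sym ss')) mulmx_vecZ -ef -eh.
have brh : bisometry rh.
  rewrite erh; apply: bisometryM => //; apply: bisometryM => //.
  by apply: bisometryM => //; rewrite eg; apply: rootmx_bisometry.
have g'r : g' *m be r = be r by rewrite eg' rootmx_fix ?(sepP pr) // eq_sym rv_neq.
have rp : sep r p by rewrite sepC.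
have g'p : g' *m be (rv p) = be (rv p) + (bar lam * om p * x) *: be r.
  rewrite eg' rootmx_swap rootmx_move // barN barK'; congr (_ + _ *: _); ring.
have br : b (be r) (be (rv r)) = om r := b_opp hr.
have bpr : b (be (rv p)) (be (rv r)) = 0 by rewrite b_sep // sepNl sepNr.
have fE (y : 'cV[R]_m) : b f y = lam * bar (b (s *m y) (be p)).
  by rewrite ef form_inv b_herm.
have [k1 ek1] := named (bar (b h (be (rv p)))).
have [k2 ek2] := named (b h (be (rv r))).
have [k3 ek3] := named (bar (b h (be r))).
have [fr efr] := named (phi r); have [fp efp] := named (phi p).
have [fr' efr'] := named (b (s *m be r) (be p)).
have [P1 eP1] := named (b (rh *m be (rv (rv r))) (be (rv r))).
have [P2 eP2] := named (b (rh *m be (rv p)) (be (rv r))).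
have P1E : P1 = om r + k3 * lam * x * bar fr - bar x * k2 * fr'.
  rewrite eP1 rev_ordK rhE g'r siegelE !bE br !fE -efr -efr'.
  rewrite !barE -ek3 -ek2; ring: (barlamK).
have P2E : P2 = lam * bar (om p) * bar x * P1 + k1 * lam * x * bar fr - bar x * k2 * fp.
  rewrite eP2 rhE g'p mulmx_vecD mulmx_vecZ bDl bZl.
  have -> : b (siegel h (bar x *: f) 0 *m be r) (be (rv r)) = P1.
    by rewrite eP1 rev_ordK rhE g'r.
  rewrite siegelE !bE bpr !fE -efr -efp !barE -ek1 -ek2; ring: (barlamK).
have rp' : sep (rv r) p by rewrite sepNl sepC.
have rq' : sep (rv r) q by rewrite sepNl sepC.
have pr' : sep p (rv r) by rewrite sepNr.
have qr' : sep q (rv r) by rewrite sepNr.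
have h64 : ideal_cost s 64 (bar P1 * P2).
  move=> c k l kl; apply: (@conj_prod_trans _ _ ss' _ _ _ 2 32 irh G2).
  have := ideal_cost32 irh brh rp' rq' pq 1 0 0 c kl.
  by rewrite -eP1 -eP2 !mul0r !addr0 mul1r.
have h16 := ideal_cost16 ss' si pq pr qr.
have h16' := ideal_cost16 ss' si pq pr' qr'.
rewrite -ex -efr in h16; rewrite rev_ordK -ex -efr' in h16'.
have h32 := ideal_cost32 ss' si pq pr qr
  (bar (bar lam * om p * bar P1 * k2))
  (bar (- (om p * bar P1 * k1) - bar P1 * k3 * lam * bar x))
  (bar (om r * bar k2 * bar fr')).
rewrite -ex -efr -efp in h32.
have o1 := om_bar p; have o2 := om_bar r; have o3 := barlamK.
have P1b : bar P1 = bar (om r) + bar k3 * bar lam * bar x * fr - x * bar k2 * bar fr'.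
  by rewrite P1E !barE; ring.
suff xE : bar x = bar lam * om p * (bar P1 * P2)
   + bar (bar (bar lam * om p * bar P1 * k2) * (bar fp * x)
      + bar (- (om p * bar P1 * k1) - bar P1 * k3 * lam * bar x) * (bar x * fr)
      + bar (om r * bar k2 * bar fr') * (bar x * x))
   + - (om r * bar k3 * bar lam * bar x) * (bar x * fr)
   + bar P1 * k2 * bar x * (bar x * fr').
  rewrite -[x](barK'); apply: (ideal_cost_bar); rewrite xE.
  (* The product [bar P1 * P2] costs 32 conjugates of [rh], each worth two of [s]; then come one
     application of [ideal_cost32] and two of [ideal_cost16], for [r] and for [rv r]. *)
  rewrite (_ : 128 = 64 + 32 + 16 + 16)%N //; do 3?apply: ideal_costD.
  - exact: ideal_costM.
  - exact: (ideal_cost_bar).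
  - exact: ideal_costM.
  - exact: ideal_costM.
rewrite !(barD, barN, barM, barK') P2E P1b P1E; ring: o1 o2 o3.
Qed.

End Indices.
End Entries.

(** * Matrix entries *)

Section EntryCosts.
Implicit Types (u v : 'cV[R]_m) (i j k l : Theta n) (a c d x y z : R) (s t g : 'M[R]_m).

Lemma entryE s i j : s i j = (s *m be j) i 0.
Proof. by rewrite mulmx_be mxE. Qed.

Lemma coordD u v i : (u + v) i 0 = u i 0 + v i 0. Proof. by rewrite mxE. Qed.
Lemma coordN v i : (- v) i 0 = - v i 0. Proof. by rewrite mxE. Qed.
Lemma coordZ c v i : (c *: v) i 0 = c * v i 0. Proof. by rewrite mxE. Qed.
Definition coordE := (coordD, coordN, coordZ).

(** An elementary conjugate of [s] counts as one factor, so entries of such a conjugate cost no more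
    than entries of [s]. *)
Lemma ideal_cost_conj s s' g g' N x : mx_inverse s s' -> EU g -> mx_inverse g g' ->
  ideal_cost (g *m s *m g') N x -> ideal_cost s N x.
Proof.
move=> ss' Eg ig hx c k l kl; rewrite -[N]muln1.
apply: (conj_prod_trans ss' (mx_inverse_conj ig ss')) (hx c k l kl).
by apply: conj_prod1; exists g, g', s; split=> //; left.
Qed.

Lemma entry_cost s s' i j : mx_inverse s s' -> bisometry s -> sep i j ->
  ideal_cost s 128 (s i j).
Proof.
move=> ss' si ij; have [hi hj] := (sep_hbl ij, sep_hbr ij).
have ij' : sep (rv i) (rv j) by rewrite sepNl sepNr.
have hi' : hb (rv i) by rewrite hb_rev.
have hj' : hb (rv j) by rewrite hb_rev.
have [r ri rj] := exists_sep hi' hj'.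
have ir : sep (rv i) r by rewrite sepC.
have jr : sep (rv j) r by rewrite sepC.
have := ideal_cost128 ss' si ij' ir jr.
rewrite b_ber // !rev_ordK -entryE => h.
have := ideal_cost_bar (ideal_costM (bar (om i)) h).
rewrite mulrA [_ * om i]mulrC om_bar mul1r barK'; exact.
Qed.

Lemma rootmx_coord k l x v i : hb k -> hb l -> i != k -> i != l ->
  (rootmx k l x *m v) i 0 = v i 0.
Proof.
move=> hk hl ik il; rewrite rootmxE // !mxE !beE (negPf ik) (negPf il).
by rewrite !mulr0 addr0 subr0.
Qed.

(** Conjugation by a root element that subtracts column [rv i] from column [j] puts
    [s i j - s i (rv i)] at position [(i, j)]; two entries of cost 128 are compared. *)
Lemma opp_entry_cost s s' i : mx_inverse s s' -> bisometry s -> hb i ->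
  ideal_cost s 256 (s i (rv i)).
Proof.
move=> ss' si hi; have [j ji _] := exists_sep hi hi.
have ij : sep i j by rewrite sepC.
have ij' : sep (rv i) (rv j) by rewrite sepNl sepNr.
have h := sepP ij.
have [y ey] := named (bar (om (rv j))).
have [g eg] := named (rootmx (rv i) (rv j) y).
have [g' eg'] := named (rootmx (rv i) (rv j) (- y)).
have ig : mx_inverse g g' by rewrite eg eg'; apply: rootmxV.
have Eg : EU g by rewrite eg; apply: EU_rootmx.
have bg : bisometry g by rewrite eg; apply: rootmx_bisometry.
have bg' : bisometry g' by rewrite eg'; apply: rootmx_bisometry.
have g'j : g' *m be j = be j - be (rv i).
  rewrite eg' -{2 3}[j]rev_ordK rootmx_move // ey mulrN om_bar scaleNr scale1r.
  exact: erefl.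
have e : (g *m s *m g') i j = s i j - s i (rv i).
  rewrite [LHS]entryE !mulmx_vec eg rootmx_coord ?h //; last by rewrite eq_sym rv_neq.
  by rewrite g'j !mulmx_vecE !coordE -!entryE.
have c1 := entry_cost (mx_inverse_conj ig ss') (bisometryM (bisometryM bg si) bg') ij.
have {}c1 := ideal_cost_conj ss' Eg ig c1.
have c2 := ideal_costD (entry_cost ss' si ij) (ideal_costM (- 1) c1).
by move: c2; rewrite e mulN1r opprB addrC subrK.
Qed.

(** Here position [(i, j)] of the conjugate holds [s i j - s i i + s j j - s j i], so three
    off-diagonal entries are spent. *)
Lemma diag_entry_cost s s' i j : mx_inverse s s' -> bisometry s -> sep i j ->
  ideal_cost s 384 (s i i - s j j).
Proof.
move=> ss' si ij; have ji : sep j i by rewrite sepC.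
have h := sepP ij; have [hi hj] := (sep_hbl ij, sep_hbr ij).
have ij' : sep i (rv j) by rewrite sepNr.
have hj' : hb (rv j) by rewrite hb_rev.
have [y ey] := named (bar (om (rv j))).
have [g eg] := named (rootmx i (rv j) y).
have [g' eg'] := named (rootmx i (rv j) (- y)).
have ig : mx_inverse g g' by rewrite eg eg'; apply: rootmxV.
have Eg : EU g by rewrite eg; apply: EU_rootmx.
have bg : bisometry g by rewrite eg; apply: rootmx_bisometry.
have bg' : bisometry g' by rewrite eg'; apply: rootmx_bisometry.
have g'j : g' *m be j = be j - be i.
  rewrite eg' -{2 3}[j]rev_ordK rootmx_move // ey mulrN om_bar scaleNr scale1r.
  exact: erefl.
have gi v : (g *m v) i 0 = v i 0 + v j 0.
  rewrite eg rootmxE // rev_ordK !mxE !beE eqxx h ey /=.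
  by have o := om_bar (rv j); ring: o.
have e : (g *m s *m g') i j = s i j - s i i + s j j - s j i.
  by rewrite [LHS]entryE !mulmx_vec gi g'j !mulmx_vecE !coordE -!entryE addrA.
have c1 := entry_cost (mx_inverse_conj ig ss') (bisometryM (bisometryM bg si) bg') ij.
have {}c1 := ideal_costM (- 1) (ideal_cost_conj ss' Eg ig c1).
have c2 := entry_cost ss' si ij.
have c3 := ideal_costM (- 1) (entry_cost ss' si ji).
have := ideal_costD (ideal_costD c1 c2) c3; rewrite e.
by congr (ideal_cost s _ _); ring.
Qed.

Lemma opp_diag_entry_cost s s' i : mx_inverse s s' -> bisometry s -> hb i ->
  ideal_cost s 768 (s i i - s (rv i) (rv i)).
Proof.
move=> ss' si hi; have [j ji _] := exists_sep hi hi.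
have ij : sep i j by rewrite sepC.
have ji' : sep j (rv i) by rewrite sepNr.
have := ideal_costD (diag_entry_cost ss' si ij) (diag_entry_cost ss' si ji').
by rewrite addrA subrK.
Qed.

Lemma shortE k a z v : hb k -> siegel (be k) (a *: be 0') z *m v =
  v + (om k * v (rv k) 0 * a) *: be 0'
    + (bar lam * (z * om k * v (rv k) 0 - bar a * mu * v 0' 0)) *: be k.
Proof.
move=> hk; rewrite siegelE bZl b_bel // b_be0l.
by apply/colP=> ?; rewrite !mxE; ring.
Qed.

Lemma short_inverse k a z : hb k -> exists z',
  mx_inverse (siegel (be k) (a *: be 0') z) (siegel (be k) ((- a) *: be 0') z').
Proof.
move=> hk; have k0 : b (be k) (a *: be 0') = 0 by rewrite bZr b_zero ?mulr0.
by have := siegelV z (b_self hk) k0; rewrite -scaleNr; eexists; eassumption.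
Qed.

Lemma Delta_trace a z : D (a, z) -> bar a * mu * a + z + lam * bar z = 0.
Proof. by move/Delta_le_max; rewrite /Delta_max /htr /= [bar z * lam]mulrC. Qed.

Lemma short_bisometry k a z : hb k -> D (a, z) ->
  bisometry (siegel (be k) (a *: be 0') z).
Proof.
move=> hk Dz; apply: siegel_bisometry; rewrite ?b_self // ?bZr ?b_zero ?mulr0 //.
rewrite !bE b_be0l beE eqxx mulr1 -(Delta_trace Dz); ring.
Qed.

(** Conjugating by a short element at [k] adds multiples of [s i 0' * a] and [s i k] to the entry at
    [(i, rv k)]. *)
Lemma zero_col_cost s s' i a : mx_inverse s s' -> bisometry s -> hb i -> J D a ->
  ideal_cost s 384 (s i 0' * a).
Proof.
move=> ss' si hi [z Dz]; have [k ki _] := exists_sep hi hi.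
have ik : sep i k by rewrite sepC.
have ik' : sep i (rv k) by rewrite sepNr.
have h := sepP ki; have hk := sep_hbl ki.
have [z' i0] := short_inverse a z hk.
have [g eg] := named (siegel (be k) (a *: be 0') z).
have [g' eg'] := named (siegel (be k) ((- a) *: be 0') z').
have ig : mx_inverse g g' by rewrite eg eg'.
have Eg : EU g by rewrite eg; apply: EU_short.
have bg : bisometry g by rewrite eg; apply: short_bisometry.
have bg' := bisometryV bg ig.
have ig' := mx_inverse_sym ig.
have Eg' : EU g' := EU_V Eg ig.
have gk : g *m be (rv k) = be (rv k) + (om k * a) *: be 0' + (bar lam * z * om k) *: be k.
  rewrite eg shortE // !beE eqxx [_ == rv k]eq_sym rv_eq rev0 (negPf hk) /=.
  by apply/colP=> ?; rewrite !mxE; ring.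
have e : (g' *m s *m g) i (rv k)
    = s i (rv k) + om k * (s i 0' * a) + bar lam * z * om k * s i k.
  rewrite [LHS]entryE !mulmx_vec eg' shortE // !coordE !beE (negPf hi) h /=.
  by rewrite gk !mulmx_vecE !coordE -!entryE; ring.
have c1 := entry_cost (mx_inverse_conj ig' ss') (bisometryM (bisometryM bg' si) bg) ik'.
have {}c1 := ideal_costM (bar (om k)) (ideal_cost_conj ss' Eg' ig' c1).
have c2 := ideal_costM (- bar (om k)) (entry_cost ss' si ik').
have c3 := ideal_costM (- bar lam * z) (entry_cost ss' si ik).
have := ideal_costD (ideal_costD c1 c2) c3; rewrite e.
by congr (ideal_cost s _ _); have o := om_bar k; ring: o.
Qed.

(** The row analogue: a short element at [k] adds a multiple of row [0'] to row [k]. *)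
Lemma zero_row_cost s s' j a : mx_inverse s s' -> bisometry s -> hb j -> J D a ->
  ideal_cost s 384 (bar a * mu * s 0' j).
Proof.
move=> ss' si hj [z Dz]; have [k kj _] := exists_sep hj hj.
have kj' : sep (rv k) j by rewrite sepNl.
have h := sepP kj; have hk := sep_hbl kj.
have [z' i0] := short_inverse a z hk.
have [g eg] := named (siegel (be k) (a *: be 0') z).
have [g' eg'] := named (siegel (be k) ((- a) *: be 0') z').
have ig : mx_inverse g g' by rewrite eg eg'.
have Eg : EU g by rewrite eg; apply: EU_short.
have bg : bisometry g by rewrite eg; apply: short_bisometry.
have bg' := bisometryV bg ig.
have k0 : (0' == k) = false by rewrite eq_sym (negPf hk).
have j0 : (0' == j) = false by rewrite eq_sym (negPf hj).
have g'j : g' *m be j = be j.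
  rewrite eg' shortE // !beE j0 h /=.
  by apply/colP=> ?; rewrite !mxE; ring.
have e : (g *m s *m g') k j = s k j + bar lam * z * om k * s (rv k) j
    - bar lam * (bar a * mu * s 0' j).
  rewrite [LHS]entryE !mulmx_vec g'j eg shortE // !coordE !beE eqxx.
  rewrite [k == 0']eq_sym k0 /= -!entryE.
  by ring.
have c1 := entry_cost (mx_inverse_conj ig ss') (bisometryM (bisometryM bg si) bg') kj.
have {}c1 := ideal_costM (- lam) (ideal_cost_conj ss' Eg ig c1).
have c2 := ideal_costM lam (entry_cost ss' si kj).
have c3 := ideal_costM (z * om k) (entry_cost ss' si kj').
have := ideal_costD (ideal_costD c1 c2) c3; rewrite e.
by congr (ideal_cost s _ _); have o := barlamK; ring: o.
Qed.

End EntryCosts.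

(** * Short root elements *)

Section ShortRoots.
Implicit Types (u v : 'cV[R]_m) (i j k l : Theta n) (a c d x y z : R) (t g : 'M[R]_m).

Variables (s s' : 'M[R]_m).
Hypothesis ss' : mx_inverse s s'.
Local Notation G := (conj_prod s).

(* The short root element at [be i + x *: be k] is conjugated to the one at
   [be i + (x + d) *: be k] by [rootmx k (rv i)] with entry [d], and by
   [siegelDl] both differ from short root elements at [be k] by the same factor
   at [be i] and by long root elements. *)
Lemma short_change N M k a z x d : hb k -> D (a, z) -> ideal_cost s N d ->
  G M (siegel (x *: be k) (a *: be 0') z) ->
  G (M + N * 3) (siegel ((x + d) *: be k) (a *: be 0') z).
Proof.
move=> hk Dz hd hM; have [i ik _] := exists_sep hk hk.
have ki : sep k i by rewrite sepC.
have hi := sep_hbl ik; have ki' : sep k (rv i) by rewrite sepNr.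
have [w ew] := named (a *: be 0').
have kk : b (be k) (be k) = 0 := b_self hk.
have ii : b (be i) (be i) = 0 := b_self hi.
have ik0 := b_sep ik; have ki0 := b_sep ki.
have wk : b w (be k) = 0 by rewrite ew bZl b_zerol ?mulr0.
have wi : b w (be i) = 0 by rewrite ew bZl b_zerol ?mulr0.
have kw : b (be k) w = 0 by rewrite ew bZr b_zero ?mulr0.
have iw : b (be i) w = 0 by rewrite ew bZr b_zero ?mulr0.
have wz : b w w + z + lam * bar z = 0.
  by rewrite -(Delta_trace Dz) ew !bE b_be0l beE eqxx /=; ring.
have FD c : siegel (be i + c *: be k) w z = siegel (be i) w z *m
    (siegel (c *: be k) w z *m rootmx i k (- bar c * bar z)).
  rewrite siegelDl ?bE ?kk ?ik0 ?wk ?wi ?mulr0 // mulmx3.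
  rewrite [siegel _ (- bar z *: be i) 0]siegelZ mulr0 scalerA rootmx_siegel.
  by rewrite mulrN mulNr; exact: erefl.
have fix0 c : rootmx k (rv i) c *m w = w.
  have z1 j : hb j -> (0' == j) = false by rewrite eq_sym => /negPf.
  by rewrite ew mulmx_vecZ rootmx_fix ?rev_ordK ?z1 ?hb_rev.
have fixk c : rootmx k (rv i) c *m be k = be k.
  by rewrite rootmx_fix ?rev_ordK ?hb_rev ?(sepP ki) // eq_sym rv_neq.
have movi c : rootmx k (rv i) (c * bar (om (rv i))) *m be i = be i + c *: be k.
  rewrite -{3 4}[i]rev_ordK rootmx_move // mulrCA om_bar mulr1; exact: erefl.
have [Fi eFi] := named (siegel (be i) w z).
have [Fi' iFi] : exists Fi', mx_inverse Fi Fi'.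
  by eexists; rewrite eFi; apply: siegelV.
have EFi : EU Fi by rewrite eFi ew; apply: EU_short.
have [h0 eh0] := named (siegel (be i + x *: be k) w z).
have Eh0 : EU h0.
  have := EU_M (EU_M (EU_rootmx (x * bar (om (rv i))) ki') EFi).
  move/(_ _ (EU_rootmx (- (x * bar (om (rv i)))) ki')).
  rewrite eFi (siegel_conj _ _ _ (rootmx_bisometry _ ki') (rootmxV _ ki')).
  by rewrite movi fix0 -eh0.
have [h0' ih0] : exists h0', mx_inverse h0 h0'.
  eexists; rewrite eh0; apply: siegelV.
    by rewrite !bE ii kk ik0 ki0; ring.
  by rewrite !bE iw kw; ring.
have [g eg] := named (rootmx k (rv i) (d * bar (om (rv i)))).
have [g' eg'] := named (rootmx k (rv i) (- (d * bar (om (rv i))))).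
have ig : mx_inverse g g' by rewrite eg eg'; apply: rootmxV.
have bg : bisometry g by rewrite eg; apply: rootmx_bisometry.
have gN : G N g by rewrite eg mulrC; apply: hd.
have := conj_prod_comm ss' gN ig Eh0 ih0.
have -> : g *m h0 *m g' = siegel (be i + (x + d) *: be k) w z.
  rewrite eh0 (siegel_conj _ _ _ bg ig) mulmx_vecD mulmx_vecZ eg movi fix0 fixk.
  by rewrite scalerDl addrAC addrA; exact: erefl.
have [F eF] := named (siegel (x *: be k) w z).
have [F1 eF1] := named (siegel ((x + d) *: be k) w z).
have [F' iF] : exists F', mx_inverse F F'.
  by eexists; rewrite eF; apply: siegelV; rewrite ?bZl ?bZr ?kk ?kw ?mulr0.
have [C eC] := named (rootmx i k (- bar x * bar z)).
have [C' eC'] := named (rootmx i k (- (- bar x * bar z))).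
have [C1 eC1] := named (rootmx i k (- bar (x + d) * bar z)).
have iC : mx_inverse C C' by rewrite eC eC'; apply: rootmxV.
have h0E : h0 = Fi *m (F *m C) by rewrite eh0 FD eFi eF eC; exact: erefl.
have h0'E : h0' = C' *m F' *m Fi'.
  apply: mx_inverse_uniq ih0 _; rewrite h0E.
  exact: mx_inverse_mul iFi (mx_inverse_mul iF iC).
rewrite FD -eFi -eF1 -eC1 h0'E.
have [K eK] := named (rootmx i k (- bar d * bar z)).
have [K' eK'] := named (rootmx i k (- (- bar d * bar z))).
have iK : mx_inverse K K' by rewrite eK eK'; apply: rootmxV.
(* The corrections from [siegelDl] for [x] and for [x + d] differ by the root element [K], which
   costs [N]; together with the commutator this accounts for [N * 3]. *)
have C1E : C1 = K *m C.
  rewrite eC1 eK eC barD opprD mulrDl addrC; exact: rootmxD.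
have KN : G N K.
  have := ideal_cost_bar (ideal_costM (- z) hd).
  rewrite barM barN mulrN -mulNr => /ideal_cost_root; rewrite eK; exact.
have EFi' : EU Fi' := EU_V EFi iFi.
move/(conj_prodJ EFi' (mx_inverse_sym iFi)).
have -> : Fi' *m (Fi *m (F1 *m C1) *m (C' *m F' *m Fi')) *m Fi = F1 *m K *m F'.
  rewrite C1E; case: iFi => _ fi; case: iC => c1 _.
  rewrite !mulmx3 fi mul1mx -(mulmx3 _ C C') c1 mulmx1 -(mulmx3 _ Fi' Fi) fi mulmx1.
  exact: erefl.
move=> hFK; rewrite -ew in hM; rewrite -ew.
have -> : siegel ((x + d) *: be k) w z = F1 *m K *m F' *m F *m K'.
  case: iF => _ ff; case: iK => kk' _.
  by rewrite -(mulmx3 _ F' F) ff mulmx1 -(mulmx3 _ K K') kk' mulmx1 eF1; exact: erefl.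
rewrite -eF in hM; have -> : (M + N * 3 = N * 2 + M + N)%N by lia.
by apply: conj_prodM (conj_prodV ss' KN iK); apply: conj_prodM.
Qed.

End ShortRoots.

(** * Removing hyperbolic coordinates *)

Section Strip.
Implicit Types (u v : 'cV[R]_m) (i j k l : Theta n) (a c d x y z : R) (t g : 'M[R]_m).

Lemma sep_card k : hb k -> #|[pred i | sep i k]| = (n.*2 - 2)%N.
Proof.
move=> hk; have := cardC [pred i | sep i k]; rewrite card_ord => cC.
suff c3 : #|[predC [pred i | sep i k]]| = 3.
  by move: cC; rewrite c3 => cC; rewrite -[LHS](addnK 3) cC; lia.
have u3 : uniq [:: 0'; k; rv k].
  rewrite /= !inE negb_or [0' == k]eq_sym [0' == rv k]eq_sym rv_eq rev0.
  by rewrite (negPf (hk : k != 0')) /= eq_sym rv_neq.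
apply: etrans (card_uniqP u3); apply: eq_card => i.
by rewrite !inE /sep hk /= !negb_and !negbK.
Qed.

Variables (s s' : 'M[R]_m).
Hypothesis ss' : mx_inverse s s'.
Local Notation G := (conj_prod s).

(** The commutator of two root elements at [k], one along [be l] and one along [be (rv l)], is
    central. *)
Lemma center_cost N k x : hb k -> root_cost s N x ->
  G (N * 2) (siegel (be k) 0 (x - lam * bar x)).
Proof.
move=> hk hx; have [l lk _] := exists_sep hk hk.
have lk' : sep (rv l) k by rewrite sepNl.
have hl := sep_hbl lk; have hl' := sep_hbl lk'.
have kl : sep k l by rewrite sepC.
have kl' : sep k (rv l) by rewrite sepNr.
have [y ey] := named (bar (om (rv l)) * x).
have o := om_bar (rv l); have hy : root_cost s N y.
  by rewrite ey; apply: (root_cost_unit) hx; rewrite mulrC; exact: o.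
have := conj_prod_comm ss' (hy _ _ lk) (rootmxV y lk) (EU_rootmx 1 lk')
  (rootmxV 1 lk').
have kk := b_self hk.
have k1 c : b (be k) (c *: be l) = 0 by rewrite bZr b_sep ?mulr0.
have k2 c : b (be k) (c *: be (rv l)) = 0 by rewrite bZr b_sep ?mulr0.
have k3 c d : b (be k) (c *: be l + d *: be (rv l)) = 0 by rewrite bDr k1 k2 addr0.
rewrite !rootmx_siegel (siegelM _ _ kk (k1 _) (k2 _)) (siegelM _ _ kk (k3 _ _) (k1 _)).
have k4 c d c' : b (be k) (c *: be l + d *: be (rv l) + c' *: be l) = 0.
  by rewrite bDr k3 k1 addr0.
rewrite (siegelM _ _ kk (k4 _ _ _) (k2 _)).
have -> : y *: be l + 1 *: be (rv l) + - y *: be l + -1 *: be (rv l) = 0 :> 'cV[R]_m.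
  by apply/colP=> ?; rewrite !mxE; ring.
congr (G _ (siegel _ _ _)).
have e1 := b_self hl; have e2 := b_self hl'; have e3 := b_opp hl.
have e4 : b (be (rv l)) (be l) = om (rv l) by rewrite -{2}[l]rev_ordK b_opp.
rewrite !bE e1 e2 e3 e4 ey !barE.
rewrite -(om_rev hl); ring: o.
Qed.

Lemma sum_root_cost k (r : seq (Theta n)) (F : Theta n -> R) (cost : Theta n -> nat) :
  hb k -> (forall i, i \in r -> sep i k /\ root_cost s (cost i) (F i)) ->
  (forall i j, i \in r -> j \in r -> b (be i) (be j) = 0) ->
  G (\sum_(i <- r) cost i) (siegel (be k) (\sum_(i <- r) F i *: be i) 0).
Proof.
move=> hk; have kk := b_self hk.
elim: r => [|i r IH] hr iso; first by rewrite !big_nil siegel00; constructor.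
have [ik Fi] := hr _ (mem_head i r).
have hr' j : j \in r -> sep j k /\ root_cost s (cost j) (F j).
  by move=> jr; apply: hr; rewrite inE jr orbT.
have bs v : (forall j, j \in r -> b v (be j) = 0) ->
    b v (\sum_(j <- r) F j *: be j) = 0.
  move=> hv; have h : {morph b v : x y / x + y >-> x + y} by move=> x y; rewrite bDr.
  rewrite (big_morph _ h (b0r v)) big_seq big1 // => j jr.
  by rewrite bZr hv ?mulr0.
have e0 : b (F i *: be i) (\sum_(j <- r) F j *: be j) = 0.
  apply: bs => j jr; rewrite bZl iso ?mulr0 ?mem_head //.
  by rewrite inE jr orbT.
have e1 : b (be k) (F i *: be i) = 0 by rewrite bZr b_sep ?mulr0 // sepC.
have e2 : b (be k) (\sum_(j <- r) F j *: be j) = 0.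
  by apply: bs => j /hr'[jk _]; rewrite b_sep // sepC.
have := siegelM 0 0 kk e1 e2; rewrite e0 subr0 addr0 !big_cons => <-.
apply: conj_prodM.
  by rewrite -rootmx_siegel; apply: Fi.
by apply: IH => // j l jr lr; apply: iso; rewrite inE ?jr ?lr orbT.
Qed.

Lemma sum_b_l (I : eqType) (r : seq I) (F : I -> 'cV[R]_m) v :
  b (\sum_(i <- r) F i) v = \sum_(i <- r) b (F i) v.
Proof.
have h : {morph (fun u => b u v) : x y / x + y >-> x + y} by move=> x y; rewrite bDl.
exact: (big_morph _ h (b0l v)).
Qed.

(** Outside [0'], [k] and [rv k] the vector splits into a positive part [vp] and a negative part
    [vm]. Each is isotropic, hence removable by root elements. The form between them supplies
    [q2 H v], and the coordinate at [k] moves into the center by [siegel_center]. *)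
Lemma strip_coords N k v z (cost : Theta n -> nat) : hb k -> v (rv k) 0 = 0 ->
  (forall i, sep i k -> root_cost s (cost i) (v i 0)) ->
  G N (siegel (be k) v z) ->
  G (N + \sum_(i | sep i k) cost i) (siegel (be k) (v 0' 0 *: be 0')
     (z + q2 H v + lam * v k 0 - bar (v k 0))).
Proof.
move=> hk vk hv hN; have kk := b_self hk.
pose rp := [seq i <- index_enum (Theta n) | sep i k && (i < n)%N].
pose rm := [seq i <- index_enum (Theta n) | sep i k && ~~ (i < n)%N].
have mp i : (i \in rp) = sep i k && (i < n)%N.
  by rewrite mem_filter mem_index_enum andbT.
have mm i : (i \in rm) = sep i k && ~~ (i < n)%N.
  by rewrite mem_filter mem_index_enum andbT.
have isop i j : i \in rp -> j \in rp -> b (be i) (be j) = 0.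
  rewrite !mp => /andP[/sep_hbl hi ni] /andP[/sep_hbl hj nj].
  rewrite b_bb // -rv_eq; case: eqP => [e|_]; last by rewrite mul0r.
  by move: ni; rewrite -e rev_lt (hb_lt hj) nj.
have isom i j : i \in rm -> j \in rm -> b (be i) (be j) = 0.
  rewrite !mm => /andP[/sep_hbl hi ni] /andP[/sep_hbl hj nj].
  rewrite b_bb // -rv_eq; case: eqP => [e|_]; last by rewrite mul0r.
  by move: ni; rewrite -e rev_lt (hb_lt hj) nj.
have hp i : i \in rp -> sep i k /\ root_cost s (cost i) (v i 0).
  by rewrite mp => /andP[ik _]; split=> //; apply: hv.
have hm i : i \in rm -> sep i k /\ root_cost s (cost i) (v i 0).
  by rewrite mm => /andP[ik _]; split=> //; apply: hv.
have [vp evp] := named (\sum_(i <- rp) v i 0 *: be i).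
have [vm evm] := named (\sum_(i <- rm) v i 0 *: be i).
have [w0 ew0] := named (v 0' 0 *: be 0').
have [wk ewk] := named (v k 0 *: be k).
have Gp := sum_root_cost hk hp isop; have Gm := sum_root_cost hk hm isom.
rewrite -evp -evm in Gp Gm.
have vpE : vp = \sum_(i | sep i k && (i < n)%N) v i 0 *: be i.
  by rewrite evp big_filter.
have vmE : vm = \sum_(i | sep i k && ~~ (i < n)%N) v i 0 *: be i.
  by rewrite evm big_filter.
have sk : sep k k = false by rewrite /sep eqxx !andbF.
have srk : sep (rv k) k = false by rewrite sepNl.
have s0 : sep 0' k = false by rewrite /sep /hb eqxx.
have k0 : (k == 0') = false by rewrite (negPf hk).
have rk0 : (rv k == 0') = false by rewrite rv_eq rev0 k0.
have vE : v = w0 + wk + vp + vm.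
  rewrite {1}[v]vecE (bigID (fun i => sep i k)) /= (bigID (fun i => (i < n)%N)) /=.
  rewrite -vpE -vmE.
  rewrite (bigD1 0') ?s0 //= (bigD1 k) ?sk ?k0 //= (bigD1 (rv k)) /=; last first.
    by rewrite srk rk0 rv_neq.
  rewrite vk scale0r add0r big1 ?addr0 -?ew0 -?ewk.
    by apply/colP=> ?; rewrite !mxE; ring.
  move=> i /andP[/andP[/andP[+ i0] ik] irk].
  by rewrite /sep (i0 : hb i) hk ik /= negbK (negPf irk).
have bsum v1 (r : seq (Theta n)) : (forall j, j \in r -> b v1 (be j) = 0) ->
    b v1 (\sum_(j <- r) v j 0 *: be j) = 0.
  move=> hv1; have h : {morph b v1 : x y / x + y >-> x + y} by move=> x y; rewrite bDr.
  rewrite (big_morph _ h (b0r v1)) big_seq big1 // => j jr.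
  by rewrite bZr hv1 ?mulr0.
have pp : b vp vp = 0.
  rewrite {1}evp sum_b_l big_seq big1 // => i ir.
  by rewrite evp bsum // => j jr; rewrite bZl isop ?mulr0.
have mm0 : b vm vm = 0.
  rewrite {1}evm sum_b_l big_seq big1 // => i ir.
  by rewrite evm bsum // => j jr; rewrite bZl isom ?mulr0.
have bkp : b (be k) vp = 0.
  by rewrite evp bsum // => j /hp[jk _]; rewrite b_sep // sepC.
have bkm : b (be k) vm = 0.
  by rewrite evm bsum // => j /hm[jk _]; rewrite b_sep // sepC.
have b0p : b w0 vp = 0.
  by rewrite evp bsum // => j /hp[/sep_hbl hj _]; rewrite ew0 bZl b_zerol ?mulr0.
have b0m : b w0 vm = 0.
  by rewrite evm bsum // => j /hm[/sep_hbl hj _]; rewrite ew0 bZl b_zerol ?mulr0.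
have bk0 : b (be k) w0 = 0 by rewrite ew0 bZr b_zero ?mulr0.
have bkv : b (be k) v = 0 by rewrite b_bel // vk mulr0.
have bwp : b wk vp = 0 by rewrite ewk bZl bkp mulr0.
have bwm : b wk vm = 0 by rewrite ewk bZl bkm mulr0.
(* The terms at [k] and [rv k] contain the factor [v (rv k) 0] or its image under [bar], and
   vanish. *)
have q2E : b vp vm = q2 H v.
  rewrite vpE /q2 [RHS](bigID (fun i => sep i k)) /= [X in _ = _ + X]big1 ?addr0.
    have h : {morph (fun u => b u vm) : x y / x + y >-> x + y} by move=> x y; rewrite bDl.
    rewrite (big_morph _ h (b0l vm)).
    apply: eq_big => [i|i /andP[ik ni]]; first by rewrite andbC.
    have hi := sep_hbl ik.
    rewrite bZl b_bel // /om ni mul1r vmE summxE (bigD1 (rv i)) /=; last first.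
      by rewrite sepNl ik rev_lt hb_lt // ni.
    rewrite !mxE beE eqxx mulr1 big1 ?addr0 // => j /andP[_ ji].
    by rewrite mxE beE eq_sym (negPf ji) mulr0.
  move=> i /andP[ni]; have hi : hb i by rewrite /hb -val_eqE /=; lia.
  rewrite /sep hi hk /= negb_and !negbK => /orP[]/eqP->; first by rewrite vk mulr0.
  by rewrite vk bar0 mul0r.
have iGm := conj_prodV ss' Gm (siegelV 0 kk bkm).
have iGp := conj_prodV ss' Gp (siegelV 0 kk bkp).
have nm : b (be k) (- vm) = 0 by rewrite bNr bkm oppr0.
have np : b (be k) (- vp) = 0 by rewrite bNr bkp oppr0.
have vmm : b (be k) (v - vm) = 0 by rewrite bDr bkv nm addr0.
have := conj_prodM (conj_prodM hN iGm) iGp.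
rewrite (siegelM _ _ kk bkv nm) (siegelM _ _ kk vmm np).
have -> : v - vm - vp = w0 + wk.
  by rewrite {1}vE; apply/colP=> ?; rewrite !mxE; ring.
have bvm : b v vm = q2 H v by rewrite {1}vE !bDl b0m bwm mm0 q2E; ring.
have bvp : b (v - vm) vp = 0.
  by rewrite bDl bNl {1}vE !bDl b0p bwp pp; ring.
rewrite mm0 pp !bNr bvm bvp.
have w0k : b w0 (v k 0 *: be k) = 0 by rewrite ew0 bZl bZr b_zerol // !mulr0.
have kvk : b (be k) (v k 0 *: be k) = 0 by rewrite bZr kk mulr0.
have cE z1 : siegel (be k) (w0 + v k 0 *: be k) z1
    = siegel (be k) w0 (z1 + (0 + lam * v k 0 - bar (v k 0))).
  have := siegelM z1 0 kk bk0 kvk; rewrite w0k subr0 addr0 => <-.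
  by rewrite siegel_center (siegelM _ _ kk bk0 (b0r _)) b0r subr0 addr0.
rewrite ewk cE -ew0.
congr (G _ (siegel _ _ _)); last by ring.
rewrite -addnA; congr (_ + _)%N; rewrite [RHS](bigID (fun i => (i < n)%N)) /= addnC.
by rewrite !big_filter.
Qed.

End Strip.

Section HalfForm.
Implicit Types (u v : 'cV[R]_m) (i j k l : Theta n) (c : R).

(* The upper half of the form [b], without the coordinate [0']; it is chosen
   so that [q2 H u = beta u u]. *)
Definition beta u v : R := \sum_(i < m | (i < n)%N) bar (u i 0) * v (rv i) 0.

Lemma betaDl u u' v : beta (u + u') v = beta u v + beta u' v.
Proof.
by rewrite /beta -big_split /=; apply: eq_bigr => i _; rewrite mxE barD mulrDl.
Qed.

Lemma betaDr u v v' : beta u (v + v') = beta u v + beta u v'.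
Proof.
by rewrite /beta -big_split /=; apply: eq_bigr => i _; rewrite mxE mulrDr.
Qed.

Lemma betaZl c u v : beta (c *: u) v = bar c * beta u v.
Proof.
by rewrite /beta mulr_sumr; apply: eq_bigr => i _; rewrite mxE barM; ring.
Qed.

Lemma betaZr c u v : beta u (c *: v) = c * beta u v.
Proof.
by rewrite /beta mulr_sumr; apply: eq_bigr => i _; rewrite mxE; ring.
Qed.

Lemma beta_be k v : beta (be k) v = (k < n)%:R * v (rv k) 0.
Proof.
rewrite /beta; case: ltnP => kn.
  rewrite (bigD1 k) //= beE eqxx bar1 big1 ?addr0 // => i /andP[_ ik].
  by rewrite beE (negPf ik) bar0 mul0r.
rewrite mul0r big1 // => i ni; rewrite beE.
case: eqP => [e|_]; last by rewrite bar0 mul0r.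
by move: ni; rewrite e ltnNge kn.
Qed.

Lemma beta_rel u v : b u v = beta u v + lam * bar (beta v u) + bar (u 0' 0) * mu * v 0' 0.
Proof.
rewrite bfE /bform -addrA [X in _ + X]addrC addrA; congr (_ + _ + _).
rewrite /beta bar_sum mulr_sumr (reindex_inj rev_ord_inj) /=.
apply: eq_big => i; first by rewrite -(rev_lt (rev_ord i)) rev_ordK.
by rewrite rev_ordK barM barK' => _; ring.
Qed.

Lemma beta_ber v k : hb k -> beta v (be k) = (rv k < n)%:R * bar (v (rv k) 0).
Proof.
move=> hk; rewrite /beta; case: ltnP => kn.
  rewrite (bigD1 (rv k)) //= beE rev_ordK eqxx mulr1 mul1r.
  rewrite big1 ?addr0 // => i /andP[_ ik].
  by rewrite beE rv_eq (negPf ik) mulr0.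
rewrite mul0r big1 // => i ni; rewrite beE rv_eq.
case: eqP => [e|_]; last by rewrite mulr0.
by move: ni; rewrite e ltnNge kn.
Qed.

End HalfForm.

(** * A short root element obtained from three columns *)

Section ShortColumn.
Implicit Types (u v : 'cV[R]_m) (i j k l : Theta n) (a c d x y z : R) (t g : 'M[R]_m).

Variables (s s' : 'M[R]_m).
Hypotheses (ss' : mx_inverse s s') (si : bisometry s).
Local Notation G := (conj_prod s).

Variables (p q r : Theta n).
Hypotheses (pq : sep p q) (pr : sep p r) (qr : sep q r).

Variables (up uq ur : 'cV[R]_m) (fp fq fr kp kq kr : R).
Hypotheses (Eup : up = s *m be (rv p)) (Euq : uq = s *m be (rv q)).
Hypotheses (Eur : ur = s *m be (rv r)).
Hypotheses (Efp : fp = b up (be p)) (Efq : fq = b uq (be p)) (Efr : fr = b ur (be p)).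
Hypotheses (Ekp : kp = b up (be r)) (Ekq : kq = b uq (be r)) (Ekr : kr = b ur (be r)).

(** [ideal_cost32] handles a combination of two products at the price of one; this keeps the later
    sums small. *)
Lemma cost_fpq x y : ideal_cost s 32 (x * (fp * bar fq) + y * (fq * bar fr)).
Proof.
have := ideal_cost32 ss' si pq pr qr (bar x) (bar y) 0.
rewrite -Eup -Euq -Eur -Efp -Efq -Efr => /(ideal_cost_bar).
by rewrite !barE; congr (ideal_cost s _ _); ring.
Qed.

Lemma cost_fpr x y : ideal_cost s 32 (x * (fp * bar fr) + y * (fr * bar fq)).
Proof.
have rq : sep r q by rewrite sepC.
have := ideal_cost32 ss' si pr pq rq (bar x) (bar y) 0.
rewrite -Eup -Euq -Eur -Efp -Efq -Efr => /(ideal_cost_bar).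
by rewrite !barE; congr (ideal_cost s _ _); ring.
Qed.

Lemma cost_f64 x1 x2 x3 x4 : ideal_cost s 64
  (x1 * (fp * bar fq) + x2 * (fq * bar fr) + x3 * (fp * bar fr) + x4 * (fr * bar fq)).
Proof. by rewrite -addrA; apply: ideal_costD (cost_fpq _ _) (cost_fpr _ _). Qed.

Lemma cost_kq : ideal_cost s 128 kq.
Proof.
have hr := sep_hbr pr; have rq : sep (rv r) (rv q) by rewrite sepNl sepNr sepC.
rewrite Ekq b_ber // Euq -entryE.
exact: ideal_costM _ (ideal_cost_bar (entry_cost ss' si rq)).
Qed.

Lemma cost_f160 : ideal_cost s 160 ((fq * kp - fp * kq) * bar fp).
Proof.
have h1 := ideal_cost_bar (cost_fpq (bar kp) 0).
have h2 := ideal_costM (- (fp * bar fp)) cost_kq.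
have := ideal_costD h1 h2; congr (ideal_cost s _ _); rewrite !barE; ring.
Qed.

(* For [t = siegel Q P 0] with [P = bar fq e_-p - bar fp e_-q] and
   [Q = bar fr e_-p - bar fp e_-r], both orthogonal to [s' (be p)], one gets
   [s t s' w = w + vh]; here [bP = b (s P) w] and [bQ = b (s Q) w]. *)
Variables (c0 bP bQ yp yq yr dl : R) (w vh : 'cV[R]_m).
Hypotheses (EbP : bP = c0 * (fq * kp - fp * kq)) (EbQ : bQ = c0 * (fr * kp - fp * kr)).
Hypotheses (Eyp : yp = bQ * bar fq - bar lam * bP * bar fr) (Eyq : yq = - bQ * bar fp).
Hypotheses (Eyr : yr = bar lam * bP * bar fp).
Hypotheses (Ew : w = c0 *: be r) (Evh : vh = yp *: up + yq *: uq + yr *: ur).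
Hypothesis Edl : dl = c0 * om (rv r) * fp * bar fp.

(** A commutator of [t' *m xi] with a root element at [be p] gives the product at cost 4, but with
    [t] in place of its part [tc], which fixes [be p]. The remaining factors of [t] cost 96, and
    exchanging [t] for [tc] takes a commutator with them: 4 + 96 * 2. The second claim reads off the
    entry at [(rv q, r)] of [ka = t' *m xi], at cost 2 * 128. *)
Lemma siegel196 :
  G 196 (siegel (be p) (w + vh) 0 *m siegel (be p) (- (w + dl *: be (rv q))) 0) /\
  ideal_cost s 256 (vh (rv q) 0 - dl + bar fp * fr * om (rv p) * vh p 0
      - fp * bar fp * om (rv r) * vh r 0).
Proof.
have rp : sep r p by rewrite sepC.
have pq' : sep (rv p) (rv q) by rewrite sepNr sepNl.
have pr' : sep (rv p) (rv r) by rewrite sepNr sepNl.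
have qr' : sep (rv q) (rv r) by rewrite sepNr sepNl.
have hp := sep_hbl pq; have hr := sep_hbl rp; have hq := sep_hbr pq.
have [P0 eP0] := named (lcomb3 (rv p) (rv q) (rv r) (bar fq) (- bar fp) 0 : 'cV[R]_m).
have [Q0 eQ0] := named (lcomb3 (rv p) (rv q) (rv r) (bar fr) 0 (- bar fp) : 'cV[R]_m).
have c1 : bar (bar fq) * b (s *m be (rv p)) (be p)
   + bar (- bar fp) * b (s *m be (rv q)) (be p) + bar 0 * b (s *m be (rv r)) (be p) = 0.
  by rewrite -Eup -Euq -Eur -Efp -Efq -Efr !barE; ring.
have c2 : bar (bar fr) * b (s *m be (rv p)) (be p) + bar 0 * b (s *m be (rv q)) (be p)
   + bar (- bar fp) * b (s *m be (rv r)) (be p) = 0.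
  by rewrite -Eup -Euq -Eur -Efp -Efq -Efr !barE; ring.
have := adapted_siegel ss' si pq pr qr c1 c2; rewrite -eP0 -eQ0.
have [t et] := named (siegel Q0 P0 0); have [t' et'] := named (siegel Q0 (- P0) 0).
rewrite -et -et'; case=> Et tt' bt ft [tp tq tr [de tv]].
have [xi exi] := named (s *m t *m s'); have [xi' exi'] := named (s *m t' *m s').
have ixi : mx_inverse xi xi' by rewrite exi exi'; apply: mx_inverse_conj.
have bs' := bisometryV si ss'.
have bxi : bisometry xi.
  by rewrite exi; apply: bisometryM bs'; apply: bisometryM.
have xip : xi *m be p = be p.
  by rewrite exi !mulmx_vec ft -mulmx_vec (proj1 ss') mul1mx.
have sP0 : s *m P0 = bar fq *: up - bar fp *: uq.
  by rewrite eP0 /lcomb3 !mulmx_vecE -Eup -Euq -Eur scale0r addr0 scaleNr.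
have sQ0 : s *m Q0 = bar fr *: up - bar fp *: ur.
  by rewrite eQ0 /lcomb3 !mulmx_vecE -Eup -Euq -Eur scale0r addr0 scaleNr.
have xiw : xi *m w = w + vh.
  rewrite exi et (siegel_conj _ _ _ si ss') sP0 sQ0 siegelE Evh Eyp Eyq Eyr.
  rewrite Ew !bE -Ekp -Ekq -Ekr !barE EbP EbQ.
  by apply/colP=> ?; rewrite !mxE; ring.
have Et' : EU t' := EU_V Et tt'.
have k2 := conj_prod_commutator ss' Et' (mx_inverse_sym tt').
have [ka eka] := named (t' *m s *m t *m s'); rewrite -eka in k2.
have ekaE : ka = t' *m xi by rewrite eka exi !mulmx3; exact: erefl.
have ik : mx_inverse ka (xi' *m t).
  by rewrite ekaE; apply: mx_inverse_mul ixi; apply: mx_inverse_sym.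
have bka : bisometry ka.
  by rewrite ekaE; apply: bisometryM bxi; apply: bisometryV bt tt'.
split; last first.
  have sqr : sep (rv q) r by rewrite sepNl.
  have h : ideal_cost s 256 (ka (rv q) r).
    move=> c k l kl; apply: (@conj_prod_trans _ _ ss' _ _ _ 2 128 ik k2).
    exact: (entry_cost ik bka sqr).
  have := ideal_costM c0 h; congr (ideal_cost s _ _).
  have -> : c0 * ka (rv q) r = (ka *m w) (rv q) 0.
    by rewrite entryE Ew mulmx_vecZ coordZ.
  rewrite ekaE mulmx_vec xiw et' siegelE.
  have P0q : P0 (rv q) 0 = - bar fp.
    by rewrite eP0 /lcomb3 !coordE !beE eqxx ?(sepP pq, sepP qr) /=; ring.
  have Q0q : Q0 (rv q) 0 = 0.
    by rewrite eQ0 /lcomb3 !coordE !beE eqxx ?(sepP pq, sepP qr) /=; ring.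
  have wp : w p 0 = 0 by rewrite Ew coordZ beE (sepP pr) mulr0.
  have wr : w r 0 = c0 by rewrite Ew coordZ beE eqxx mulr1.
  have wq : w (rv q) 0 = 0 by rewrite Ew coordZ beE (sepP qr) mulr0.
  have Q0w : b Q0 (w + vh) = fr * om (rv p) * vh p 0 - fp * om (rv r) * (c0 + vh r 0).
    rewrite eQ0 /lcomb3 2!bDl !bZl !b_bel ?hb_rev // !rev_ordK !coordD wp wr !barE.
    by ring.
  by rewrite !coordE P0q Q0q Q0w wq Edl; ring.
have [M eM] := named (siegel (be p) (w + vh) 0).
have [L eL] := named (siegel (be p) (- (w + dl *: be (rv q))) 0).
have [g eg] := named (rootmx r p c0); have [g' eg'] := named (rootmx r p (- c0)).
have ig : mx_inverse g g' by rewrite eg eg'; apply: rootmxV.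
have Eg : EU g by rewrite eg; apply: EU_rootmx.
have xg : xi *m g *m xi' = M.
  by rewrite eg rootmx_siegel (siegel_conj _ _ _ bxi ixi) -Ew xip xiw eM; exact: erefl.
have := conj_prodJ Et tt' (conj_prod_comm ss' k2 ik Eg ig).
have -> : t *m (ka *m g *m (xi' *m t) *m g') *m t' = M *m (t *m g' *m t').
  by rewrite -xg ekaE !mulmx3 (proj1 tt') mul1mx; exact: erefl.
have [X eX] := named (bar fq *: be (rv p)); have [Y eY] := named (bar fr *: be (rv p)).
have [P1 eP1] := named (- bar fp *: be (rv q)).
have [Q1 eQ1] := named (- bar fp *: be (rv r)).
have [tc etc] := named (siegel Q1 P1 0).
have [tc' etc'] := named (siegel Q1 (- P1) 0).
have [A1 eA1] := named (siegel Y P1 0).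
have [A2 eA2] := named (siegel Q1 X 0).
have [A3 eA3] := named (siegel Y X 0).
have zz : [/\ b X X = 0, b X Y = 0, b Y X = 0 & b Y Y = 0].
  by rewrite eX eY !bE !b_self ?hb_rev // !mulr0.
have zq : [/\ b X P1 = 0, b X Q1 = 0, b Y P1 = 0 & b Y Q1 = 0].
  by rewrite eX eY eP1 eQ1 !bE !b_sep // !mulr0.
have zr : [/\ b P1 P1 = 0, b P1 Q1 = 0, b Q1 P1 = 0 & b Q1 Q1 = 0].
  have rq' : sep (rv r) (rv q) by rewrite sepC.
  by rewrite eP1 eQ1 !bE !b_self ?hb_rev // !b_sep // !mulr0.
have [zXX zXY zYX zYY] := zz; have [zXP zXQ zYP zYQ] := zq; have [zPP zPQ zQP zQQ] := zr.
have sy (x1 x2 : 'cV[R]_m) : b x1 x2 = 0 -> b x2 x1 = 0.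
  by move=> e0; rewrite b_herm e0 !barE mulr0.
(* The vectors [X], [Y], [P1], [Q1] are isotropic and mutually orthogonal, so
   [siegel (Y + Q1) (X + P1) 0] splits bilinearly. *)
have tE : t = (A3 *m A1 *m A2) *m tc.
  rewrite et eA1 eA2 eA3 etc (_ : P0 = X + P1); last first.
    by rewrite eP0 /lcomb3 scale0r addr0 eX eP1.
  rewrite (_ : Q0 = Y + Q1); last by rewrite eQ0 /lcomb3 scale0r addr0 eY eQ1.
  pose F := (zXX, zXY, zYX, zYY, zXP, zXQ, zYP, zYQ, zPP, zPQ, zQP, zQQ,
    sy _ _ zXP, sy _ _ zXQ, sy _ _ zYP, sy _ _ zYQ).
  have orth v (e1 x1 : 'cV[R]_m) z1 (y : 'cV[R]_m) : b v e1 = 0 -> b v x1 = 0 ->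
    b v (siegel e1 x1 z1 *m y) = b v y.
    by move=> v1 v2; rewrite siegelE !bE v1 v2 !mulr0 !addr0.
  apply: mx_ext => y; rewrite !mulmx_vec.
  do 5?[rewrite siegelE ?(bDl, bNl, bZl) ?(orth, F, b0r, b0l) //].
  by apply/colP=> ?; rewrite !mxE; ring.
have A1E : A1 = rootmx (rv q) (rv p) (- (fr * bar fp)).
  by rewrite eA1 eY eP1 siegelZ mulr0 scalerA barK' mulrN rootmx_siegel; exact: erefl.
have A2E : A2 = rootmx (rv p) (rv r) (- (fp * bar fq)).
  rewrite eA2 eQ1 eX siegelZ mulr0 scalerA barN barK' mulNr rootmx_siegel.
  exact: erefl.
have A3E : A3 = siegel (be (rv p)) 0
    (- bar (fr * bar fq) - lam * bar (- bar (fr * bar fq))).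
  rewrite eA3 eY eX siegelZ mulr0 scalerA barK' siegel_center.
  by congr siegel; rewrite !barE; ring.
have hp' : hb (rv p) by rewrite hb_rev.
have qp' : sep (rv q) (rv p) by rewrite sepC.
have iA1 : mx_inverse A1 (rootmx (rv q) (rv p) (- - (fr * bar fp))).
  by rewrite A1E; apply: rootmxV.
have iA2 : mx_inverse A2 (rootmx (rv p) (rv r) (- - (fp * bar fq))).
  by rewrite A2E; apply: rootmxV.
have iA3 := siegelV 0 zYY zYX; rewrite -eA3 in iA3.
have EA1 : EU A1 by rewrite A1E; apply: EU_rootmx.
have EA2 : EU A2 by rewrite A2E; apply: EU_rootmx.
have EA3 : EU A3.
  rewrite A3E; have := EU_center (fr * bar fq) hp'.
  by congr (Defs.EU D (siegel _ _ _)); rewrite !barE; ring.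
have G1 : G 32 A1.
  rewrite A1E; have := ideal_costM (- 1) (ideal_cost_bar (cost_fpr 1 0)).
  rewrite mul1r mul0r addr0 mulN1r barM barK' => /ideal_cost_root; exact.
have G2 : G 32 A2.
  rewrite A2E; have := ideal_costM (- 1) (cost_fpq 1 0).
  rewrite mul1r mul0r addr0 mulN1r => /ideal_cost_root; exact.
have G3 : G 32 A3.
  rewrite A3E; apply: (center_cost ss' hp' (N := 16)).
  have := ideal_costM (- 1) (ideal_cost_bar (ideal_cost16 ss' si pq pr qr)).
  rewrite -Euq -Eur -Efq -Efr mulN1r mulrC => /ideal_cost_root; exact.
have GI : G 96 (A3 *m A1 *m A2) := conj_prodM (conj_prodM G3 G1) G2.
have iI := mx_inverse_mul (mx_inverse_mul iA3 iA1) iA2.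
have EA := EU_M (EU_M EA3 EA1) EA2.
have [I eI] := named (A3 *m A1 *m A2); rewrite -eI in GI iI EA tE.
have [I' eI'] := named (rootmx (rv p) (rv r) (- - (fp * bar fq)) *m
  (rootmx (rv q) (rv p) (- - (fr * bar fp)) *m siegel Y (- X) (- 0 - b X X))).
rewrite -eI' in iI.
have itc : mx_inverse tc tc'.
  by have := siegelV 0 zQQ zQP; rewrite zPP oppr0 addr0 etc etc'; exact.
have btc : bisometry tc.
  by rewrite etc; apply: siegel_bisometry zQQ zQP _; rewrite zPP bar0; ring.
have t'E : t' = tc' *m I'.
  by apply: mx_inverse_uniq tt' _; rewrite tE; apply: mx_inverse_mul iI itc.
have Q1p : b Q1 (be p) = 0 by rewrite eQ1 bZl b_sep ?mulr0 // sepNl.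
have P1p : b P1 (be p) = 0 by rewrite eP1 bZl b_sep ?mulr0 // sepNl sepC.
have tcp : tc *m be p = be p.
  by rewrite etc siegelE Q1p P1p; apply/colP=> ?; rewrite !mxE; ring.
have P1w : b P1 w = 0 by rewrite eP1 Ew bZl bZr b_sep ?mulr0 // sepNl.
have Q1w : b Q1 w = - (fp * (c0 * om (rv r))).
  rewrite eQ1 Ew bZl bZr -{2}[r]rev_ordK b_opp ?hb_rev // !barE; ring.
have tcw : tc *m w = w + dl *: be (rv q).
  rewrite etc siegelE Q1w P1w eP1 Edl; apply/colP=> ?; rewrite !mxE; ring.
have tcg : tc *m g' *m tc' = L.
  rewrite eg' rootmx_siegel (siegel_conj _ _ _ btc itc) tcp scaleNr -Ew mulmx_vecN tcw.
  by rewrite eL; exact: erefl.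
have -> : t *m g' *m t' = I *m L *m I'.
  by rewrite tE t'E -tcg !mulmx3; exact: erefl.
have [L' iL] : exists L', mx_inverse L L'.
  by eexists; rewrite -tcg; exact: mx_inverse_conj itc (mx_inverse_sym ig).
have EL : EU L.
  have -> : L = I' *m (t *m g' *m t') *m I.
    rewrite tE t'E !mulmx3 (proj2 iI) mul1mx -(mulmx3 _ I' I) (proj2 iI) mulmx1.
    by rewrite tcg; exact: erefl.
  exact: (EU_M (EU_M (EU_V EA iI) (EU_M (EU_M Et (EU_V Eg ig)) Et')) EA).
have EL' := EU_V EL iL.
(* The commutator of [I] with the inverse of [L] turns [I *m L *m I'] into [L]. *)
move=> h4; have h := conj_prodM h4 (conj_prod_comm ss' GI iI EL' (mx_inverse_sym iL)).
have e : M *m (I *m L *m I') *m (I *m L' *m I' *m L) = M *m L.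
  rewrite !mulmx3 -(mulmx3 _ I' I) (proj2 iI) mulmx1 -(mulmx3 _ L L') (proj1 iL) mulmx1.
  by rewrite -(mulmx3 _ I I') (proj1 iI) mulmx1; exact: erefl.
by rewrite e eM eL in h; exact: h.
Qed.

Lemma cost_yp : ideal_cost s 64 yp.
Proof.
have := cost_f64 (- (c0 * kr)) (- (bar lam * c0 * kp)) (bar lam * c0 * kq) (c0 * kp).
by congr (ideal_cost s _ _); rewrite Eyp EbP EbQ; ring.
Qed.

Lemma cost_yr : ideal_cost s 160 yr.
Proof.
have := ideal_costM (bar lam * c0) cost_f160.
by congr (ideal_cost s _ _); rewrite Eyr EbP; ring.
Qed.

Lemma vh_entry i : vh i 0 = yp * s i (rv p) + yq * s i (rv q) + yr * s i (rv r).
Proof. by rewrite Evh Eup Euq Eur !coordE -!entryE. Qed.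

(* At [rv q] the coordinate that is removed is that of [vh - dl *: be (rv q)],
   by [siegel196]. *)
Definition strip_cost i : nat := if i == q then 480 else if i == rv q then 640 else 352.

(** Beyond 352 at each index, [q] contributes an excess of 128 and [rv q] one of 288. *)
Lemma sum_strip_cost :
  (\sum_(i | sep i p) strip_cost i = (n.*2 - 2) * 352 + 416)%N.
Proof.
have hp := sep_hbl pq; have qp : sep q p by rewrite sepC.
have hq := sep_hbl qp; have qp' : sep (rv q) p by rewrite sepNl.
have cE : #|[pred i | [&& sep i p, i != q & i != rv q]]| = (n.*2 - 4)%N.
  have := sep_card hp; rewrite (cardD1 q) (cardD1 (rv q)) !inE qp qp' rv_neq //=.
  rewrite (_ : #|_| = #|[pred i | [&& sep i p, i != q & i != rv q]]|).
    by set c := #|_|; lia.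
  by apply: eq_card => i; rewrite !inE; case: (sep i p); rewrite ?andbF ?andbT //= andbC.
rewrite (bigD1 q) //= (bigD1 (rv q)) /=; last by rewrite qp' rv_neq.
rewrite (eq_bigr (fun=> 352%N)) => [|i /andP[/andP[_ iq] iq']]; last first.
  by rewrite /strip_cost (negPf iq) (negPf iq').
rewrite sum_nat_const /strip_cost eqxx (negPf (rv_neq hq)) eqxx.
rewrite (@eq_card _ _ [pred i | [&& sep i p, i != q & i != rv q]]) ?cE; first by lia.
by move=> i; rewrite !inE andbA.
Qed.

(** The coefficients [yp] and [yr] cost 64 and 160; since [yq] is arbitrary, its column enters
    through [s i (rv q)], of cost 256 if [i = q] and 128 otherwise. *)
Lemma coord_cost i : sep i p -> i != rv q -> ideal_cost s (strip_cost i) (vh i 0).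
Proof.
move=> ip iq'; rewrite vh_entry.
have [cE|cE] := eqVneq i q.
  have hq : hb q := sep_hbr pq.
  have c2 := opp_entry_cost ss' si hq.
  have := ideal_costD (ideal_costD (ideal_costM (s i (rv p)) cost_yp)
    (ideal_costM yq c2)) (ideal_costM (s i (rv r)) cost_yr).
  rewrite cE /strip_cost eqxx; congr (ideal_cost s _ _); ring.
have iq : sep i (rv q).
  by rewrite /sep (sep_hbl ip) hb_rev (sep_hbr pq) rev_ordK iq' cE.
have c2 := entry_cost ss' si iq.
have := ideal_costD (ideal_costD (ideal_costM (s i (rv p)) cost_yp)
  (ideal_costM yq c2)) (ideal_costM (s i (rv r)) cost_yr).
rewrite /strip_cost (negPf cE) (negPf iq'); congr (ideal_cost s _ _); ring.
Qed.

Lemma stripped : G (196 + ((n.*2 - 2) * 352 + 416)) (siegel (be p) (vh 0' 0 *: be 0')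
  (b vh w + q2 H vh + lam * vh p 0 - bar (vh p 0))).
Proof.
have [hG hk] := siegel196.
have rp : sep r p by rewrite sepC.
have [hp hq hr] : [/\ hb p, hb q & hb r].
  by rewrite (sep_hbl pq) (sep_hbr pq) (sep_hbl rp).
have pp := b_self hp; have rr := b_self hr.
have pq' : sep p (rv q) by rewrite sepNr.
have qp' : sep (rv q) p by rewrite sepC.
have rq' : sep r (rv q) by rewrite sepNr sepC.
have [de ede] := named (dl *: be (rv q)); rewrite -ede in hG.
have pw : b (be p) w = 0 by rewrite Ew bZr b_sep ?mulr0.
have pde : b (be p) de = 0 by rewrite ede bZr b_sep ?mulr0.
have ww : b w w = 0 by rewrite Ew !bE rr !mulr0.
have wde : b w de = 0 by rewrite ede Ew !bE b_sep ?mulr0.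
have dede : b de de = 0 by rewrite ede !bE b_self ?mulr0 ?hb_rev.
have pvh : b (be p) vh = 0.
  rewrite b_herm Evh !bE -Efp -Efq -Efr Eyp Eyq Eyr !barE.
  by ring: (barlamK).
have [v ev] := named (vh - de).
have pv : b (be p) v = 0 by rewrite ev bDr bNr pvh pde subr0.
have vrp : v (rv p) 0 = 0.
  have := pv; rewrite b_bel // => e0; have o := om_bar p.
  by rewrite -[LHS]mul1r -o mulrAC e0 mul0r.
have dei i : i != rv q -> de i 0 = 0.
  by move=> iq; rewrite ede coordZ beE (negPf iq) mulr0.
have vi i : i != rv q -> v i 0 = vh i 0.
  by move=> iq; rewrite ev coordD coordN dei // subr0.
have vq : v (rv q) 0 = vh (rv q) 0 - dl.
  by rewrite ev coordD coordN ede coordZ beE eqxx mulr1.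
have hv i : sep i p -> root_cost s (strip_cost i) (v i 0).
  move=> ip; apply: ideal_cost_root; have [->|iq] := eqVneq i (rv q); last first.
    by rewrite vi //; apply: coord_cost.
  rewrite vq.
  have rq2 : r != rv q by rewrite (sepP qr).
  have rq3 : r != q by rewrite (sepP qr).
  (* By [siegel196] the coordinate is cheap up to multiples of [bar fp * fr] and of [vh r 0]: 256 +
     32 + 352 = 640. *)
  have c1 := ideal_costM (fp * bar fp * om (rv r)) (coord_cost rp rq2).
  have c2 := cost_fpr (bar (- (om (rv p) * vh p 0))) 0.
  have := ideal_costD (ideal_costD hk (ideal_cost_bar c2)) c1.
  rewrite /strip_cost (negPf (rv_neq hq)) eqxx (negPf rq3) (negPf rq2).
  by congr (ideal_cost s _ _); rewrite !barE; ring.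
have p0 : (p == rv q) = false by rewrite (sepP pq).
have z0 : (0' == rv q) = false by rewrite eq_sym rv_eq rev0 (negPf (hq : q != 0')).
have v0 : v 0' 0 = vh 0' 0 by rewrite vi ?z0.
have vp : v p 0 = vh p 0 by rewrite vi ?p0.
have q2E u : q2 H u = beta u u by [].
have q2v : q2 H v = q2 H vh - beta vh de - beta de vh + beta de de.
  by rewrite !q2E ev -scaleN1r betaDl !betaDr !betaZl !betaZr !barE; ring.
have dede0 : beta de de = 0.
  by rewrite ede betaZl betaZr beta_be rev_ordK beE eq_sym (negPf (rv_neq hq)) !mulr0.
have pwv : b (be p) (w + vh) = 0 by rewrite bDr pw pvh addr0.
have pwd : b (be p) (- (w + de)) = 0 by rewrite bNr bDr pw pde addr0 oppr0.
have vE : w + vh + - (w + de) = v by rewrite ev; apply/colP=> ?; rewrite !mxE; ring.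
rewrite (siegelM _ _ pp pwv pwd) vE in hG.
have zE : 0 + 0 - b (w + vh) (- (w + de)) = b vh w + b vh de.
  by rewrite bNr !bDl !bDr ww wde; ring.
rewrite zE in hG.
have dvh : b de vh = bar dl * om (rv q) * vh q 0.
  by rewrite ede bZl b_bel ?hb_rev // rev_ordK mulrA.
have vhd : b vh de = dl * om q * bar (vh q 0).
  by rewrite ede bZr b_ber ?hb_rev // rev_ordK mulrA.
have bdv : beta de vh = bar dl * ((rv q < n)%:R * vh q 0).
  by rewrite ede betaZl beta_be rev_ordK.
have bvd : beta vh de = dl * ((q < n)%:R * bar (vh q 0)).
  by rewrite ede betaZr beta_ber ?hb_rev // rev_ordK.
have omq : om q = if (q < n)%N then 1 else lam by [].
have omq' : om (rv q) = if (q < n)%N then lam else 1.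
  by rewrite /om rev_lt hb_lt //; case: (q < n)%N.
(* The terms with [dl] have to cancel between the central parameter and [q2 H v]. For positive [q]
   they do. For negative [q] one first conjugates by the root element of [- de], which replaces
   [b vh de] by [b de vh]. *)
case: (boolP (q < n)%N) => qn; last first.
  have mdp : b (be p) (- de) = 0 by rewrite bNr pde oppr0.
  have Ed : EU (siegel (be p) (- de) 0).
    by rewrite ede -scaleNr -rootmx_siegel; apply: EU_rootmx.
  have id : mx_inverse (siegel (be p) (- de) 0) (siegel (be p) de 0).
    have := siegelV 0 pp mdp.
    by rewrite opprK bNl bNr dede ?oppr0 ?addr0 ?oppr0; exact: id.
  have := conj_prodJ Ed id hG.
  have mdv : b (be p) (- de + v) = 0 by rewrite bDr mdp pv addr0.
  rewrite (siegelM _ _ pp mdp pv) (siegelM _ _ pp mdv pde).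
  have -> : - de + v + de = v by apply/colP=> ?; rewrite !mxE; ring.
  move/(strip_coords ss' hp vrp hv); rewrite sum_strip_cost v0 vp.
  congr (G _ (siegel _ _ _)).
  rewrite q2v dede0 bdv bvd bNl bDl bNl dede ev bDl bDr !bNl !bNr.
  rewrite dede dvh vhd omq omq' rev_lt hb_lt // (negPf qn) /=; ring.
move/(strip_coords ss' hp vrp hv): hG; rewrite sum_strip_cost v0 vp.
congr (G _ (siegel _ _ _)).
rewrite q2v dede0 bdv bvd vhd omq rev_lt hb_lt // qn /=; ring.
Qed.

(** The central parameter in [stripped] exceeds that of the product of the three column factors, in
    the order [q], [p], [r], by [W - lam * bar W]. *)
Let W := bar bQ * bP + lam * vh p 0
  - lam * (yp * bar yq * bar (beta up uq)
           + yr * (bar yq * bar (beta ur uq) + bar yp * bar (beta ur up))).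

Lemma cost_center : ideal_cost s 352 W.
Proof.
have pq' : sep p (rv q) by rewrite sepNr.
have [A eA] := named (lam * s p (rv p) - lam * (bar yq * bar (beta up uq)) : R).
have [B eB] := named (lam * s p (rv r)
  - lam * (bar yq * bar (beta ur uq) + bar yp * bar (beta ur up)) : R).
have h1 := cost_f64 (- (A * c0 * kr))
  (- (A * bar lam * c0 * kp) + c0 * bar c0 * bar kp * kp)
  (A * bar lam * c0 * kq - c0 * bar c0 * bar kp * kq) (A * c0 * kp).
have h2 := ideal_costM (B * bar lam * c0 - bar c0 * bar kr * c0) cost_f160.
have h3 := ideal_costM (lam * yq) (entry_cost ss' si pq').
have := ideal_costD (ideal_costD h1 h2) h3; congr (ideal_cost s _ _).
have -> : W = bar bQ * bP + A * yp + B * yr + lam * yq * s p (rv q).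
  rewrite /W Evh !coordE Eup Euq Eur -!entryE eA eB; rewrite -Eup -Euq -Eur; ring.
by rewrite Eyp Eyr EbP EbQ !barE; ring.
Qed.

Hypothesis Dcol : forall k, hb k -> D (q1 (s *m be k), q2 H (s *m be k)).

(** [short_change] started from the coefficient 0, where the element is the identity. *)
Lemma short_factor N y k : hb k -> ideal_cost s N y ->
  G (N * 3) (siegel (be p) (y * q1 (s *m be k) *: be 0') (y * bar y * q2 H (s *m be k))).
Proof.
move=> hk hy; have hp := sep_hbl pq.
have h0 : G 0 (siegel (0 *: be p) (q1 (s *m be k) *: be 0') (q2 H (s *m be k))).
  by rewrite siegelZ bar0 !scale0r !mul0r siegel00; constructor.
have := short_change ss' hp (Dcol hk) (ideal_cost_bar hy) h0.
rewrite !add0r siegelZ barK' scalerA; congr (G _ (siegel _ _ _)); ring.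
Qed.

(** The summands come from [stripped], from the central factor of [W], and from the columns with
    coefficients [yr] and [yp]. *)
Lemma short_yq_count :
  (196 + ((n.*2 - 2) * 352 + 416) + 352 * 2 + 160 * 3 + 64 * 3 = 704 * n + 1284)%N.
Proof. lia. Qed.

(** The element of [stripped] is a product of a central factor and one factor per column; dividing
    by the cheap ones leaves the column with coefficient [yq]. *)
Lemma short_yq : G (704 * n + 1284)
  (siegel (bar yq *: be p) (q1 uq *: be 0') (q2 H uq)).
Proof.
have rp : sep r p by rewrite sepC.
have [hp hq hr] : [/\ hb p, hb q & hb r].
  by rewrite (sep_hbl pq) (sep_hbr pq) (sep_hbl rp).
have pp := b_self hp.
have pe a : b (be p) (a *: be 0') = 0 by rewrite bZr b_zero ?mulr0.
have h0 := stripped.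
have hc := center_cost ss' hp (ideal_cost_root (ideal_costM (- 1) cost_center)).
have hp' : hb (rv p) by rewrite hb_rev.
have hr' : hb (rv r) by rewrite hb_rev.
have h1 := conj_prodV ss' (short_factor hp' cost_yp) (siegelV _ pp (pe _)).
have h2 := conj_prodV ss' (short_factor hr' cost_yr) (siegelV _ pp (pe _)).
have mul a1 z1 a2 z2 : siegel (be p) (a1 *: be 0') z1 *m siegel (be p) (a2 *: be 0') z2
    = siegel (be p) ((a1 + a2) *: be 0') (z1 + z2 - bar a1 * mu * a2).
  rewrite (siegelM _ _ pp (pe _) (pe _)) -scalerDl bZl b_be0l coordZ beE eqxx mulr1.
  by congr (siegel _ _ _); ring.
have bb a : b (a *: be 0') (a *: be 0') = bar a * mu * a.
  by rewrite bZl b_be0l coordZ beE eqxx mulr1; ring.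
rewrite -(scale0r (be 0')) in hc; rewrite -Eup -scaleNr bb in h1.
rewrite -Eur -scaleNr bb in h2.
have := conj_prodM (conj_prodM (conj_prodM h0 hc) h2) h1.
rewrite !mul siegelZ barK' scalerA.
rewrite short_yq_count.
have v0 : vh 0' 0 = yp * q1 up + yq * q1 uq + yr * q1 ur by rewrite Evh !coordE.
congr (G _ (siegel _ _ _)).
  by congr (_ *: _); rewrite v0; ring.
(* The three columns are mutually orthogonal, so [beta_rel] expresses [beta u v] through [beta v u],
   and the mixed terms can be compared. *)
have iso k l : sep k l -> b (s *m be (rv k)) (s *m be (rv l)) = 0.
  by move=> kl; rewrite si b_sep // sepNl sepNr.
have qp : sep q p by rewrite sepC.
have solve (A B C : R) : A + B + C = 0 -> A = - C - B.
  by move=> h; rewrite -[RHS]addr0 -h; ring.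
have rel u v : b u v = 0 ->
    beta u v = - (bar (u 0' 0) * mu * v 0' 0) - lam * bar (beta v u).
  by rewrite beta_rel; apply: solve.
have e1 : b up ur = 0 by rewrite Eup Eur iso.
have e2 : b uq ur = 0 by rewrite Euq Eur iso.
have e3 : b uq up = 0 by rewrite Euq Eup iso.
move/rel: e1 => e1; move/rel: e2 => e2; move/rel: e3 => e3.
have bw : b vh w = bar yp * (c0 * kp) + bar yq * (c0 * kq) + bar yr * (c0 * kr).
  by rewrite Evh Ew !bDl !bZl !bZr Ekp Ekq Ekr.
have q2E u : q2 H u = beta u u by [].
have q2v : q2 H vh = bar yp * yp * beta up up + bar yq * yq * beta uq uq
   + bar yr * yr * beta ur ur + bar yp * yq * beta up uq + bar yq * yp * beta uq up
   + bar yp * yr * beta up ur + bar yr * yp * beta ur up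
   + bar yq * yr * beta uq ur + bar yr * yq * beta ur uq.
  by rewrite q2E Evh !betaDl !betaDr !betaZl !betaZr; ring.
have bw' : b vh w = bar bQ * bP - lam * bar bP * bQ.
  by rewrite bw Eyp Eyq Eyr EbP EbQ !barE; ring: (barlamK).
rewrite bw' q2v !q2E e1 e2 e3 v0 /W /q1 !barE.
by ring: (barlamK).
Qed.

End ShortColumn.

(** * Short root elements with an arbitrary coefficient *)

Section ShortScalar.
Implicit Types (u v : 'cV[R]_m) (i j k l : Theta n) (a c d z : R) (t g : 'M[R]_m).
Variables (s s' : 'M[R]_m).
Hypotheses (ss' : mx_inverse s s') (si : bisometry s).
Local Notation G := (conj_prod s).
Hypothesis Dcol : forall k, hb k -> D (q1 (s *m be k), q2 H (s *m be k)).
Hypothesis Jinv : forall k, hb k -> J D (s' 0' k).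

Lemma ideal_cost0 : ideal_cost s 0 0.
Proof.
move=> c k l _; rewrite mulr0 rootmx_siegel scale0r siegel00; exact: conj_prod0.
Qed.

Lemma ideal_cost_sum (P : pred (Theta n)) (cost : Theta n -> nat) (F : Theta n -> R) :
  (forall i, P i -> ideal_cost s (cost i) (F i)) ->
  ideal_cost s (\sum_(i | P i) cost i) (\sum_(i | P i) F i).
Proof.
move=> h; apply: (big_ind2 (fun N x => ideal_cost s N x)); last exact: h.
  exact: ideal_cost0.
by move=> N x M y hx hy; apply: ideal_costD hx hy.
Qed.

Lemma sum_line_cost r : hb r ->
  (\sum_(i | i != rv r) (if i == r then 256 else if i == 0' then 384 else 128)
   = 256 * n + 384)%N.
Proof.
move=> hr; have r0 : r != rv r by rewrite eq_sym rv_neq.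
have z0 : 0' != rv r by rewrite eq_sym rv_eq rev0.
rewrite (bigD1 r) //= eqxx (bigD1 0') /=; last by rewrite z0 eq_sym.
rewrite [0' == r]eq_sym (negPf hr) eqxx.
rewrite (eq_bigr (fun=> 128%N)) => [|i /andP[/andP[_ /negPf->] /negPf->]//].
rewrite sum_nat_const (@eq_card _ _ [pred i | sep i r]) ?sep_card //; first by lia.
move=> i; rewrite !inE /sep hr /hb /=.
rewrite unfold_in.
by case: (i == 0'); case: (i == r); case: (i == rv r).
Qed.

(** Row [rv r] of [s] times column [rv r] of [s'] is 1, and [s' (rv r) (rv r) = bar (s r r)]. The
    other products contain an entry of cost 256 at [r], 128 at the [2n - 2] separated indices, and
    cost 384 at [0'], where the entry of [s'] lies in [J D]. *)
Lemma line_defect_cost r : hb r ->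
  ideal_cost s (256 * n + 384) (1 - s (rv r) (rv r) * bar (s r r)).
Proof.
move=> hr; have hr' : hb (rv r) by rewrite hb_rev.
have srr : s' (rv r) (rv r) = bar (s r r).
  have := form_inv ss' si (be (rv r)) (be r).
  rewrite b_ber // b_bel // rev_ordK -!entryE -[om (rv r) * s r r]mulrC => e.
  have o := om_bar (rv r).
  have {}e : bar (s' (rv r) (rv r)) = s r r.
    by rewrite -[LHS]mul1r -[RHS]mul1r -o; ring: e.
  by rewrite -e barK'.
rewrite -(sum_line_cost hr).
have <- : \sum_(i | i != rv r) s (rv r) i * s' i (rv r)
    = 1 - s (rv r) (rv r) * bar (s r r).
  have := congr1 (fun A : 'M[R]_m => A (rv r) (rv r)) (proj1 ss').
  rewrite !mxE eqxx (bigD1 (rv r)) //= srr => e.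
  by apply/eqP; rewrite eq_sym subr_eq addrC; apply/eqP; exact: esym e.
apply: ideal_cost_sum => i ir; case: eqP => [->|/eqP irr].
  have := ideal_costM (s' r (rv r)) (opp_entry_cost ss' si hr').
  by rewrite rev_ordK mulrC.
case: eqP => [->|/eqP i0]; first exact: (zero_col_cost ss' si hr' (Jinv hr')).
rewrite mulrC; apply: ideal_costM; apply: (entry_cost ss' si).
by rewrite sepNl sepC /sep /hb i0 irr ir (hr : r != 0').
Qed.

Lemma short_sep_count N : (256 * N + 384 + 384 + 384 + 32 = 256 * N + 1184)%N.
Proof. lia. Qed.

Lemma short_sep_count' N : (704 * N + 1284 + (256 * N + 1184) * 3 = 1472 * N + 4836)%N.
Proof. lia. Qed.

(** With [q = rv l] the column in [short_yq] is column [l]. The difference between [a] and its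
    coefficient [bar yq] is cheap, and [short_change] bridges it at three times its cost. *)
Lemma short_sep p l a : sep p l -> G (1472 * n + 4836)
  (siegel (a *: be p) (q1 (s *m be l) *: be 0') (q2 H (s *m be l))).
Proof.
move=> pl; have pq : sep p (rv l) by rewrite sepNr.
have [q eq] := named (rv l); have lE : l = rv q by rewrite eq rev_ordK.
rewrite -eq in pq; have [hp hq] := (sep_hbl pq, sep_hbr pq).
have [r rp rq] := exists_sep hp hq.
have [pr qr] : sep p r /\ sep q r by rewrite sepC rp sepC rq.
have hr := sep_hbr pr.
have pr' : sep (rv p) r by rewrite sepNl.
have pr2 : sep (rv p) (rv r) by rewrite sepNl sepNr.
have [up eup] := named (s *m be (rv p)); have [uq euq] := named (s *m be (rv q)).
have [ur eur] := named (s *m be (rv r)).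
have [fp efp] := named (b up (be p)); have [fq efq] := named (b uq (be p)).
have [fr efr] := named (b ur (be p)).
have [kp ekp] := named (b up (be r)); have [kq ekq] := named (b uq (be r)).
have [kr ekr] := named (b ur (be r)).
have [c0 ec0] := named (bar a * bar (om (rv r)) * s r r).
have [bP ebP] := named (c0 * (fq * kp - fp * kq)).
have [bQ ebQ] := named (c0 * (fr * kp - fp * kr)).
have [yp eyp] := named (bQ * bar fq - bar lam * bP * bar fr).
have [yq eyq] := named (- bQ * bar fp).
have [yr eyr] := named (bar lam * bP * bar fp).
have [w ew] := named (c0 *: be r).
have [vh evh] := named (yp *: up + yq *: uq + yr *: ur).
have [dl edl] := named (c0 * om (rv r) * fp * bar fp).
have hyq := short_yq ss' si pq pr qr eup euq eur efp efq efr ekp ekq ekr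
  ebP ebQ eyp eyq eyr ew evh edl Dcol.
have c1 := line_defect_cost hr.
have c2 := diag_entry_cost ss' si pr'.
have c3 := diag_entry_cost ss' si pr2.
have c4 := cost_fpr ss' si pq pr qr eup euq eur efp efq efr (bar c0 * bar kp) 0.
have [B eB] := named (1 - s (rv r) (rv r) * bar (s r r)); rewrite -eB in c1.
(* The choice of [c0] makes [bar yq] equal to
   [a * (1 - B) * fp * bar fp] up to a cheap term. *)
have hd : ideal_cost s (256 * n + 1184) (a - bar yq).
  have h1 := ideal_costM (a * (2 - B)) c1.
  have h2 := ideal_costM (- (a * (1 - B) * bar (s r r))) c3.
  have h3 := ideal_costM (- (a * (1 - B) * s (rv p) (rv p))) (ideal_cost_bar c2).
  have := ideal_costD (ideal_costD (ideal_costD h1 h2) h3) c4.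
  rewrite short_sep_count.
  congr (ideal_cost s _ _).
  have op := om_bar (rv p); have or := om_bar (rv r).
  have fpE : fp = om (rv p) * bar (s (rv p) (rv p)).
    by rewrite efp b_ber // eup -entryE.
  have krE : kr = om (rv r) * bar (s (rv r) (rv r)).
    by rewrite ekr b_ber // eur -entryE.
  have E1 : s (rv r) (rv r) * bar (s r r) = 1 - B by rewrite eB; ring.
  have E2 : fp * bar fp = s (rv p) (rv p) * bar (s (rv p) (rv p)).
    by rewrite fpE !barE; ring: op.
  have E3 : bar c0 * bar kr = a * (1 - B).
    by rewrite krE ec0 -E1 !barE; ring: or.
  have -> : a - bar yq = a + bar c0 * bar kp * (fp * bar fr)
     - (bar c0 * bar kr) * (fp * bar fp).
    by rewrite eyq ebQ !barE; ring.
  rewrite E2 E3 !barE; ring: E1.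
have hq' : hb (rv q) by rewrite hb_rev.
have Dq : D (q1 uq, q2 H uq) by rewrite euq; apply: Dcol.
have := short_change ss' hp Dq hd hyq.
rewrite addrC subrK lE euq; rewrite short_sep_count'; exact: id.
Qed.

End ShortScalar.

(** * Preservation of the quadratic form modulo the form parameter *)

Section UnitaryColumns.
Implicit Types (u v : 'cV[R]_m) (i j k l : Theta n) (a c d z : R) (t g s : 'M[R]_m).

Definition qpres s := forall u, D (hsub H (qform H (s *m u)) (qform H u)).

Lemma qform_be k : hb k -> qform H (be k) = (0, 0).
Proof.
move=> hk; rewrite /qform /q1 beE eq_sym (negPf hk).
by rewrite [q2 H _](_ : _ = beta (be k) (be k)) // beta_be beE (negPf (rv_neq hk)) mulr0.
Qed.

Lemma hsubKN (x y : R * R) : hopp H (hsub H x y) = hsub H y x.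
Proof.
case: x y => [x1 x2] [y1 y2]; rewrite /hsub /hadd /hopp /= !barD !barN.
by congr (_, _); ring.
Qed.

Lemma qpresM s t : qpres s -> qpres t -> qpres (s *m t).
Proof.
move=> hs ht u; have := hsubmoduleD (Delta_hsubmodule D) (hs (t *m u)) (ht u).
by rewrite /hsub -haddA [hadd _ (hopp _ _) _]haddA haddNp hadd0p mulmx_vec.
Qed.

Lemma qpresV s s' : qpres s -> mx_inverse s s' -> qpres s'.
Proof.
move=> hs [e _] u; have := hsubmoduleN (Delta_hsubmodule D) (hs (s' *m u)).
by rewrite hsubKN -mulmx_vec e mul1mx.
Qed.

Lemma qpres_col s k : hb k -> qpres s -> D (q1 (s *m be k), q2 H (s *m be k)).
Proof.
move=> hk /(_ (be k)); rewrite (qform_be hk) /hsub /hopp /=.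
by rewrite oppr0 bar0 !mul0r subr0 haddp0.
Qed.

(** The value of the form changes by the action of a scalar [c] on [(a, z)], or on its variant from
    [Delta_bar] for positive [k], up to an element of [Delta_min]. *)
Lemma qpres_short k a z : hb k -> D (a, z) -> qpres (siegel (be k) (a *: be 0') z).
Proof.
move=> hk Dz u; have [c ec] := named (om k * u (rv k) 0 : R).
have [d ed] := named (bar lam * (z * c - bar a * mu * u 0' 0) : R).
have [v ev] := named (siegel (be k) (a *: be 0') z *m u); rewrite -ev.
have vE : v = u + (c * a) *: be 0' + d *: be k.
  by rewrite ev shortE // ed ec !mulrA.
have k0 : (0' == k) = false by rewrite eq_sym; exact: (negPf (hk : k != 0')).
have v0 : q1 v = u 0' 0 + c * a.
  by rewrite /q1 vE !coordE !beE eqxx k0 mulr0 addr0 mulr1.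
have b0 x : beta (be 0') x = 0 by rewrite beta_be ltnn mul0r.
have b0' x : beta x (be 0') = 0.
  rewrite /beta big1 // => i ni; rewrite beE; case: eqP => [e|_]; last by rewrite mulr0.
  by move: ni; rewrite -[i]rev_ordK e rev0 ltnn.
have q2E x : q2 H x = beta x x by [].
have kk : beta (be k) (be k) = 0.
  by rewrite beta_be beE (negPf (rv_neq hk)) mulr0.
have v2 : q2 H v = q2 H u + d * beta u (be k) + bar d * beta (be k) u.
  rewrite !q2E vE !betaDl !betaDr !betaZl !betaZr !b0 !b0' kk.
  by ring.
have hE : hsub H (qform H v) (qform H u) =
    (a * c, q2 H v - q2 H u + bar c * bar a * mu * u 0' 0).
  rewrite /hsub /hadd /hopp /qform /= v0 /q1 !barE; congr (_, _); ring.
have act x y : D (a, x) -> D (a * c, bar c * c * x + (y - lam * bar y)).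
  move=> /(hsubmoduleA (Delta_hsubmodule D) c) Dx.
  have Dm : D (0, y - bar y * lam) by apply: Delta_ge_min; exists y.
  have := hsubmoduleD (Delta_hsubmodule D) Dx Dm; rewrite /hact /hadd /=.
  by congr (D (_, _)); ring.
rewrite hE v2 beta_ber // beta_be.
have [kn|kn] := boolP (k < n)%N.
  have rkn : (rv k < n)%N = false by rewrite rev_lt hb_lt // kn.
  have omE : om k = 1 by rewrite /om kn.
  have := act _ (bar c * bar a * mu * u 0' 0) (Delta_bar Dz).
  rewrite rkn; congr (D (_, _)).
  have uE : u (rv k) 0 = c by rewrite ec omE mul1r.
  by rewrite uE ed !barE /=; ring: (barlamK).
have rkn : (rv k < n)%N by rewrite rev_lt hb_lt.
have omE : om k = lam by rewrite /om (negPf kn).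
have := act _ 0 Dz; rewrite rkn; congr (D (_, _)).
have uE : u (rv k) 0 = bar lam * c by rewrite ec omE; ring: (barlamK).
by rewrite uE ed !barE /=; ring: (barlamK).
Qed.

End UnitaryColumns.

(** * Short root elements for a unitary matrix *)

Section UnitaryShort.
Implicit Types (u v : 'cV[R]_m) (i j k l : Theta n) (a c d z : R) (t g s : 'M[R]_m).

Definition uni s s' := [/\ mx_inverse s s', bisometry s & qpres s].

Lemma uniP s : unitary D s -> exists s', uni s s'.
Proof. by case=> [[s' ss'] si qs]; exists s'; split=> // u v; rewrite !bfE. Qed.

Lemma uniM s s' t t' : uni s s' -> uni t t' -> uni (s *m t) (t' *m s').
Proof.
case=> ss' si qs [tt' ti qt]; split; first exact: mx_inverse_mul.
  exact: bisometryM.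
exact: qpresM.
Qed.

Lemma uniV s s' : uni s s' -> uni s' s.
Proof.
case=> ss' si qs; split; [exact: mx_inverse_sym | exact: bisometryV si ss' |].
exact: qpresV qs ss'.
Qed.

(** A Weyl element carries the result from an index [p] separated from [l] to [k], so [k] and [l]
    may be related. *)
Lemma short_unitary s s' k l a : uni s s' -> hb k -> hb l ->
  conj_prod s (1472 * n + 4836)
    (siegel (a *: be k) (q1 (s *m be l) *: be 0') (q2 H (s *m be l))).
Proof.
move=> us hk hl; have [_ _ qs'] := uniV us; have [ss' si qs] := us.
have Dcol i : hb i -> D (q1 (s *m be i), q2 H (s *m be i)).
  by move=> hi; apply: qpres_col.
have Jinv i : hb i -> J D (s' 0' i).
  by move=> /qpres_col/(_ qs') h; rewrite entryE; exists (q2 H (s' *m be i)).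
have [p pk pl] := exists_sep hk hl; have kp : sep k p by rewrite sepC.
have h := short_sep ss' si Dcol Jinv a pl.
have [w [w' [Ew iw bw wk [_ w0]]]] := weyl kp (mulr1 1).
have := conj_prodJ Ew iw h; rewrite (siegel_conj _ _ _ bw iw).
by rewrite !mulmx_vecZ wk w0 scale1r.
Qed.

Section ShortElements.
Variable k : Theta n.
Hypothesis hk : hb k.

Definition short_in s N (p : R * R) :=
  D p /\ conj_prod s N (siegel (om k *: be k) (p.1 *: be 0') p.2).

Lemma short_inD s N M (p p' : R * R) : short_in s N p -> short_in s M p' ->
  short_in s (N + M) (hadd H p p').
Proof.
case=> Dp Gp [Dp' Gp']; split; first exact: (hsubmoduleD (Delta_hsubmodule D) Dp Dp').
have kk : b (om k *: be k) (om k *: be k) = 0 by rewrite bZl bZr b_self ?mulr0.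
have k0 c : b (om k *: be k) (c *: be 0') = 0.
  by rewrite bZl bZr b_zero ?mulr0.
have := conj_prodM Gp Gp'; rewrite (siegelM _ _ kk (k0 _) (k0 _)).
rewrite -scalerDl bZl b_be0l coordZ beE eqxx mulr1 /hadd /=.
by rewrite mulrA; exact: id.
Qed.

Lemma short_in_col s s' l (t : R) : uni s s' -> hb l ->
  short_in s (1472 * n + 4836) (t * q1 (s *m be l), t * bar t * q2 H (s *m be l)).
Proof.
move=> us hl; have [ss' si qs] := us; split.
  have := hsubmoduleA (Delta_hsubmodule D) t (qpres_col hl qs).
  by rewrite /hact /=; congr (D (_, _)); ring.
have := short_unitary (bar t * om k) us hk hl.
by rewrite -scalerA siegelZ barK' scalerA [bar t * t]mulrC.
Qed.

Lemma short_in_ideal s s' N (x : R) a z : uni s s' -> D (a, z) -> ideal_cost s N x ->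
  short_in s (N * 3) (x * a, x * bar x * z).
Proof.
case=> ss' si qs Dz hx; split.
  have := hsubmoduleA (Delta_hsubmodule D) x Dz.
  by rewrite /hact /=; congr (D (_, _)); ring.
have h0 : conj_prod s 0 (siegel (0 *: be k) (a *: be 0') z).
  by rewrite siegelZ bar0 !scale0r !mul0r siegel00; constructor.
have := short_change ss' hk Dz (ideal_costM (om k) (ideal_cost_bar hx)) h0.
rewrite !add0r mulrC -scalerA siegelZ barK' scalerA /= [bar x * x]mulrC; exact: id.
Qed.

Lemma short_in_diag_count N : (1472 * N + 4836 + (1472 * N + 4836) + (1472 * N + 4836)
  + (384 + 256) * 3 = (1472 * N + 4836) * 3 + 1920)%N.
Proof. lia. Qed.

(** In column [j] of the conjugate of [s] by a short element at [rv j], the coordinate at [0']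
    contains [o * a * (s 0' 0' - s j j)]. Columns [j] and [rv j] of [s] cancel two further terms;
    the rest is [a] times an element of cost 384 + 256. *)
Lemma short_in_diag s s' j a : uni s s' -> hb j -> J D a ->
  exists x, short_in s ((1472 * n + 4836) * 3 + 1920) ((s 0' 0' - s j j) * a, x).
Proof.
move=> us hj [z Dz]; have [ss' si qs] := us.
have hj' : hb (rv j) by rewrite hb_rev.
have [z' i0] := short_inverse a z hj'.
have [g eg] := named (siegel (be (rv j)) (a *: be 0') z).
have [g' eg'] := named (siegel (be (rv j)) ((- a) *: be 0') z').
have ig : mx_inverse g g' by rewrite eg eg'.
have Eg : EU g by rewrite eg; apply: EU_short.
have ug : uni g g'.
  split; [exact: ig | rewrite eg | rewrite eg].
    exact: (short_bisometry hj' Dz).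
  exact: (qpres_short hj' Dz).
have ut := uniM (uniM (uniV ug) us) ug.
have [o eo] := named (om (rv j)); have oo : o * bar o = 1.
  by rewrite eo om_bar.
have [c ec] := named (bar lam * z * o).
have j0 : (0' == j) = false by rewrite eq_sym; exact: (negPf (hj : j != 0')).
have j0' : (0' == rv j) = false by rewrite eq_sym; exact: (negPf (hj' : rv j != 0')).
have gj : g *m be j = be j + (o * a) *: be 0' + c *: be (rv j).
  rewrite eg shortE // rev_ordK !beE eqxx j0 -eo /=.
  apply/colP=> ?; rewrite !mxE ec /=; ring.
have tj : q1 (g' *m s *m g *m be j) = s 0' j + o * a * s 0' 0' + c * s 0' (rv j)
   - o * a * (s j j + o * a * s j 0' + c * s j (rv j)).
  rewrite /q1 !mulmx_vec gj eg' shortE // !coordE !beE eqxx j0' rev_ordK -eo /=.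
  by rewrite !mulmx_vecE !coordE -!entryE; ring.
have h1 : short_in s (1472 * n + 4836) (bar o * q1 (g' *m s *m g *m be j),
    bar o * bar (bar o) * q2 H (g' *m s *m g *m be j)).
  have [Dt Gt] := short_in_col (bar o) ut hj; split; first exact: Dt.
  have it := mx_inverse_conj (mx_inverse_sym ig) ss'.
  rewrite -[(1472 * n + 4836)%N]muln1; apply: (conj_prod_trans ss' it) Gt.
  apply: conj_prod1; exists g', g, s.
  by split; [exact: EU_V Eg ig | exact: mx_inverse_sym | left | ].
have h2 := short_in_col (- bar o) us hj.
have h3 := short_in_col (- (bar o * c)) us hj'.
have Ja : J D a by exists z.
have c1 := ideal_costM o (zero_col_cost ss' si hj Ja).
have c2 := ideal_costM c (opp_entry_cost ss' si hj).
have h4 := short_in_ideal us Dz (ideal_costD c1 c2).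
have := short_inD (short_inD (short_inD h1 h2) h3) h4.
rewrite short_in_diag_count; set P := hadd _ _ _ => hP.
have <- : P.1 = (s 0' 0' - s j j) * a.
  by rewrite /P /hadd /= tj /q1 -!entryE; ring: oo.
by exists P.2; rewrite -surjective_pairing.
Qed.

End ShortElements.
End UnitaryShort.

(** * Translation to the elementary matrices [Tij] and [Ti] *)

Section Translate.

Lemma ideal_cost_Tij (s s' : 'M[R]_m) N M (k l : Theta n) (x : R) :
  mx_inverse s s' -> sep k l ->
  ideal_cost s N x -> (N <= M)%N -> ~~ odd (M - N) ->
  product_of_conjugates D M s (Tij H k l x).
Proof.
move=> ss' kl hx NM ev; have h := sepP kl.
apply/conj_prodP/(conj_prod_pad ss' _ NM ev).
rewrite -[l]rev_ordK Tij_root ?h // -rootmx_siegel mulrC; apply: hx.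
by rewrite sepNr.
Qed.

Lemma short_in_Ti (s s' : 'M[R]_m) N M (k : Theta n) (x z : R) :
  mx_inverse s s' -> hb k ->
  short_in k s N (x, z) -> (N <= M)%N -> ~~ odd (M - N) ->
  Delta_pow D (- eps k) (x, om k * bar lam * z) /\
  product_of_conjugates D M s (Ti H k x (om k * bar lam * z)).
Proof.
move=> ss' hk [Dp Gp] NM ev; split; first exact/Delta_pow_short.
by rewrite Ti_short //; apply/conj_prodP/(conj_prod_pad ss' Gp NM ev).
Qed.

End Translate.

End HermitianFormRing.

(* Numerals above 5000 are parsed as [Nat.of_num_uint _], which [lia] does not
   evaluate. *)
Lemma short_bound1 n : (1472 * n + 4836 <= 1600 * n + 5764)%N.
Proof. rewrite (_ : 5764%N = 1441 * 4)%N; last by apply/eqP; vm_compute. lia. Qed.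

Lemma short_parity1 n : ~~ odd (1600 * n + 5764 - (1472 * n + 4836)).
Proof. rewrite (_ : 5764%N = 1441 * 4)%N; last by apply/eqP; vm_compute. lia. Qed.

Lemma short_bound2 n : ((1472 * n + 4836) * 3 + 1920 <= 4800 * n + 16812)%N.
Proof. rewrite (_ : 16812%N = 4203 * 4)%N; last by apply/eqP; vm_compute. lia. Qed.

Lemma short_parity2 n : ~~ odd (4800 * n + 16812 - ((1472 * n + 4836) * 3 + 1920)).
Proof. rewrite (_ : 16812%N = 4203 * 4)%N; last by apply/eqP; vm_compute. lia. Qed.

Theorem theorem56 (n : nat) (R : comNzRingType) (H : hermitianRing R)
    (D : oddFormParameter H) (s : 'M[R]_(n.*2.+1)) (i j k l : Theta n) (a : R) :
  (3 <= n)%N ->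
  unitary D s ->
  hb i -> hb j -> hb k -> hb l ->
  k != l -> k != rev_ord l ->
  i != j -> i != rev_ord j ->
  J D a ->
  (* (i) *)
  product_of_conjugates D 160 s (Tij H k l (s i j)) /\
  (* (ii) *)
  product_of_conjugates D 320 s (Tij H k l (s i (rev_ord i))) /\
  (* (iii) *)
  product_of_conjugates D 480 s (Tij H k l (s i (theta0 n) * a)) /\
  (* (iv) *)
  product_of_conjugates D 480 s (Tij H k l (bar H a * mu H * s (theta0 n) j)) /\
  (* (v) *)
  product_of_conjugates D 480 s (Tij H k l (s i i - s j j)) /\
  (* (vi) *)
  product_of_conjugates D 960 s
    (Tij H k l (s i i - s (rev_ord i) (rev_ord i))) /\
  (* (vii) *)
  (let x := q1 (col j s) in
   let y := lamz H (- ((eps k + 1) %/ 2)%Z) * q2 H (col j s) in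
   Delta_pow D (- eps k) (x, y) /\
   product_of_conjugates D (1600 * n + 5764) s (Ti H k x y)) /\
  (* (viii) *)
  (exists x : R,
     let y := (s (theta0 n) (theta0 n) - s j j) * a in
     Delta_pow D (- eps k) (y, x) /\
     product_of_conjugates D (4800 * n + 16812) s (Ti H k y x)).

Proof.
move=> n3 us hi hj hk hl kl kl' ij ij' Ja.
have [s' us'] := uniP us; have [ss' si qs] := us'.
have ske : sep k l by rewrite /sep hk hl kl kl'.
have sij : sep i j by rewrite /sep hi hj ij ij'.
(* The bounds 128, 256, 384, 384, 384 and 768 have the parity of the numbers claimed in (i) to (vi),
   so padding applies. *)
split; first exact: (ideal_cost_Tij ss' ske (entry_cost D n3 ss' si sij)).
split; first exact: (ideal_cost_Tij ss' ske (opp_entry_cost D n3 ss' si hi)).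
split; first exact: (ideal_cost_Tij ss' ske (zero_col_cost n3 ss' si hi Ja)).
split; first exact: (ideal_cost_Tij ss' ske (zero_row_cost n3 ss' si hj Ja)).
split; first exact: (ideal_cost_Tij ss' ske (diag_entry_cost D n3 ss' si sij)).
split; first exact: (ideal_cost_Tij ss' ske (opp_diag_entry_cost D n3 ss' si hi)).
split.
  have hG := short_in_col n3 hk 1 us' hj.
  have := short_in_Ti ss' hk hG (short_bound1 n) (short_parity1 n).
  rewrite bar1 !mul1r mulmx_be.
  have -> : lamz H (- ((eps k + 1) %/ 2)%Z) = om H k * bar H (lam H).
    by rewrite /eps /om; case: ifP => _ /=; rewrite ?expr0 ?expr1; ring: (barlamK H).
  exact: id.
have [x hx] := short_in_diag n3 hk us' hj Ja.
have [h1 h2] := short_in_Ti ss' hk hx (short_bound2 n) (short_parity2 n).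
by exists (om H k * bar H (lam H) * x).
Qed.
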